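(* Let $H$ be a real separable symplectic Hilbert space with compatible symplectic form, inner product and almost complex structure $J$. Let $\lambda,\mu\in\Lambda(H)$ and assume $\mu=U(\lambda)$ with a unitary operator $U\in\mathcal{U}(H_J)$ such that $U-\mathrm{Id}$ is compact (so that $\mathcal{F}\Lambda_\lambda(H)=\mathcal{F}\Lambda_\mu(H)$). Let $\{\mathbf{c}(t)\}_{t\in[0,1]}$ be a continuous curve in $\mathcal{F}\Lambda_\lambda(H)=\mathcal{F}\Lambda_\mu(H)$. Then the difference $$\mathbf{Mas}(\{\mathbf{c}(t)\},\lambda)-\mathbf{Mas}(\{\mathbf{c}(t)\},\mu)$$ depends only on the end points $\mathbf{c}(0)$ and $\mathbf{c}(1)$.
   Context: Compatible means $\omega(x,y)=\langle Jx,y\rangle$ with $J$ orthogonal, $J^2=-\mathrm{Id}$. $H_J$ is $H$ as a complex Hilbert space via $J$ with Hermitian inner product $\langle\cdot,\cdot\rangle-\sqrt{-1}\,\omega$; $\mathcal{U}(H_J)$ its unitary group (norm topology). $\Lambda(H)$ is the set of Lagrangian subspaces ($\mu=\mu^\circ$, the $\omega$-annihilator) with metric $\|\mathcal{P}_\mu-\mathcal{P}_\nu\|$, $\mathcal{P}_\mu$ the orthogonal projection onto $\mu$. $(\mu,\lambda)$ is a Fredholm pair if $\dim(\mu\cap\lambda)<\infty$ and $\mu+\lambda$ is closed of finite codimension; $\mathcal{F}\Lambda_\lambda(H)=\{\mu\in\Lambda(H):(\mu,\lambda)\text{ Fredholm pair}\}$. $\mathcal{U}_{\mathcal{F}}(H_J)=\{U\in\mathcal{U}(H_J):U+\mathrm{Id}\text{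 Fredholm}\}$. The Souriau map is $\mathcal{S}_\lambda(\mu)=(\mathrm{Id}-2\mathcal{P}_\mu)(2\mathcal{P}_\lambda-\mathrm{Id})$; it maps $\mathcal{F}\Lambda_\lambda(H)$ continuously into $\mathcal{U}_{\mathcal{F}}(H_J)$. Unitary Maslov index: for a continuous path $\mathbf{d}:[0,1]\to\mathcal{U}_{\mathcal{F}}(H_J)$ there exist a partition $0=t_0<\dots<t_N=1$ and $0<\varepsilon_j<\pi$ such that for all $t\in[t_{j-1},t_j]$ the points $e^{\sqrt{-1}(\pi\pm\varepsilon_j)}$ lie in the resolvent set of $\mathbf{d}(t)$ and the spectrum of $\mathbf{d}(t)$ in the arc $\{e^{\sqrt{-1}(\pi+\theta)}:|\theta|\le\varepsilon_j\}$ consists of finitely many eigenvalues of finite multiplicity. Put $k(t,\varepsilon)=\sum_{0\le\theta\le\varepsilon}\dim_{\mathbb{C}}\operatorname{Ker}(\mathbf{d}(t)-e^{\sqrt{-1}(\pi+\theta)})$ and $\mathbf{M}(\{\mathbf{d}(t)\})=\sum_{j=1}^N(k(t_j,\varepsilon_j)-k(t_{j-1},\varepsilon_j))$; this is independent of the choices. The Maslov index of a continuous path $\mathbf{c}$ in $\mathcal{F}\Lambda_\lambda(H)$ is $\mathbf{Mas}(\{\mathbf{c}(t)\},\lambda)=\mathbf{M}(\{\mathcal{S}_\lambda(\mathbf{c}(t))\})$. (The difference in the claim is called the Hörmander index $\sigma(\mathbf{c}(0),\mathbf{c}(1);\lambda,\mu)$.) *)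

(* Defs.v *)
From HB Require Import structures.
From mathcomp Require Import all_boot all_order all_algebra.
From mathcomp Require Import complex.
From mathcomp Require Import all_classical all_reals all_analysis.

Set Implicit Arguments.
Unset Strict Implicit.
Unset Printing Implicit Defensive.

Import Order.TTheory GRing.Theory Num.Theory.
Import numFieldNormedType.Exports.

Local Open Scope classical_set_scope.
Local Open Scope ring_scope.

Section LinearAlgebra.
Variables (K : nzRingType) (V : lmodType K).
Implicit Types S W : set V.

Definition lin_indep n (v : 'I_n -> V) : Prop :=
  forall a : 'I_n -> K, \sum_i a i *: v i = 0 -> forall i, a i = 0.

Definition span n (v : 'I_n -> V) : set V :=
  [set x | exists a : 'I_n -> K, x = \sum_i a i *: v i].

Definition has_dim S (n : nat) : Prop :=
  exists v : 'I_n -> V, lin_indep v /\ S = span v.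

Definition finite_dim S : Prop := exists n, has_dim S n.

(* 0 when S is not finite-dimensional. *)
Definition dim S : nat := xget 0%N [set n | has_dim S n].

Definition add_set S W : set V := [set x + y | x in S & y in W].

Definition finite_codim S : Prop :=
  exists2 W, finite_dim W & add_set S W = setT.

End LinearAlgebra.

(* A real separable Hilbert space (the norm is the one of the inner product
   ip) with a symplectic form and a compatible almost complex structure. *)
Record symplecticHilbert (R : realType) := SymplecticHilbert {
  carrier :> completeNormedModType R ;
  ip : {dot carrier for idfun} ;
  ip_norm : forall x, ip x x = `|x| ^+ 2 ;
  carrier_separable : exists2 D : set carrier, countable D & dense D ;
  omega : {skew_symmetric carrier} ;
  omega_bounded : exists M, forall x y, `|omega x y| <= M * `|x| * `|y| ;
  omega_nondegenerate : forall x, (forall y, omega x y = 0) -> x = 0 ;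
  J : {linear carrier -> carrier} ;
  J_orthogonal : forall x y, ip (J x) (J y) = ip x y ;
  J_square : forall x, J (J x) = - x ;
  omega_compatible : forall x y, omega x y = ip (J x) y
}.

Section ComplexStructure.
Variables (R : realType) (H : symplecticHilbert R).
Local Notation C := (complex R).

(* H_J: the underlying additive group of H, with C acting through J. *)
Definition HJ : Type := carrier H.

HB.instance Definition _ := GRing.Zmodule.copy HJ (carrier H).

Definition HJ_scale (z : C) (x : HJ) : HJ :=
  complex.Re z *: (x : H) + complex.Im z *: J H x.


Fact HJ_scaleA a b x : HJ_scale a (HJ_scale b x) = HJ_scale (a * b) x.
Proof.
case: a b => [a1 a2] [b1 b2]; rewrite /HJ_scale /=.
have -> : J H (b1 *: (x : H) + b2 *: J H x) = b1 *: J H x - b2 *: (x : H).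
  by rewrite linearD !linearZ /= [X in _ + b2 *: X]J_square scalerN.
rewrite !scalerDr scalerN !scalerDl !scaleNr !scalerA -[LHS]addrA -[RHS]addrA.
by congr (_ + _); rewrite addrA addrC.
Qed.

Fact HJ_scale1 : left_id 1 HJ_scale.
Proof. by move=> x; rewrite /HJ_scale /= scale1r scale0r addr0. Qed.

Fact HJ_scaleDr : right_distributive HJ_scale +%R.
Proof.
by move=> z x y; rewrite /HJ_scale (linearD (J H)) !scalerDr addrACA.
Qed.

Fact HJ_scaleDl x : {morph HJ_scale^~ x : a b / a + b}.
Proof.
by move=> [a1 a2] [b1 b2]; rewrite /HJ_scale /= !scalerDl addrACA.
Qed.

HB.instance Definition _ := GRing.Zmodule_isLmodule.Build C HJ
  HJ_scaleA HJ_scale1 HJ_scaleDr HJ_scaleDl.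

(* The Hermitian inner product <x, y> - i omega(x, y), linear in x. *)
Definition hprod (x y : HJ) : C := Complex (ip H x y) (- omega H x y).

(* The unitary group U(H_J). *)
Definition unitary : set (HJ -> HJ) :=
  [set T | [/\ linear T, forall x y, hprod (T x) (T y) = hprod x y &
             forall y, exists x, T x = y]].

Definition bounded_op (T : H -> H) : Prop :=
  exists M : R, forall x, `|T x| <= M * `|x|.

Definition compact_op (T : H -> H) : Prop :=
  precompact (T @` [set x : H | `|x| <= 1]).

(* Operator norm; meaningful for bounded linear T. *)
Definition opnorm (T : H -> H) : R :=
  sup [set `|T x| | x in [set x | `|x| <= 1]].

Definition annihilator (mu : set H) : set H :=
  [set x | forall y, mu y -> omega H x y = 0].

(* Lambda(H). Being a closed linear subspace is implied by the equality. *)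
Definition Lagrangian : set (set H) := [set mu | mu = annihilator mu].

(* Orthogonal projection onto mu, for mu a closed subspace. *)
Definition proj (mu : set H) (x : H) : H :=
  xget 0 [set p | mu p /\ forall y, mu y -> ip H (x - p) y = 0].

Definition lag_dist (mu nu : set H) : R :=
  opnorm (fun x => proj mu x - proj nu x).

Definition Fredholm_pair (mu lam : set H) : Prop :=
  [/\ finite_dim (mu `&` lam), closed (add_set mu lam) &
      finite_codim (add_set mu lam)].

(* F Lambda_lam(H) *)
Definition FLambda (lam : set H) : set (set H) :=
  [set mu | Lagrangian mu /\ Fredholm_pair mu lam].

(* Continuous curves [0, 1] -> F Lambda_lam(H); only the values of c on [0, 1]
   matter. *)
Definition FLambda_curve (lam : set H) (c : R -> set H) : Prop :=
  (forall t, t \in `[0, 1] -> FLambda lam (c t)) /\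
  (forall t, t \in `[0, 1] ->
     lag_dist (c s) (c t) @[s --> within `[0, 1] (nbhs t)] --> (0 : R)).

Definition souriau (lam mu : set H) (x : HJ) : HJ :=
  let y := 2 *: proj lam x - x : H in y - 2 *: proj mu y.

Definition eigenspace (T : HJ -> HJ) (z : C) : set HJ := [set x | T x = z *: x].

Definition resolvent_set (T : HJ -> HJ) : set C :=
  [set z | exists S : HJ -> HJ, [/\ linear S, bounded_op S,
     forall x, S (T x - z *: x) = x & forall x, T (S x) - z *: S x = x]].

Definition spectrum (T : HJ -> HJ) : set C := ~` resolvent_set T.

(* cis a = exp(i a) *)
Definition cis (a : R) : C := Complex (cos a) (sin a).

(* The arc of opening e on both sides of -1. *)
Definition arc (e : R) : set C := [set cis (pi + th) | th in `[- e, e]].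

Definition crossing_dim (d : R -> HJ -> HJ) (t e : R) : int :=
  \sum_(th \in `[0, e]) (dim (eigenspace (d t) (cis (pi + th))))%:Z.

(* t 0 < ... < t N is the partition; e j is attached to [t j, t j.+1]. *)
Definition maslov_partition (d : R -> HJ -> HJ) (N : nat) (t e : nat -> R) :
    Prop :=
  [/\ t 0%N = 0, t N = 1, forall j, (j < N)%N -> t j < t j.+1,
      forall j, (j < N)%N -> 0 < e j < pi &
      forall j s, (j < N)%N -> s \in `[t j, t j.+1] ->
        [/\ resolvent_set (d s) (cis (pi + e j)),
            resolvent_set (d s) (cis (pi - e j)),
            finite_set (spectrum (d s) `&` arc (e j)) &
            forall z, (spectrum (d s) `&` arc (e j)) z ->
              eigenspace (d s) z <> [set 0] /\
              finite_dim (eigenspace (d s) z)]].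

Definition is_unitary_maslov (d : R -> HJ -> HJ) (m : int) : Prop :=
  exists (N : nat) (t e : nat -> R), maslov_partition d N t e /\
    m = \sum_(j < N)
      (crossing_dim d (t j.+1) (e j) - crossing_dim d (t j) (e j)).

(* The unitary Maslov index M({d(t)}): the common value of all admissible
   partitions. *)
Definition unitary_maslov (d : R -> HJ -> HJ) : int :=
  xget 0 [set m | is_unitary_maslov d m].

Definition Mas (c : R -> set H) (lam : set H) : int :=
  unitary_maslov (fun t => souriau lam (c t)).

End ComplexStructure.

(* Main.v *)
(* With tau_l the reflection 2 P_l - Id, the Souriau map is
   S_l(nu) = - tau_nu tau_l, hence S_mu(nu) = S_l(nu) K with the fixed unitary
   K = tau_l tau_mu, and K - Id is compact because mu = U(l).  A path
   K_s = f_s(K) of unitaries = Id + compact joins Id to K, where f_s is the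
   hyperbolic Moebius map of the circle with fixed points 1 and some w outside
   the spectrum of K.  Two curves c, c' with the same end points give paths
   d K_s and d' K_s in U_F with the same end points for each s, and the integer
   M(d K_s) - M(d' K_s) is locally constant in s: a partition for s0 still works
   near s0, and all contributions at interior partition points telescope.

   Everything rests on counting the eigenvalues of a unitary T in an arc
   variationally: the count is n as soon as the quadratic form Re <T x, x> has a
   gap at cos h between an n-dimensional subspace and its orthogonal complement,
   a condition which is open in T.  Compactness only enters through the property
   "|T x - x| <= e |x| on a subspace of finite codimension, for every e > 0". *)
Require Import Defs.
From mathcomp Require Import all_boot all_order all_algebra.
From mathcomp Require Import complex.
From mathcomp Require Import all_classical all_reals all_analysis.
From mathcomp Require Import ring lra.
Import Defs Order.TTheory GRing.Theory Num.Theory.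
Import numFieldNormedType.Exports.
Set Implicit Arguments.
Unset Strict Implicit.
Unset Printing Implicit Defensive.
Local Open Scope classical_set_scope.
Local Open Scope ring_scope.

(** Along the homotopy neither Maslov index need be constant: the end points [d s 0] and [d s 1]
    move with s and may carry eigenvalues through -1, where a crossing count jumps. What is stable
    is the difference of two crossing counts of the same operator, since it counts eigenvalues in an
    arc that avoids -1. The spectral theorem for T is replaced by the self-adjoint T + T^-1, which
    turns e^it into 2 cos t, and by the factorization of T^2 + 1 - 2 cos t T; they convert lower
    bounds for T - e^it into gaps of a quadratic form and back. The Moebius path suits this setting:
    it is a quotient of two first-degree polynomials in K, so unitarity, continuity in s and
    closeness to Id follow by computation once the denominator is bounded below. The Fredholm
    condition is used as a lower bound for |T x + x| on a subspace of finite codimension. For the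
    Souriau map this is equivalent to the Fredholm pair condition, and it survives composition with
    K; hence the two spaces of Lagrangians coincide. *)

Section Dimension.
Variables (K : fieldType) (V : lmodType K).

Lemma exists_kernel_comb m n (A : 'M[K]_(m, n)) : (n < m)%N ->
  exists2 u : 'rV[K]_m, u != 0 & u *m A = 0.
Proof.
move=> nm; have : kermx A != 0.
  rewrite -mxrank_eq0 mxrank_ker subn_eq0 -ltnNge.
  exact: leq_ltn_trans (rank_leq_col A) nm.
case/rowV0Pn => u /sub_kermxP uA u0; by exists u.
Qed.

Lemma span_sum n (v : 'I_n -> V) (I : finType) (a : I -> K) (w : I -> V) :
  (forall i, span v (w i)) -> span v (\sum_i a i *: w i).
Proof.
move=> /(_ _)/cid-/all_sig[c wE].
exists (fun j => \sum_i a i * c i j).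
rewrite (eq_bigr (fun i => \sum_j (a i * c i j) *: v j)); last first.
  by move=> i _; rewrite wE scaler_sumr; apply: eq_bigr => j _; rewrite scalerA.
by rewrite exchange_big /=; apply: eq_bigr => j _; rewrite scaler_suml.
Qed.

Lemma span_mem n (v : 'I_n -> V) i : span v (v i).
Proof.
exists (fun j => (j == i)%:R); rewrite (bigD1 i) //= eqxx scale1r big1 ?addr0//.
by move=> j /negPf ->; rewrite scale0r.
Qed.

Lemma span0 n (v : 'I_n -> V) : span v 0.
Proof. by exists (fun=> 0); rewrite big1 // => i _; rewrite scale0r. Qed.

Lemma spanP n (v : 'I_n -> V) a x y :
  span v x -> span v y -> span v (a *: x + y).
Proof.
move=> [b ->] [c ->]; exists (fun i => a * b i + c i).
rewrite scaler_sumr -big_split /=; apply: eq_bigr => i _.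
by rewrite scalerDl scalerA.
Qed.

(** If n < m, the matrix of coefficients has more rows than columns, and a row vector killed by it
    is a linear relation among the [w i]. *)
Lemma lin_indep_size m n (v : 'I_n -> V) (w : 'I_m -> V) :
  lin_indep w -> (forall i, span v (w i)) -> (m <= n)%N.
Proof.
move=> wi /(_ _)/cid-/all_sig[c wE]; rewrite leqNgt; apply/negP => nm.
have [u u0 uA] := @exists_kernel_comb _ _ (\matrix_(i, j) c i j) nm.
have /wi ui : \sum_i u 0 i *: w i = 0.
  rewrite (eq_bigr (fun i => \sum_j (u 0 i * c i j) *: v j)); last first.
    by move=> i _; rewrite {1}wE scaler_sumr; apply: eq_bigr => j _;
      rewrite scalerA.
  rewrite exchange_big big1//= => j _; rewrite -scaler_suml.
  move/rowP/(_ j): uA; rewrite !mxE => uA.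
  rewrite (_ : \sum_i _ = 0) ?scale0r// -[RHS]uA.
  by apply: eq_bigr => i _; rewrite mxE.
by case/eqP: u0; apply/rowP => i; rewrite mxE ui.
Qed.

Lemma has_dim_uniq (S : set V) m n : has_dim S m -> has_dim S n -> m = n.
Proof.
move=> [v [vi ->]] [w [wi vw]]; apply/eqP; rewrite eqn_leq; apply/andP; split.
  by apply: (lin_indep_size (v := w) vi) => i; rewrite -vw; apply: span_mem.
by apply: (lin_indep_size (v := v) wi) => i; rewrite vw; apply: span_mem.
Qed.

Lemma dimE (S : set V) n : has_dim S n -> dim S = n.
Proof.
move=> Sn; rewrite /dim; case: xgetP => [m _ Sm|/(_ n)];
  first exact: has_dim_uniq Sm Sn.
by move=> /(_ Sn).
Qed.

Lemma has_dim0 : has_dim ([set 0] : set V) 0.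
Proof.
exists (fun _ => 0); split; first by move=> a _ [].
apply/seteqP; split => [x ->|x [a ->]]; first exact: span0.
by rewrite big_ord0.
Qed.

Lemma lin_indep0 : lin_indep (fun _ : 'I_0 => 0 : V).
Proof. by move=> a _ []. Qed.

Definition snoc n (v : 'I_n -> V) (x : V) (i : 'I_n.+1) : V :=
  if unlift ord_max i is Some j then v j else x.

Lemma sum_snoc n (v : 'I_n -> V) x (a : 'I_n.+1 -> K) :
  \sum_i a i *: snoc v x i =
  \sum_i a (widen_ord (leqnSn n) i) *: v i + a ord_max *: x.
Proof.
rewrite big_ord_recr /=; congr (_ + _ *: _); last first.
  by rewrite /snoc unlift_none.
apply: eq_bigr => i _; rewrite /snoc.
have -> : widen_ord (leqnSn n) i = lift ord_max i.
  by apply: val_inj; rewrite /= /bump leqNgt ltn_ord.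
by rewrite liftK.
Qed.

Lemma lin_indep_snoc n (v : 'I_n -> V) x :
  lin_indep v -> ~ span v x -> lin_indep (snoc v x).
Proof.
move=> vi xv a; rewrite sum_snoc => s0.
have am : a ord_max = 0.
  apply: contrapT => /eqP am; apply: xv.
  exists (fun i => - (a ord_max)^-1 * a (widen_ord (leqnSn n) i)).
  apply: (scalerI am); rewrite scaler_sumr.
  move/eqP: s0; rewrite addrC addr_eq0 => /eqP ->; rewrite -sumrN.
  apply: eq_bigr => i _; rewrite scalerA mulrA mulrN mulfV// mulN1r.
  by rewrite scaleNr.
move: s0; rewrite am scale0r addr0 => /vi a0 i.
case: (unliftP ord_max i) => [j|] ->//.
have <- : widen_ord (leqnSn n) j = lift ord_max j.
  by apply: val_inj; rewrite /= /bump leqNgt ltn_ord.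
exact: a0.
Qed.

(** An independent family of maximal size in [S] spans it, since [snoc] would otherwise lengthen it.
    This turns a bound on independent families into a dimension, over C for eigenspaces and over R
    for intersections of Lagrangians. *)
Lemma finite_dim_bounded (S : set V) n :
  S 0 -> (forall a x y, S x -> S y -> S (a *: x + y)) ->
  (forall m (w : 'I_m -> V), lin_indep w -> (forall i, S (w i)) -> (m <= n)%N) ->
  exists2 m, (m <= n)%N & has_dim S m.
Proof.
move=> S0 SP bS.
pose P m := `[< exists w : 'I_m -> V, lin_indep w /\ forall i, S (w i) >].
have P0 : exists m, P m.
  by exists 0%N; apply/asboolP; exists (fun=> 0); split => [|[]//];
    exact: lin_indep0.
have Pn m : P m -> (m <= n)%N by move=> /asboolP[w [wi /(bS _ _ wi)]].
case: (ex_maxnP P0 Pn) => m /asboolP[w [wi wS]] mmax.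
exists m; first by apply: (bS _ w).
exists w; split => //; apply/seteqP; split => [x Sx|x [a ->]]; last first.
  elim/big_ind: _ => // [y z Sy Sz|i _].
    by rewrite -[y]scale1r; apply: SP.
  by rewrite -[_ *: _]addr0; apply: SP.
apply: contrapT => xw; have : P m.+1.
  apply/asboolP; exists (snoc w x); split; first exact: lin_indep_snoc.
  by move=> i; rewrite /snoc; case: unliftP.
by move=> /mmax; rewrite ltnn.
Qed.

Definition cat_fam m n (v : 'I_m -> V) (w : 'I_n -> V) (i : 'I_(m + n)) : V :=
  match fintype.split i with inl j => v j | inr j => w j end.

Lemma sum_cat_fam m n (v : 'I_m -> V) (w : 'I_n -> V) (a : 'I_(m + n) -> K) :
  \sum_i a i *: cat_fam v w i =
  \sum_i a (lshift n i) *: v i + \sum_i a (rshift m i) *: w i.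
Proof.
rewrite big_split_ord /=; congr (_ + _); apply: eq_bigr => i _; rewrite /cat_fam.
  by rewrite (unsplitK (inl i)).
by rewrite (unsplitK (inr i)).
Qed.

Lemma span_catP m n (v : 'I_m -> V) (w : 'I_n -> V) x :
  span (cat_fam v w) x <-> exists y z, [/\ span v y, span w z & x = y + z].
Proof.
split=> [[a ->]|[_ [_ [[a ->] [b ->] ->]]]].
  rewrite sum_cat_fam; do 2 eexists; split; last reflexivity.
    by exists (fun i => a (lshift n i)).
  by exists (fun i => a (rshift m i)).
exists (fun i => match fintype.split i with inl j => a j | inr j => b j end).
rewrite sum_cat_fam; congr (_ + _); apply: eq_bigr => i _.
  by rewrite (unsplitK (inl i)).
by rewrite (unsplitK (inr i)).
Qed.

Lemma cat_famL m n (v : 'I_m -> V) (w : 'I_n -> V) i :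
  cat_fam v w (lshift n i) = v i.
Proof. by rewrite /cat_fam (unsplitK (inl i)). Qed.

Lemma cat_famR m n (v : 'I_m -> V) (w : 'I_n -> V) i :
  cat_fam v w (rshift m i) = w i.
Proof. by rewrite /cat_fam (unsplitK (inr i)). Qed.

Lemma finite_dimE (S : set V) : finite_dim S -> has_dim S (dim S).
Proof. by move=> [n Sn]; rewrite (dimE Sn). Qed.

End Dimension.

(** * Complex Hilbert spaces *)

(* [HJ H] is studied through this abstract structure because its scalar
   multiplication unfolds to real operations. Completeness is stated for
   sequences with an explicit rate, which is all that is ever produced. *)
Record hilbert (R : realType) := Hilbert {
  hspace :> lmodType (complex R) ;
  hp : hspace -> hspace -> complex R ;
  hpPl : forall a x y z, hp (a *: x + y) z = a * hp x z + hp y z ;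
  hpC : forall x y, hp x y = conjc (hp y x) ;
  hp_gt0 : forall x, x != 0 -> 0 < complex.Re (hp x x) ;
  hp_complete : forall (u : nat -> hspace) (c : R),
    (forall m n, (m <= n)%N ->
      Num.sqrt (complex.Re (hp (u m - u n) (u m - u n))) <= c / m.+1%:R) ->
    exists l, forall n,
      Num.sqrt (complex.Re (hp (u n - l) (u n - l))) <= c / n.+1%:R
}.

Section InnerProduct.
Variables (R : realType) (V : hilbert R).
Local Notation C := (complex R).
Implicit Types (x y z : V) (a b : C) (r : R).

Definition rip x y : R := complex.Re (hp x y).
Definition nrm x : R := Num.sqrt (rip x x).

Lemma hpDl x y z : hp (x + y) z = hp x z + hp y z.
Proof. by rewrite -{1}[x]scale1r hpPl mul1r. Qed.

Lemma hp0l x : hp 0 x = 0.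
Proof. by apply: (addrI (hp 0 x)); rewrite -hpDl !addr0. Qed.

Lemma hpZl a x y : hp (a *: x) y = a * hp x y.
Proof. by rewrite -[_ *: _]addr0 hpPl hp0l addr0. Qed.

Lemma hpDr x y z : hp z (x + y) = hp z x + hp z y.
Proof. by rewrite hpC hpDl rmorphD /= -!hpC. Qed.

Lemma hpZr a x y : hp x (a *: y) = conjc a * hp x y.
Proof. by rewrite hpC hpZl rmorphM /= -hpC. Qed.

Lemma hpNl x y : hp (- x) y = - hp x y.
Proof. by rewrite -scaleN1r hpZl mulN1r. Qed.

Lemma hpBl x y z : hp (x - y) z = hp x z - hp y z.
Proof. by rewrite hpDl hpNl. Qed.

Lemma hpNr x y : hp x (- y) = - hp x y.
Proof. by rewrite hpC hpNl rmorphN /= -hpC. Qed.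

Lemma hpBr x y z : hp z (x - y) = hp z x - hp z y.
Proof. by rewrite hpDr hpNr. Qed.

Lemma hp_eq0C x y : hp x y = 0 -> hp y x = 0.
Proof. by rewrite hpC => /eqP; rewrite conjc_eq0 => /eqP. Qed.

Lemma hp_eq0 x y : hp x y = 0 -> rip x y = 0.
Proof. by rewrite /rip => ->. Qed.

Lemma hp_suml (I : finType) (w : I -> V) y :
  hp (\sum_i w i) y = \sum_i hp (w i) y.
Proof. by elim/big_rec2: _ => [|i a b _ <-]; rewrite ?hp0l ?hpDl. Qed.

Lemma ripC x y : rip x y = rip y x.
Proof. by rewrite /rip hpC; case: (hp y x). Qed.

Lemma ripDl x y z : rip (x + y) z = rip x z + rip y z.
Proof. by rewrite /rip hpDl; case: (hp x z) (hp y z) => ? ? []. Qed.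

Lemma ripDr x y z : rip z (x + y) = rip z x + rip z y.
Proof. by rewrite ripC ripDl !(ripC z). Qed.

Lemma rip0l x : rip 0 x = 0.
Proof. by rewrite /rip hp0l. Qed.

Lemma rip0r x : rip x 0 = 0.
Proof. by rewrite ripC rip0l. Qed.

Lemma ripNl x y : rip (- x) y = - rip x y.
Proof. by apply: (addrI (rip x y)); rewrite -ripDl !subrr rip0l. Qed.

Lemma ripNr x y : rip x (- y) = - rip x y.
Proof. by rewrite ripC ripNl ripC. Qed.

Lemma ripBl x y z : rip (x - y) z = rip x z - rip y z.
Proof. by rewrite ripDl ripNl. Qed.

Lemma ripBr x y z : rip z (x - y) = rip z x - rip z y.
Proof. by rewrite ripDr ripNr. Qed.

Lemma ripRl r x y : rip ((real_complex R r) *: x) y = r * rip x y.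
Proof. by rewrite /rip hpZl; case: (hp x y) => s t /=; ring. Qed.

Lemma ripRr r x y : rip y ((real_complex R r) *: x) = r * rip y x.
Proof. by rewrite ripC ripRl ripC. Qed.

Lemma rip_ge0 x : 0 <= rip x x.
Proof. by have [->|/hp_gt0/ltW] := eqVneq x 0; rewrite ?rip0l. Qed.

Lemma rip_eq0 x : (rip x x == 0) = (x == 0).
Proof.
apply/idP/idP => [|/eqP->]; last by rewrite rip0l.
by apply: contraLR => /hp_gt0; rewrite lt0r => /andP[].
Qed.

Lemma rip_gt0 x : (0 < rip x x) = (x != 0).
Proof. by rewrite lt0r rip_ge0 rip_eq0 andbT. Qed.

Lemma nrm_ge0 x : 0 <= nrm x. Proof. exact: sqrtr_ge0. Qed.
Lemma nrm2 x : nrm x ^+ 2 = rip x x. Proof. by rewrite sqr_sqrtr// rip_ge0. Qed.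
Lemma nrm0 : nrm 0 = 0. Proof. by rewrite /nrm rip0l sqrtr0. Qed.
Lemma nrm_eq0 x : (nrm x == 0) = (x == 0).
Proof. by rewrite -rip_eq0 -nrm2 sqrf_eq0. Qed.
Lemma nrm_gt0 x : (0 < nrm x) = (x != 0).
Proof. by rewrite lt0r nrm_ge0 nrm_eq0 andbT. Qed.

Lemma nrm_rip_le (c d : R) x y : 0 <= c -> 0 <= d ->
  (c * nrm x <= d * nrm y) = (c ^+ 2 * rip x x <= d ^+ 2 * rip y y).
Proof.
move=> c0 d0; rewrite -!nrm2 -!exprMn ler_pXn2r // nnegrE mulr_ge0 ?nrm_ge0//.
Qed.

Lemma ler_nrm x y : (nrm x <= nrm y) = (rip x x <= rip y y).
Proof. by have := @nrm_rip_le 1 1 x y ler01 ler01; rewrite !expr1n !mul1r. Qed.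

Lemma eq_nrm x y : rip x x = rip y y -> nrm x = nrm y.
Proof. by rewrite /nrm => ->. Qed.

Lemma nrmN x : nrm (- x) = nrm x.
Proof. by apply: eq_nrm; rewrite ripNl ripNr opprK. Qed.

Lemma nrmC x y : nrm (x - y) = nrm (y - x).
Proof. by rewrite -nrmN opprB. Qed.

Lemma rip_normM x y : `|rip x y| <= nrm x * nrm y.
Proof.
rewrite -(@ler_pXn2r _ 2) ?nnegrE ?mulr_ge0 ?nrm_ge0//
  exprMn !nrm2 real_normK ?num_real//.
have [->|y0] := eqVneq y 0; first by rewrite !rip0r expr0n mulr0.
have yy : 0 < rip y y by rewrite rip_gt0.
have := rip_ge0 (x - real_complex R (rip x y / rip y y) *: y).
rewrite ripBl !ripBr !ripRl !ripRr (ripC y x).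
have -> : rip x x - rip x y / rip y y * rip x y -
  (rip x y / rip y y * rip x y - rip x y / rip y y * (rip x y / rip y y * rip y
    y)) =
  (rip x x * rip y y - rip x y ^+ 2) / rip y y.
  by field; rewrite gt_eqF.
by rewrite pmulr_lge0 ?invr_gt0// subr_ge0.
Qed.

Lemma rip_le x y : rip x y <= nrm x * nrm y.
Proof. exact: le_trans (ler_norm _) (rip_normM x y). Qed.

Lemma nrmD x y : nrm (x + y) <= nrm x + nrm y.
Proof.
rewrite -(@ler_pXn2r _ 2) ?nnegrE ?addr_ge0 ?nrm_ge0// nrm2 ripDl !ripDr.
by rewrite (ripC y x) -!nrm2; have := rip_le x y; lra.
Qed.

Lemma nrmB x y : nrm (x - y) <= nrm x + nrm y.
Proof. by rewrite -[nrm y]nrmN nrmD. Qed.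

Lemma nrm_lerB x y : nrm x - nrm y <= nrm (x - y).
Proof. by rewrite lerBlDr -{1}(subrK y x) nrmD. Qed.

Lemma rip_Z a x y : rip (a *: x) (a *: y) =
  (complex.Re a ^+ 2 + complex.Im a ^+ 2) * rip x y.
Proof.
rewrite /rip hpZl hpZr mulrA; case: a => u v /=.
by case: (hp x y) => s t /=; ring.
Qed.

Lemma rip_cis (t : R) x y : rip (cis t *: x) (cis t *: y) = rip x y.
Proof. by rewrite rip_Z /= cos2Dsin2 mul1r. Qed.

Lemma nrm_cis (t : R) x : nrm (cis t *: x) = nrm x.
Proof. by apply: eq_nrm; rewrite rip_cis. Qed.

Lemma nrm_R (t : R) x : nrm (real_complex R t *: x) = `|t| * nrm x.
Proof.
apply/eqP; rewrite -(@eqrXn2 _ 2) ?mulr_ge0 ?nrm_ge0//.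
by rewrite exprMn !nrm2 ripRl ripRr real_normK ?num_real// mulrA.
Qed.

Lemma nrm_Z a x : nrm (a *: x) <= (`|complex.Re a| + `|complex.Im a|) * nrm x.
Proof.
rewrite -[leLHS]mul1r nrm_rip_le// ?addr_ge0// expr1n mul1r rip_Z.
apply: ler_wpM2r; first exact: rip_ge0.
rewrite sqrrD !real_normK ?num_real// -addrA lerD2l lerDr.
by rewrite mulrn_wge0// mulr_ge0.
Qed.

Lemma ripJ a x y : rip (a *: x) y = rip x (conjc a *: y).
Proof. by rewrite /rip hpZl hpZr conjcK. Qed.

Lemma rip_eqP x y : (forall z, rip x z = rip y z) -> x = y.
Proof. by move=> E; apply/eqP; rewrite -subr_eq0 -rip_eq0 ripBl E subrr. Qed.

Lemma hp_rip x y : hp x y = Complex (rip x y) (- rip (Complex 0 1 *: x) y).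
Proof. by rewrite /rip hpZl; case: (hp x y) => s t /=; congr Complex; ring. Qed.

Lemma complete_rate (u : nat -> V) (c : R) :
  (forall m n, (m <= n)%N -> nrm (u m - u n) <= c / m.+1%:R) ->
  exists l, forall n, nrm (u n - l) <= c / n.+1%:R.
Proof. exact: hp_complete. Qed.

End InnerProduct.

Lemma archi_small (R : realType) (c e : R) : 0 < e -> exists n : nat,
  c / n.+1%:R < e.
Proof.
move=> e0; exists (Num.truncn (c / e)).
rewrite ltr_pdivrMr ?ltr0n// mulrC -ltr_pdivrMr//.
exact: truncnS_gt.
Qed.

Lemma ler_archi (R : realType) (a b c : R) :
  (forall n : nat, a <= b + c / n.+1%:R) -> a <= b.
Proof.
move=> E; rewrite leNgt; apply/negP => ba.
have ab : 0 < a - b by rewrite subr_gt0.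
have [n ncr] := archi_small c ab.
by move: ncr; rewrite ltrBrDl ltNge E.
Qed.

(** * Real-linear operators: closed ranges, orthogonal projections, quadratic forms *)

Section Operators.
Local Open Scope complex_scope.
Variables (R : realType) (V : hilbert R).
Local Notation C := (complex R).
Implicit Types (x y z : V) (a b : C) (r : R) (W F : set V).

(** Real subspaces and real-linear maps are the common frame because Lagrangians, their projections
    and their reflections are only real-linear. *)
Definition rsubspace W := W 0 /\ forall r x y, W x -> W y -> W (r%:C *: x + y).
Definition hclosed W :=
  forall x, (forall e, 0 < e -> exists2 y, W y & nrm (x - y) < e) -> W x.
Definition rlinear (D : V -> V) :=
  forall r x y, D (r%:C *: x + y) = r%:C *: D x + D y.
Definition hbounded (D : V -> V) := exists M, forall x, nrm (D x) <= M * nrm x.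
Definition bounded_below W (D : V -> V) :=
  exists2 c, 0 < c & forall x, W x -> c * nrm x <= nrm (D x).
Definition rsym (D : V -> V) := forall x y, rip (D x) y = rip x (D y).

Lemma rsubspaceB W x y : rsubspace W -> W x -> W y -> W (x - y).
Proof. by move=> [_ sW] Wx Wy; have := sW (-1) _ _ Wy Wx;
  rewrite rmorphN1 scaleN1r addrC. Qed.

Lemma rsubspaceD W x y : rsubspace W -> W x -> W y -> W (x + y).
Proof. by move=> [_ sW] Wx Wy; have := sW 1 _ _ Wx Wy; rewrite scale1r. Qed.

Lemma rsubspaceZ W r x : rsubspace W -> W x -> W (r%:C *: x).
Proof. by move=> [W0 sW] Wx; have := sW r _ _ Wx W0; rewrite addr0. Qed.

Lemma rsubspaceT : rsubspace setT. Proof. by []. Qed.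
Section RLinear.
Variables (D : V -> V) (lD : rlinear D).
Lemma rlinD x y : D (x + y) = D x + D y.
Proof. by have := lD 1 x y; rewrite !scale1r. Qed.
Lemma rlin0 : D 0 = 0.
Proof. by apply: (addrI (D 0)); rewrite -rlinD !addr0. Qed.
Lemma rlinZ r x : D (r%:C *: x) = r%:C *: D x.
Proof. by rewrite -[_ *: _]addr0 lD rlin0 addr0. Qed.
Lemma rlinN x : D (- x) = - D x.
Proof. by apply: (addrI (D x)); rewrite -rlinD !subrr rlin0. Qed.
Lemma rlinB x y : D (x - y) = D x - D y.
Proof. by rewrite rlinD rlinN. Qed.
End RLinear.

Lemma linear_rlinear (D : V -> V) : linear D -> rlinear D.
Proof. by move=> lD r x y; rewrite lD. Qed.

Lemma hbounded_ge0 D : hbounded D -> exists2 M, 0 < M & forall x,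
  nrm (D x) <= M * nrm x.
Proof.
move=> [M DM]; exists (`|M| + 1); first by rewrite ltr_pwDr.
move=> x; apply: le_trans (DM x) _; apply: ler_wpM2r; first exact: nrm_ge0.
by rewrite (le_trans (ler_norm _))// lerDl.
Qed.

Lemma range_closed D W : rlinear D -> hbounded D -> rsubspace W -> hclosed W ->
  bounded_below W D -> hclosed (D @` W).
Proof.
move=> lD /hbounded_ge0[M M0 DM] sW cW [c c0 Dc] y yD.
have /(_ _)/cid2-/all_sig2[u Wu Du] n : exists2 x, W x &
  nrm (y - D x) < n.+1%:R^-1.
  have [|_ [x Wx <-] xy] := yD n.+1%:R^-1; first by rewrite invr_gt0 ltr0n.
  by exists x.
(* Both [D (u m)] and [D (u n)] lie within 1/(m+1) of y, and the lower bound on D divides their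
   distance by c. *)
have [m n mn|l ul] := @complete_rate _ V u (2 / c).
  have : c * nrm (u m - u n) <= 2 / m.+1%:R.
    apply: le_trans (Dc _ (rsubspaceB sW (Wu m) (Wu n))) _; rewrite rlinB//.
    have -> : D (u m) - D (u n) = (y - D (u n)) - (y - D (u m)).
      by rewrite opprB [RHS]addrC addrA subrK.
    apply: le_trans (nrmB _ _) _; rewrite mulr_natl mulr2n lerD ?(ltW (Du _))//.
    apply: ltW; apply: lt_le_trans (Du n) _.
    by rewrite lef_pV2 ?posrE ?ltr0n// ler_nat.
  by rewrite -ler_pdivlMl// mulrCA mulrA.
exists l.
  apply: cW => e e0; have [n cn] := archi_small (2 / c) e0.
  by exists (u n) => //; rewrite nrmC (le_lt_trans (ul n)).
apply/eqP; rewrite -subr_eq0 -nrm_eq0 eq_le nrm_ge0 andbT.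
apply: (@ler_archi _ _ _ (1 + M * (2 / c))) => n; rewrite add0r mulrDl mul1r.
have -> : D l - y = (D l - D (u n)) - (y - D (u n)).
  by rewrite opprB addrA subrK.
apply: le_trans (nrmB _ _) _; rewrite addrC lerD ?(ltW (Du _))//.
rewrite -rlinB//; apply: le_trans (DM _) _; rewrite nrmC -mulrA.
by rewrite ler_pM2l// ul.
Qed.

Lemma quad_ge0 (b c : R) : 0 <= c ->
  (forall t, 0 <= - (2 * t * b) + t ^+ 2 * c) -> b = 0.
Proof.
move=> c0 /(_ (b / (c + 1))).
have c1 : 0 < c + 1 by rewrite ltr_wpDl.
have -> : - (2 * (b / (c + 1)) * b) + (b / (c + 1)) ^+ 2 * c =
  - ((c + 2) / (c + 1) ^+ 2 * b ^+ 2) by field; rewrite gt_eqF.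
rewrite oppr_ge0 pmulr_rle0 => [b0|]; last first.
  by rewrite divr_gt0 ?exprn_gt0// ltr_wpDl.
by apply/eqP; rewrite -(@sqrf_eq0 _ b) eq_le b0 sqr_ge0.
Qed.

(* Minimizing sequences are Cauchy by the parallelogram identity. *)
Lemma projection W x : rsubspace W -> hclosed W ->
  exists2 p, W p & forall y, W y -> rip (x - p) y = 0.
Proof.
move=> sW cW; pose A := [set rip (x - y) (x - y) | y in W].
have A0 : lbound A 0 by move=> _ [y _ <-]; exact: rip_ge0.
have hA : has_inf A.
  by split; [exists (rip (x - 0) (x - 0)); exists 0 => //;
    exact: sW.1 | exists 0].
have d0 : 0 <= inf A by apply: lb_le_inf => //; exact: hA.1.
have dW y : W y -> inf A <= rip (x - y) (x - y).
  by move=> Wy; apply: (inf_lbound hA.2); exists y.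
(* The excess over the infimum is squared so that the parallelogram identity yields |u m - u n| <=
   2/(m+1). *)
have /(_ _)/cid2-/all_sig2[u Wu Du] n :
    exists2 y, W y & rip (x - y) (x - y) < inf A + n.+1%:R^-1 ^+ 2.
  have [|_ [y Wy <-] ylt] := @inf_adherent _ A (n.+1%:R^-1 ^+ 2) _ hA.
    by rewrite exprn_gt0// invr_gt0 ltr0n.
  by exists y.
have [m n mn|p up] := @complete_rate _ V u 2.
  rewrite -(@ler_pXn2r _ 2) ?nnegrE ?nrm_ge0 ?divr_ge0 ?ler0n// nrm2 exprMn.
  pose w := (2^-1)%:C *: (u m + u n).
  have Ww : W w by apply: rsubspaceZ => //; apply: rsubspaceD.
  have := dW _ Ww; have := Du m; have := Du n.
  have : n.+1%:R^-1 ^+ 2 <= m.+1%:R^-1 ^+ 2 :> R.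
    by rewrite ler_pXn2r ?nnegrE ?invr_ge0 ?ler0n// lef_pV2 ?posrE ?ltr0n//
      ler_nat.
  rewrite /w !(ripBl, ripBr, ripDl, ripDr, ripRl, ripRr).
  rewrite !(ripC _ x) (ripC (u n) (u m)) -[2 ^+ 2 : R]/(2 ^+ 2).
  set s1 := n.+1%:R^-1 ^+ 2; set s2 := m.+1%:R^-1 ^+ 2; lra.
exists p.
  apply: cW => e e0; have [n cn] := archi_small 2 e0.
  by exists (u n) => //; rewrite nrmC (le_lt_trans (up n)).
have Wp : W p.
  apply: cW => e e0; have [n cn] := archi_small 2 e0.
  by exists (u n) => //; rewrite nrmC (le_lt_trans (up n)).
have xp : rip (x - p) (x - p) <= inf A.
  rewrite -nrm2 -[leRHS](sqr_sqrtr d0) ler_pXn2r ?nnegrE ?nrm_ge0 ?sqrtr_ge0//.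
  (* 3 = 1 + 2: the defect of [u n] in the infimum plus its distance to p. *)
  apply: (@ler_archi _ _ _ 3) => n.
  have -> : x - p = (x - u n) + (u n - p) by rewrite addrA subrK.
  apply: le_trans (nrmD _ _) _; have := up n.
  have : nrm (x - u n) <= Num.sqrt (inf A) + n.+1%:R^-1.
    rewrite -(@ler_pXn2r _ 2) ?nnegrE ?addr_ge0 ?nrm_ge0 ?sqrtr_ge0 ?invr_ge0
      ?ler0n//.
    rewrite nrm2 sqrrD sqr_sqrtr// addrAC (le_trans (ltW (Du n)))//.
    by rewrite lerDl mulrn_wge0// mulr_ge0 ?sqrtr_ge0// invr_ge0 ler0n.
  set s := n.+1%:R^-1; lra.
move=> y Wy; apply: (quad_ge0 (rip_ge0 y)) => t.
have := dW _ (sW.2 t _ _ Wy Wp).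
have -> : x - (t%:C *: y + p) = (x - p) - t%:C *: y by rewrite opprD [- _ -
  p]addrC addrA.
move: xp; move: (x - p) => z.
rewrite ripBl !ripBr !ripRl !ripRr (ripC y z) => h1 h2.
have := le_trans h1 h2; rewrite expr2; lra.
Qed.

(** Evaluate the nonnegative form at x - M^-1 D x and bound <D D x, D x> by M |D x|^2. *)
Lemma form_cauchy F D M : rlinear D -> rsym D -> rsubspace F ->
  (forall x, F x -> F (D x)) -> (forall x, F x -> 0 <= rip (D x) x) ->
  0 < M -> (forall x, nrm (D x) <= M * nrm x) ->
  forall x, F x -> rip (D x) (D x) <= M * rip (D x) x.
Proof.
move=> lD sD sF FD D0 M0 DM x Fx.
have := D0 _ (rsubspaceB sF Fx (rsubspaceZ M^-1 sF (FD _ Fx))).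
rewrite rlinB// rlinZ// ripBl !ripBr !ripRl !ripRr (sD (D x) x).
have DDx : rip (D (D x)) (D x) <= M * rip (D x) (D x).
  apply: le_trans (rip_le _ _) _; rewrite -nrm2 expr2 mulrA.
  by apply: ler_wpM2r; rewrite ?nrm_ge0.
set p := rip (D x) x; set q := rip (D x) (D x) in DDx *;
  set s := rip _ _ in DDx *.
move=> h; have : M^-1 * (M^-1 * s) <= M^-1 * q.
  by rewrite ler_pM2l ?invr_gt0// ler_pdivrMl.
move=> h2; have : M^-1 * q <= p by lra.
by rewrite ler_pdivrMl.
Qed.

(* If the supremum m of the quadratic form of D were >= m0, the Cauchy-Schwarz
   inequality for the form of m - D and the lower bound for D - m would push the
   form below m. *)
Lemma form_sup F D M m0 : rlinear D -> rsym D -> rsubspace F ->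
  (forall x, F x -> F (D x)) -> (forall x, nrm (D x) <= M * nrm x) ->
  (forall m, m0 <= m -> bounded_below F (fun x => D x - m%:C *: x)) ->
  exists2 c, 0 < c & forall x, F x -> rip (D x) x <= (m0 - c) * rip x x.
Proof.
move=> lD sD sF FD DM DF.
have qM x : rip (D x) x <= M * rip x x.
  rewrite -nrm2 expr2 mulrA (le_trans (rip_le _ _))// ler_wpM2r ?nrm_ge0//.
have [F0|/existsNP[x0 /not_implyP[Fx0 /eqP x00]]] := pselect (forall x, F x ->
  x = 0).
  by exists 1 => // x /F0 ->; rewrite !rip0r mulr0.
pose A := [set rip (D x) x / rip x x | x in [set x | F x /\ x != 0]].
have AM : ubound A M.
  by move=> _ [x [Fx xn0] <-]; rewrite ler_pdivrMr ?rip_gt0.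
have hA : has_sup A.
  by split; [exists (rip (D x0) x0 / rip x0 x0), x0|exists M].
have [mlt|mge] := ltP (sup A) m0.
  exists (m0 - sup A); rewrite ?subr_gt0// => x Fx; rewrite subKr.
  have [->|xn0] := eqVneq x 0; first by rewrite !rip0r mulr0.
  by rewrite -ler_pdivrMr ?rip_gt0//; apply: sup_ubound; [exact: hA.2|exists x].
pose m := sup A; pose G x := m%:C *: x - D x.
have lG : rlinear G.
  move=> r x y; rewrite /G lD scalerDr scalerBr !scalerA [in LHS]mulrC.
  by rewrite opprD addrACA.
have sG : rsym G.
  by move=> x y; rewrite ripBl ripBr ripRl ripRr sD.
have GF x : F x -> F (G x) by move=> Fx; apply: rsubspaceB => //;
  [exact: rsubspaceZ|exact: FD].
have G0 x : F x -> 0 <= rip (G x) x.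
  move=> Fx; rewrite ripBl ripRl subr_ge0.
  have [->|xn0] := eqVneq x 0; first by rewrite !rip0r mulr0.
  by rewrite -ler_pdivrMr ?rip_gt0//; apply: sup_ubound; [exact: hA.2|exists x].
have M'0 : 0 < `|m| + `|M| + 1 by rewrite ltr_pwDr// addr_ge0.
have GM x : nrm (G x) <= (`|m| + `|M| + 1) * nrm x.
  rewrite -addrA mulrDl (le_trans (nrmB _ _))// nrm_R lerD2l (le_trans (DM _))//.
  apply: ler_wpM2r; first exact: nrm_ge0.
  by rewrite (le_trans (ler_norm _))// lerDl.
have gc := form_cauchy lG sG sF GF G0 M'0 GM.
have [c c0 cD] := DF _ mge.
have cm x : F x -> c ^+ 2 / (`|m| + `|M| + 1) * rip x x <= rip (G x) x.
  move=> Fx; rewrite mulrAC ler_pdivrMr// [leRHS]mulrC; apply: le_trans (gc _ Fx).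
  rewrite -[leRHS]mul1r -(expr1n _ 2) -nrm_rip_le ?ler01 ?(ltW c0)// mul1r.
  by rewrite -[G x]opprK nrmN opprB; exact: cD.
have : sup A <= m - c ^+ 2 / (`|m| + `|M| + 1).
  apply: ge_sup; first exact: hA.1.
  move=> _ [x [Fx xn0] <-]; rewrite ler_pdivrMr ?rip_gt0//.
  have := cm _ Fx; rewrite ripBl ripRl mulrBl; lra.
rewrite -/m lerBrDl gerDr; have : 0 < c ^+ 2 / (`|m| + `|M| + 1).
  by rewrite divr_gt0// exprn_gt0.
by move=> h1 /(lt_le_trans h1); rewrite ltxx.
Qed.

End Operators.

(** * Unitary operators, regular points, subspaces of finite codimension *)

Section Unitary.
Local Open Scope complex_scope.
Variables (R : realType) (V : hilbert R).
Local Notation C := (complex R).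
Implicit Types (x y z : V) (a b : C) (r : R) (W F : set V) (T D : V -> V).

Definition csubspace W := W 0 /\ forall a x y, W x -> W y -> W (a *: x + y).
Definition hclosure W : set V :=
  [set x | forall e, 0 < e -> exists2 y, W y & nrm (x - y) < e].
(* P contains a linear subspace of finite codimension; P itself need not be a
   subspace. *)
Definition fin_codim (P : set V) := exists n (f : V -> 'rV[C]_n),
  linear f /\ forall x, f x = 0 -> P x.
Definition unitop T := [/\ linear T, forall x y, hp (T x) (T y) = hp x y &
  forall y, exists x, T x = y].
(** For unitary T this lower bound alone makes z a resolvent point: surjectivity follows from
    normality, see [combK_surj]. *)
Definition regular_pt T (z : C) := bounded_below setT (fun x => T x - z *: x).

Lemma csubspace_rsubspace W : csubspace W -> rsubspace W.
Proof. by move=> [W0 sW]; split => // r x y; exact: sW. Qed.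

Lemma csubspace_hclosure W : csubspace W -> csubspace (hclosure W).
Proof.
move=> [W0 sW]; split => [e e0|a x y cx cy e e0].
  by exists 0 => //; rewrite subr0 nrm0.
pose N := `|complex.Re a| + `|complex.Im a| + 1.
have N0 : 0 < N by rewrite ltr_wpDl// addr_ge0.
have e2 : 0 < e / 2 / N by rewrite !divr_gt0.
have e1 : 0 < e / 2 by rewrite divr_gt0.
have [x' Wx xx'] := cx _ e2; have [y' Wy yy'] := cy _ e1.
exists (a *: x' + y'); first exact: sW.
rewrite opprD addrACA -scalerBr (le_lt_trans (nrmD _ _))//.
rewrite [ltRHS](splitr e) ltr_leD// ?(ltW yy')//.
rewrite (le_lt_trans (nrm_Z _ _))//.
have : N * nrm (x - x') < e / 2 by rewrite mulrC -ltr_pdivlMr.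
by apply: le_lt_trans; rewrite ler_wpM2r ?nrm_ge0// lerDl.
Qed.

Lemma hclosure_sub W : W `<=` hclosure W.
Proof. by move=> x Wx e e0; exists x => //; rewrite subrr nrm0. Qed.

Lemma hclosed_hclosure W : hclosed (hclosure W).
Proof.
move=> x cx e e0; have [|y cy xy] := cx (e / 2); first by rewrite divr_gt0.
have [|z Wz yz] := cy (e / 2); first by rewrite divr_gt0.
exists z => //; rewrite [ltRHS](splitr e) -(subrK y x) -addrA.
by rewrite (le_lt_trans (nrmD _ _))// ltrD.
Qed.

Lemma bounded_below_hclosure W D : rlinear D -> hbounded D ->
  bounded_below W D -> bounded_below (hclosure W) D.
Proof.
move=> lD /hbounded_ge0[M M0 DM] [c c0 Dc]; exists c => // x cx.
apply: (@ler_archi _ _ _ (c + M)) => n.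
have [|y Wy xy] := cx n.+1%:R^-1; first by rewrite invr_gt0 ltr0n.
have h1 : c * nrm x <= c * (nrm y + nrm (x - y)).
  by rewrite ler_pM2l// -{1}(subrK y x) addrC nrmD.
have h2 : nrm (D y) <= nrm (D x) + M * nrm (x - y).
  rewrite -{1}(subKr x y) rlinB// (le_trans (nrmB _ _))// lerD2l.
  exact: DM.
have := Dc _ Wy; have : (c + M) * nrm (x - y) <= (c + M) / n.+1%:R.
  by rewrite ler_pM2l ?ltW// addr_gt0.
move: h1 h2; set s := (c + M) / _; rewrite !mulrDr mulrDl; lra.
Qed.

Lemma hboundedB T D : hbounded T -> hbounded D -> hbounded (fun x => T x - D x).
Proof.
move=> [M TM] [N DN]; exists (M + N) => x.
by rewrite (le_trans (nrmB _ _))// mulrDl lerD.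
Qed.

Lemma hbounded_scale a : hbounded (fun x => a *: x).
Proof. by exists (`|complex.Re a| + `|complex.Im a|) => x; exact: nrm_Z. Qed.

Lemma hbounded_comp T D : hbounded T -> hbounded D -> hbounded (T \o D).
Proof.
move=> /hbounded_ge0[M M0 TM] [N DN]; exists (M * N) => x /=.
by rewrite (le_trans (TM _))// -mulrA ler_pM2l.
Qed.

(* The kernel of g need not be closed, so the argument is run on its closure. *)
Section OneFunctional.
Variables (D : V -> V) (W : set V) (g : V -> C).
Hypotheses (lD : linear D) (bD : hbounded D) (iD : forall x, D x = 0 -> x = 0).
Hypotheses (sW : csubspace W) (lg : forall a x y, g (a *: x + y) = a * g x + g y).

Lemma bounded_below_functional : bounded_below (W `&` [set x | g x = 0]) D ->
  bounded_below W D.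
Proof.
move=> Dg; have rD := linear_rlinear lD.
have [g0|/existsNP[v0 /not_implyP[Wv0 /eqP gv0]]] := pselect (forall x, W x ->
  g x = 0).
  by have [c c0 Dc] := Dg; exists c => // x Wx; apply: Dc; split => //; exact: g0.
have gZ a x : g (a *: x) = a * g x.
  have g00 : g 0 = 0.
    by apply: (addrI (g 0)); rewrite addr0 -[in RHS](addr0 (0 : V)) -{3}(scale1r
      (0:V)) lg mul1r.
  by rewrite -[_ *: _]addr0 lg g00 addr0.
pose v := (g v0)^-1 *: v0.
have Wv : W v by rewrite /v -[_ *: _]addr0; apply: sW.2 => //; exact: sW.1.
have gv : g v = 1 by rewrite /v gZ mulVf.
pose W0 := W `&` [set x | g x = 0].
have sW0 : csubspace W0.
  split; first by split; [exact: sW.1|rewrite /= -(scale0r v) gZ mul0r].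
  move=> a x y [Wx gx] [Wy gy]; split; first exact: sW.2.
  by rewrite /= lg gx gy mulr0 addr0.
have split_x x : W x -> W0 (x - g x *: v).
  move=> Wx; rewrite addrC -scaleNr; split; first exact: sW.2.
  by rewrite /= lg gv mulr1 addNr.
pose W1 := hclosure W0.
have sW1 : csubspace W1 by exact: csubspace_hclosure.
have DW1 : bounded_below W1 D by exact: bounded_below_hclosure.
have cDW1 : hclosed (D @` W1).
  by apply: range_closed => //; [exact: csubspace_rsubspace|exact:
    hclosed_hclosure].
(* If D v lies in D W1, injectivity puts v, and with it W, inside W1, where the bound is known.
   Otherwise D v keeps a distance e > 0 from D W0, and e lets |D x| control the coefficient [g x] of
   v. *)
have [[w W1w /eqP]|nDv] := pselect ((D @` W1) (D v)).
  rewrite -subr_eq0 -rlinB// => /eqP/iD/eqP; rewrite subr_eq0 => /eqP wv.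
  have [c c0 Dc] := DW1; exists c => // x Wx; apply: Dc.
  rewrite -(subrK (g x *: v) x) addrC; apply: sW1.2; first by rewrite -wv.
  exact/hclosure_sub/split_x.
have [e e0 De] : exists2 e, 0 < e & forall u, W0 u -> e <= nrm (D u + D v).
  apply: contrapT => H; apply: nDv; apply: cDW1 => e e0.
  apply: contrapT => H1; apply: H; exists e => // u W0u.
  rewrite leNgt; apply/negP => lt; apply: H1; exists (D (- u)).
    exists (- u) => //; apply: hclosure_sub.
    by rewrite -[- u]addr0 -scaleN1r; apply: sW0.2 => //; exact: sW0.1.
  by rewrite (rlinN rD) opprK addrC.
have [c c0 Dc] := Dg.
(* From |x| <= |u| + |t| |v|, with |t| <= |D x| / e and c |u| <= |D x| + |t| |D v|. *)
pose K := (1 + nrm (D v) / e) / c + nrm v / e.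
have K0 : 0 < K.
  rewrite ltr_pwDl ?divr_ge0 ?nrm_ge0 ?(ltW e0)// divr_gt0// ltr_wpDr//.
  by rewrite divr_ge0 ?nrm_ge0 ?(ltW e0).
exists K^-1; rewrite ?invr_gt0// => x Wx; rewrite ler_pdivrMl//.
pose t := g x; pose u := x - t *: v; pose nt := Normc.normc t.
have nrm_t y : nrm (t *: y) = nt * nrm y.
  apply/eqP; rewrite -(@eqrXn2 _ 2) ?mulr_ge0 ?nrm_ge0//; last first.
    by rewrite /nt; case: (t) => ? ?; exact: sqrtr_ge0.
  rewrite exprMn !nrm2 rip_Z /nt; case: (t) => p q /=.
  by rewrite sqr_sqrtr// addr_ge0// sqr_ge0.
have W0u : W0 u by exact: split_x.
have xE : x = u + t *: v by rewrite /u subrK.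
have h1 : nt * e <= nrm (D x).
  have [t0|t0] := eqVneq t 0.
    rewrite (_ : nt = 0) ?mul0r ?nrm_ge0// /nt t0 /=.
    by rewrite expr0n/= addr0 sqrtr0.
  have -> : D x = t *: (D (t^-1 *: u) + D v).
    by rewrite -rlinD// -[RHS]addr0 -(rlin0 rD) -lD addr0 scalerDr scalerA
      mulfV// scale1r -xE.
  rewrite nrm_t ler_wpM2l//; first by rewrite /nt; case: (t) => ? ?;
    exact: sqrtr_ge0.
  by apply: De; rewrite -[_ *: _]addr0; apply: sW0.2 => //; exact: sW0.1.
have h2 : c * nrm u <= nrm (D x) + nt * nrm (D v).
  rewrite (le_trans (Dc _ W0u))// /u rlinB// (le_trans (nrmB _ _))// lerD2l.
  have -> : D (t *: v) = t *: D v by rewrite -[t *: v]addr0 lD rlin0// addr0.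
  by rewrite nrm_t.
have h3 : nt <= nrm (D x) / e by rewrite ler_pdivlMr.
have h4 : nrm x <= nrm u + nt * nrm v.
  by rewrite {1}xE (le_trans (nrmD _ _))// nrm_t.
rewrite (le_trans h4)// /K mulrDl lerD//.
  rewrite -ler_pdivlMl// in h2; rewrite (le_trans h2)//.
  rewrite mulrC [leRHS]mulrAC ler_pM2r ?invr_gt0// mulrDl mul1r lerD2l.
  by rewrite mulrC mulrAC -mulrA ler_wpM2l ?nrm_ge0.
by rewrite mulrAC mulrC -mulrA ler_wpM2l ?nrm_ge0.
Qed.

End OneFunctional.

(** [W k] is cut out by the coordinates of f from k on, so it grows from the kernel of f at k = 0 to
    the whole space at k = n; each step drops one functional. *)
Lemma bounded_below_fin_codim D P : linear D -> hbounded D -> (forall x,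
  D x = 0 -> x = 0) ->
  fin_codim P -> bounded_below P D -> bounded_below setT D.
Proof.
move=> lD bD iD [n [f [lf fP]]] [c c0 Dc].
pose W k := [set x : V | forall i : 'I_n, (k <= i)%N -> f x 0 i = 0].
have f0 : f 0 = 0.
  by have := lf (-1) 0 0; rewrite scaler0 addr0 scaleN1r addNr.
have WW k : bounded_below (W k) D.
  elim: k => [|k IH].
    exists c => // x Wx; apply/Dc/fP/rowP => i; rewrite !mxE; exact: Wx.
  have [nk|kn] := leqP n k.
    have [c' c'0 Dc'] := IH; exists c' => // x _; apply: Dc' => i.
    by rewrite leqNgt (leq_trans (ltn_ord i)).
  apply: (@bounded_below_functional D _ (fun x => f x 0 (Ordinal kn))) => //.
  - split; first by move=> i _; rewrite f0 mxE.
    by move=> a x y Wx Wy i ki; rewrite lf !mxE Wx// Wy// mulr0 addr0.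
  - by move=> a x y; rewrite lf !mxE.
  - have [c' c'0 Dc'] := IH; exists c' => // x [Wx gx]; apply: Dc' => i.
    rewrite leq_eqVlt => /predU1P[ki|]; last exact: Wx.
    by rewrite -gx; congr (f x 0 _); apply: val_inj.
have [c' c'0 Dc'] := WW n; exists c' => // x _; apply: Dc' => i.
by rewrite leqNgt ltn_ord.
Qed.

Lemma fin_codim_sub P Q : P `<=` Q -> fin_codim P -> fin_codim Q.
Proof. by move=> PQ [n [f [lf fP]]]; exists n, f; split => // x /fP /PQ. Qed.

Lemma fin_codimI P Q : fin_codim P -> fin_codim Q -> fin_codim (P `&` Q).
Proof.
move=> [n [f [lf fP]]] [m [g [lg gQ]]]; exists (n + m)%N, (fun x =>
  row_mx (f x) (g x)).
split => [a x y|x /eqP]; first by rewrite lf lg scale_row_mx add_row_mx.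
by rewrite row_mx_eq0 => /andP[/eqP/fP ? /eqP/gQ].
Qed.

Lemma fin_codim_preim P T : linear T -> fin_codim P -> fin_codim (T @^-1` P).
Proof.
move=> lT [n [f [lf fP]]]; exists n, (f \o T); split => [a x y|x /fP//].
by rewrite /= lT lf.
Qed.

Lemma fin_codim_orth n (v : 'I_n -> V) : fin_codim [set x | forall i,
  hp x (v i) = 0].
Proof.
exists n, (fun x => \row_i hp x (v i)); split => [a x y|x /rowP fx i].
  by apply/rowP => i; rewrite !mxE hpPl.
by have := fx i; rewrite !mxE.
Qed.

Section IsoU.
Variables (T : V -> V) (uT : unitop T).

Lemma unitop_lin : linear T. Proof. by case: uT. Qed.
Lemma unitop_rlin : rlinear T. Proof. exact/linear_rlinear/unitop_lin. Qed.
Lemma unitop_hp x y : hp (T x) (T y) = hp x y. Proof. by case: uT. Qed.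
Lemma unitop_rip x y : rip (T x) (T y) = rip x y.
Proof. by rewrite /rip unitop_hp. Qed.
Lemma unitop_nrm x : nrm (T x) = nrm x. Proof. by rewrite /nrm unitop_rip. Qed.
Lemma unitop_hbounded : hbounded T. Proof. by exists 1 => x;
  rewrite unitop_nrm mul1r. Qed.
Lemma unitopZ a x : T (a *: x) = a *: T x.
Proof. by rewrite -[a *: x]addr0 unitop_lin rlin0 ?addr0//;
  exact: unitop_rlin. Qed.
Lemma unitopD x y : T (x + y) = T x + T y.
Proof. exact/rlinD/unitop_rlin. Qed.
Lemma unitopB x y : T (x - y) = T x - T y.
Proof. exact/rlinB/unitop_rlin. Qed.
Lemma unitop_inj x y : T x = T y -> x = y.
Proof.
by move/eqP; rewrite -subr_eq0 -unitopB -nrm_eq0 unitop_nrm nrm_eq0 subr_eq0 =>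
  /eqP.
Qed.

Lemma unitop_inv : exists T', [/\ unitop T', cancel T T' & cancel T' T].
Proof.
have /(_ _)/cid-/all_sig[T' T'K] : forall y, exists x, T x = y by case: uT.
have TK : cancel T T' by move=> x; apply: unitop_inj; rewrite T'K.
exists T'; split => //; split.
- by move=> a x y; apply: unitop_inj; rewrite unitop_lin !T'K.
- by move=> x y; rewrite -unitop_hp !T'K.
- by move=> y; exists (T y).
Qed.

Lemma combK_lin a b : linear (fun x => a *: T x - b *: x).
Proof.
move=> c x y; rewrite unitop_lin !scalerDr !scalerN !scalerA.
by rewrite ![_ * c]mulrC opprD addrACA.
Qed.

Lemma combK_hbounded a b : hbounded (fun x => a *: T x - b *: x).
Proof.
apply: hboundedB; last exact: hbounded_scale.
exact: (hbounded_comp (hbounded_scale a) unitop_hbounded).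
Qed.

(* The operator is normal: a vector T w orthogonal to its range satisfies
   (a T - b) w = 0. *)
Lemma combK_surj a b : bounded_below setT (fun x => a *: T x - b *: x) ->
  forall y, exists x, a *: T x - b *: x = y.
Proof.
move=> bb; set D := fun x => _ in bb *; have lD : linear D := combK_lin a b.
have rD := linear_rlinear lD.
have cl : hclosed (D @` setT).
  by apply: (range_closed rD (combK_hbounded a b) _ _ bb).
have sD : csubspace (D @` setT).
  split; first by exists 0 => //; exact: rlin0.
  by move=> c _ _ [x _ <-] [y _ <-]; exists (c *: x + y) => //; rewrite lD.
move=> y; have [p [x _ <-] yp] := projection y (csubspace_rsubspace sD) cl.
exists x; apply/eqP; rewrite -subr_eq0 -opprB oppr_eq0; apply/eqP.
move: yp; rewrite -/(D x); move: (y - D x) => {}y yp.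
have [w wy] : exists w, T w = y by case: uT => _ _; apply.
have /rip_eqP wE : forall z, rip (conjc a *: w) z = rip (conjc b *: T w) z.
  move=> z; have := yp _ (ex_intro2 _ _ z Logic.I erefl); rewrite -wy /D ripBr.
  rewrite (ripC _ (a *: T z)) ripJ -unitopZ unitop_rip (ripC _ (b *: z)) ripJ.
  by rewrite !(ripC z) => /eqP; rewrite subr_eq0 => /eqP.
have nE : nrm (conjc a *: w) = nrm (conjc b *: w).
  by rewrite wE -unitopZ unitop_nrm.
suff w0 : D w = 0.
  have [c c0 Dc] := bb; have := Dc w Logic.I; rewrite w0 nrm0 pmulr_rle0//.
  have := nrm_ge0 w; rewrite -wy => h1 h2.
  have /eqP : nrm w = 0 by apply/eqP; rewrite eq_le h1 h2.
  by rewrite nrm_eq0 => /eqP ->; exact/rlin0/unitop_rlin.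
have [->|wn0] := eqVneq w 0; first exact: rlin0.
have : complex.Re a ^+ 2 + complex.Im a ^+ 2 = complex.Re b ^+ 2 + complex.Im b
  ^+ 2.
  move/(congr1 (fun t => t ^+ 2)): nE; rewrite !nrm2 !rip_Z.
  move/mulIf; rewrite rip_eq0 => /(_ wn0).
  by case: (a) (b) => a1 a2 [b1 b2] /=; rewrite !sqrrN.
have aa (c : C) : c * conjc c = (complex.Re c ^+ 2 + complex.Im c ^+ 2)%:C.
  by case: (c) => s t; simpc; apply/eqP; rewrite eq_complex /=; apply/andP;
    split; apply/eqP; ring.
(* By [wE], the product of conj b with D w is (|a|^2 - |b|^2) w = 0. The case b = 0 forces a = 0 and
   is settled apart. *)
move=> ab; rewrite /D.
have [b0|b0] := eqVneq b 0.
  have /eqP : complex.Re a ^+ 2 + complex.Im a ^+ 2 = 0 by rewrite ab b0 /=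
    expr0n /= addr0.
  rewrite paddr_eq0 ?sqr_ge0// !sqrf_eq0 => /andP[/eqP a1 /eqP a2].
  have -> : a = 0 by apply/eqP; rewrite eq_complex a1 a2 /= eqxx.
  by rewrite b0 !scale0r subrr.
have cb0 : conjc b != 0 by rewrite conjc_eq0.
apply: (scalerI cb0); rewrite scaler0 scalerBr.
have -> : conjc b *: (a *: T w) = a *: (conjc b *: T w) by rewrite !scalerA mulrC.
by rewrite -wE !scalerA (mulrC _ b) !aa ab subrr.
Qed.

Lemma res_inverse (z : C) : regular_pt T z -> exists S : V -> V, [/\ linear S,
  hbounded S,
  forall x, S (T x - z *: x) = x & forall x, T (S x) - z *: S x = x].
Proof.
move=> rz; have [c c0 Dc] := rz.
have rz1 : bounded_below setT (fun x => 1 *: T x - z *: x).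
  by exists c => // x _; rewrite scale1r; exact: Dc.
have /(_ _)/cid-/all_sig[S SK] := combK_surj rz1.
have lD := combK_lin 1 z.
have inj x y : T x - z *: x = T y - z *: y -> x = y.
  move=> E; apply/eqP; rewrite -subr_eq0 -nrm_eq0 eq_le nrm_ge0 andbT.
  rewrite -(pmulr_rle0 _ c0) (le_trans (Dc _ Logic.I))// unitopB scalerBr.
  by rewrite opprD addrACA -opprD E subrr nrm0.
exists S; split.
- by move=> a x y; apply: inj; have := lD a (S x) (S y); rewrite !scale1r => ->;
  have := SK x; have := SK y; have := SK (a *: x + y); rewrite !scale1r => -> ->
    ->.
- exists c^-1 => x; rewrite ler_pdivlMl//; apply: le_trans (Dc _ Logic.I) _.
  by have := SK x; rewrite scale1r => ->.
- by move=> x; apply: inj; have := SK (T x - z *: x); rewrite scale1r.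
- by move=> x; have := SK x; rewrite scale1r.
Qed.

End IsoU.

Lemma inverse_res T (z : C) S : hbounded S -> (forall x, S (T x - z *: x) = x) ->
  regular_pt T z.
Proof.
move=> /hbounded_ge0[M M0 SM] SK; exists M^-1; rewrite ?invr_gt0// => x _.
by rewrite ler_pdivrMl//; rewrite -{1}(SK x).
Qed.

End Unitary.

Section Cis.
Local Open Scope complex_scope.
Variable R : realType.
Implicit Types a b : R.

Lemma cisD a b : cis (a + b) = cis a * cis b.
Proof. by rewrite /cis cosD sinD; apply/eqP; rewrite eq_complex /=; apply/andP;
  split; apply/eqP; ring. Qed.

Lemma cis0 : cis 0 = 1 :> complex R.
Proof. by rewrite /cis cos0 sin0. Qed.

Lemma cisN a : conjc (cis a) = cis (- a).
Proof. by rewrite /cis cosN sinN. Qed.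

Lemma cisVl a : cis (- a) * cis a = 1.
Proof. by rewrite -cisD addNr cis0. Qed.

Lemma cisVr a : cis a * cis (- a) = 1.
Proof. by rewrite -cisD subrr cis0. Qed.

Lemma cis_add_conj a : cis a + cis (- a) = (2 * cos a)%:C.
Proof. by rewrite -cisN /cis; apply/eqP; rewrite eq_complex /=; apply/andP;
  split; apply/eqP; ring. Qed.

Lemma cis_inj a b : - pi < a < pi -> - pi < b < pi -> cis a = cis b -> a = b.
Proof.
move=> /andP[a1 a2] /andP[b1 b2] [cab sab].
have nn (x : R) : - pi < x -> x < pi -> `|x| \in `[0, pi].
  by move=> x1 x2; rewrite in_itv /= normr_ge0 /= ler_norml !ltW.
have cn (x : R) : cos `|x| = cos x by case: (ger0P x); rewrite ?cosN.
have := cos_inj (nn _ a1 a2) (nn _ b1 b2); rewrite !cn => /(_ cab) nab.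
have s0 (x : R) : - pi < x -> x < pi -> sin x = 0 -> x = 0.
  move=> x1 x2 sx; apply/eqP; case: (ltgtP x 0) => // x0.
    have : 0 < sin (- x) by rewrite sin_gt0_pi// oppr_gt0 x0 ltrNl.
    by rewrite sinN sx oppr0 ltxx.
  by have := @sin_gt0_pi _ x; rewrite sx ltxx x0 x2 => /(_ isT).
move/eqP: nab; rewrite eqr_norm2 => /orP[/eqP//|/eqP ab].
have sb : sin b = 0 by move: sab; rewrite ab sinN; lra.
by rewrite ab (s0 b)// oppr0.
Qed.

Lemma cos_le_itv (h t : R) : 0 <= h <= pi -> t \in `[- h, h] -> cos h <= cos t.
Proof.
move=> /andP[h0 hpi]; rewrite in_itv /= -ler_norml => th.
have -> : cos t = cos `|t| by case: (ger0P t); rewrite ?cosN.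
have [->//|ne] := eqVneq `|t| h.
by rewrite ltW// ltr_cos ?in_itv/= ?h0 ?hpi ?normr_ge0 ?(le_trans th hpi)//
  lt_neqAle ne.
Qed.
End Cis.

(** * Isolated spectral points of a unitary operator *)

Section Spectral.
Local Open Scope complex_scope.
Variables (R : realType) (V : hilbert R).
Local Notation C := (complex R).
Implicit Types (x y z : V) (a b : C) (r : R) (W F : set V) (T D : V -> V).

Lemma unitop_rot T t : unitop T -> unitop (fun x => cis t *: T x).
Proof.
move=> uT; split.
- by move=> a x y; rewrite (unitop_lin uT) scalerDr !scalerA mulrC.
- by move=> x y; rewrite hpZl hpZr cisN mulrA cisVr mul1r (unitop_hp uT).
- by move=> y; case: uT => _ _ /(_ (cis (- t) *: y))[x xE]; exists x;
  rewrite xE scalerA cisVr scale1r.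
Qed.

Lemma unitop_comp T D : unitop T -> unitop D -> unitop (T \o D).
Proof.
move=> uT uD; split.
- by move=> a x y; rewrite /= (unitop_lin uD) (unitop_lin uT).
- by move=> x y; rewrite /= (unitop_hp uT) (unitop_hp uD).
- move=> y; case: (uT) => _ _ /(_ y)[z <-]; case: (uD) => _ _ /(_ z)[x <-].
  by exists x.
Qed.

Lemma eigen_orth T s t x y : unitop T -> - pi < s < pi -> - pi < t < pi ->
  s != t ->
  T x = cis s *: x -> T y = cis t *: y -> hp x y = 0.
Proof.
move=> uT hs ht st Tx Ty; apply/eqP; apply: contraNT st => xy0.
apply/eqP/cis_inj => //; have := unitop_hp uT x y.
rewrite Tx Ty hpZl hpZr mulrA -[RHS]mul1r => /(mulIf xy0).
by move/(congr1 (fun u => u * cis t)); rewrite cisN -mulrA cisVl mulr1 mul1r.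
Qed.

Lemma bounded_below_ext W D D' : (forall x, D x = D' x) -> bounded_below W D ->
  bounded_below W D'.
Proof. by move=> E [c c0 Dc]; exists c => // x Wx; rewrite -E Dc. Qed.

(* The form of S = bt B - B^2 is <= 0: for m > 0, S - m is, up to sign, either
   (B - r1) (B - r2) with r1, r2 in the gap ]0, bt[ or definite. *)
Lemma gap_form B M bt : rlinear B -> rsym B ->
  (forall x, nrm (B x) <= M * nrm x) -> 0 < bt ->
  (forall r, 0 < r < bt -> bounded_below setT (fun x => B x - r%:C *: x)) ->
  forall x, bt * rip (B x) x <= rip (B x) (B x).
Proof.
move=> Blin Bsym BM bt0 Bb x; pose S x := bt%:C *: B x - B (B x).
have Slin : rlinear S.
  move=> r y z; rewrite /S !Blin scalerDr scalerBr !scalerA (mulrC bt%:C).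
  by rewrite opprD addrACA.
have Ssym : rsym S.
  by move=> y z; rewrite ripBl ripBr ripRl ripRr (Bsym y z) (Bsym (B y)) (Bsym y).
have [N N0 BN] : exists2 N, 0 < N & forall x, nrm (B x) <= N * nrm x.
  by apply: hbounded_ge0; exists M.
have SM y : nrm (S y) <= (bt * N + N * N) * nrm y.
  rewrite (le_trans (nrmB _ _))// nrm_R gtr0_norm// mulrDl lerD//.
    by rewrite -mulrA ler_pM2l.
  by rewrite (le_trans (BN _))// -mulrA ler_pM2l.
have Sm (m : R) : 0 < m -> bounded_below setT (fun x => S x - m%:C *: x).
  (* r (bt - r) has maximum bt^2/4. Up to there it takes the value m at points r1 <= r2 of ]0, bt[;
     beyond, the form of S - m is negative with margin m - bt^2/4. *)
  move=> m0; have [mb|mb] := leP m (bt ^+ 2 / 4).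
    pose q := Num.sqrt (bt ^+ 2 - 4 * m).
    have q2 : q ^+ 2 = bt ^+ 2 - 4 * m by rewrite sqr_sqrtr//; lra.
    have qbt : q < bt.
      by rewrite -(@ltr_pXn2r _ 2) ?nnegrE ?sqrtr_ge0 ?(ltW bt0)// q2; lra.
    have q0 : 0 <= q by exact: sqrtr_ge0.
    pose r1 := (bt - q) / 2; pose r2 := (bt + q) / 2.
    have [|c c0 Bc] := Bb r1; first by rewrite /r1; apply/andP; split; lra.
    have [|d d0 Bd] := Bb r2; first by rewrite /r2; apply/andP; split; lra.
    exists (c * d); rewrite ?mulr_gt0// => y _.
    have -> : nrm (S y - m%:C *: y) =
        nrm (B (B y - r2%:C *: y) - r1%:C *: (B y - r2%:C *: y)).
      rewrite -nrmN; congr nrm; rewrite (rlinB Blin) (rlinZ Blin) scalerBr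
        scalerA.
      rewrite -rmorphM /= (_ : r1 * r2 = m); last first.
        rewrite /r1 /r2 (_ : m = (bt ^+ 2 - q ^+ 2) / 4); last by rewrite q2; lra.
        by field.
      rewrite /S (_ : bt = r1 + r2); last by rewrite /r1 /r2; lra.
      rewrite rmorphD /= scalerDl !opprD !opprK.
      by rewrite !addrA; congr (_ + _); rewrite [LHS]addrC [in LHS](addrC (- _))
        addrA.
    by rewrite -mulrA (le_trans _ (Bc _ Logic.I))// ler_pM2l// Bd.
  exists (m - bt ^+ 2 / 4); first by rewrite subr_gt0.
  move=> y _; have [->|y0] := eqVneq y 0; first by rewrite nrm0 mulr0 nrm_ge0.
  rewrite -(@ler_pM2r _ (nrm y)) ?nrm_gt0// -mulrA -expr2 nrm2.
  rewrite -nrmN (le_trans _ (rip_le _ _))//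
    ripNl ripBl ripRl ripBl ripRl (Bsym (B y)).
  have := rip_ge0 (B y - (bt / 2)%:C *: y).
  rewrite ripBl !ripBr !ripRl !ripRr (ripC y (B y)); lra.
have S0 (m : R) : 0 < m -> rip (S x) x <= m * rip x x.
  move=> m0; have [//||c c0 Sc] := @form_sup _ _ setT S _ m Slin Ssym
    (@rsubspaceT _ _) _ SM.
    by move=> m' mm'; apply: Sm; apply: lt_le_trans mm'.
  rewrite (le_trans (Sc _ Logic.I))// ler_wpM2r ?rip_ge0//; lra.
have : rip (S x) x <= 0.
  apply: (@ler_archi _ _ _ (rip x x)) => n; rewrite add0r mulrC.
  by apply: S0; rewrite invr_gt0 ltr0n.
by rewrite ripBl ripRl (Bsym (B x)) subr_le0.
Qed.

Section Pair.
Variables (T T' : V -> V).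
Hypotheses (uT : unitop T) (uT' : unitop T') (TK : cancel T T') (TK' : cancel T'
  T).

(** Twice the self-adjoint part of T, since the inverse T' is its adjoint: results on self-adjoint
    operators reach T through it. *)
Let S2 x := T x + T' x.

Lemma rip_adj x y : rip (T x) y = rip x (T' y).
Proof. by rewrite -{1}(TK' y) (unitop_rip uT). Qed.

Lemma S2_lin : rlinear S2.
Proof. by move=> r x y; rewrite /S2 (unitop_lin uT) (unitop_lin uT') scalerDr
  addrACA. Qed.

Lemma S2_sym : rsym S2.
Proof. by move=> x y; rewrite ripDl ripDr rip_adj (ripC (T' x)) -(rip_adj y x)
  (ripC (T y)) addrC. Qed.

Lemma S2_nrm x : nrm (S2 x) <= 2 * nrm x.
Proof. by rewrite (le_trans (nrmD _ _))//
  (unitop_nrm uT) (unitop_nrm uT') mulr_natl mulr2n. Qed.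

Lemma S2_rip x : rip (S2 x) x = 2 * rip (T x) x.
Proof. by rewrite ripDl [rip (T' x) x]ripC -rip_adj mulr_natl mulr2n. Qed.

(* T^2 + 1 - 2 cos t T = (T - e^it) (T - e^-it) *)
Lemma S2_factor t x : let u := T x - cis (- t) *: x in
  T (S2 x - (2 * cos t)%:C *: x) = T u - cis t *: u.
Proof.
rewrite /= -cis_add_conj /S2 !(unitopB uT) (unitopD uT) !(unitopZ uT) TK'
  scalerDl.
rewrite scalerBr scalerA cisVr scale1r [cis t *: T x + _]addrC !opprD opprK.
by rewrite addrACA; congr (_ + _); rewrite addrC.
Qed.

Lemma S2_bounded_below F t : (forall x, F x -> F (T x - cis (- t) *: x)) ->
  bounded_below F (fun x => T x - cis t *: x) ->
  bounded_below F (fun x => T x - cis (- t) *: x) ->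
  bounded_below F (fun x => S2 x - (2 * cos t)%:C *: x).
Proof.
move=> FT [c c0 Tc] [d d0 Td]; exists (c * d); rewrite ?mulr_gt0// => x Fx.
rewrite -(unitop_nrm uT (S2 x - _)) S2_factor (le_trans _ (Tc _ (FT _ Fx)))//.
by rewrite -mulrA ler_pM2l// Td.
Qed.

(* Apply [gap_form] to B = |T - 1|^2 = 2 - T - T^-1: it bounds B from below on
   its range, hence on the closure of its range, which is the orthogonal
   complement of the kernel. *)
Lemma isolated_bounded_below1 : (exists2 e, 0 < e & forall t, 0 < `|t| < e ->
  regular_pt T (cis t)) ->
  bounded_below [set x | forall y, T y = y -> rip x y = 0] (fun x => T x - x).
Proof.
move=> [e e0 Te]; pose B x := (2%:C : C) *: x - S2 x.
have Blin : rlinear B.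
  by move=> r x y; rewrite /B S2_lin scalerDr !scalerBr !scalerA mulrC opprD
    addrACA.
have Bsym : rsym B by move=> x y; rewrite ripBl ripBr ripRl ripRr S2_sym.
have BM x : nrm (B x) <= 4 * nrm x.
  rewrite (le_trans (nrmB _ _))// nrm_R ger0_norm//.
  by have := S2_nrm x; lra.
(* Half the minimum keeps t1 in the punctured neighbourhood and in ]0, pi[, where cos is strictly
   decreasing. *)
pose t1 := Num.min e pi / 2.
have t10 : 0 < t1 by rewrite divr_gt0// lt_min e0 pi_gt0.
have t1e : t1 < e.
  by rewrite ltr_pdivrMr// (@le_lt_trans _ _ e) ?ge_min ?lexx//; lra.
have t1pi : t1 < pi.
  have := pi_gt0 R => p0.
  by rewrite ltr_pdivrMr// (@le_lt_trans _ _ pi) ?ge_min ?lexx ?orbT//; lra.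
(* The value of |z - 1|^2 at z = e^(i t1). Every b in ]0, bt[ equals 2 - 2 cos t with 0 < t < t1,
   and both t and -t are regular angles. *)
pose bt := 2 - 2 * cos t1.
have bt0 : 0 < bt.
  have : cos t1 < cos 0 by rewrite ltr_cos ?in_itv /= ?lexx ?pi_ge0// ltW//= ltW.
  by rewrite cos0 /bt; lra.
have Bb (b : R) : 0 < b < bt -> bounded_below setT (fun x => B x - b%:C *: x).
  move=> /andP[b0 bbt]; pose t := acos (1 - b / 2).
  have b11 : -1 <= 1 - b / 2 <= 1.
    by have := cos_geN1 t1; move: bbt; rewrite /bt; lra.
  have ct : cos t = 1 - b / 2 by rewrite acosK.
  have t0 : 0 < t.
    rewrite lt_neqAle acos_ge0// andbT; apply/eqP => t0.
    by move: ct; rewrite -t0 cos0; lra.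
  have tt1 : t < t1.
    rewrite -ltr_cos ?in_itv /= ?(ltW t10) ?(ltW t1pi) ?(ltW t0) ?acos_lepi//.
    by rewrite ct; move: bbt; rewrite /bt; lra.
  have [|||c c0 Sc] := @S2_bounded_below setT t => //.
  - by apply: Te; rewrite gtr0_norm// t0 (lt_trans tt1).
  - by apply: Te; rewrite normrN gtr0_norm// t0 (lt_trans tt1).
  exists c => // x _; rewrite (le_trans (Sc _ Logic.I))// nrmC.
  rewrite /B addrAC -scalerBl -rmorphB /= (_ : 2 - b = 2 * cos t)// ct; lra.
have B0 x : 0 <= rip (B x) x.
  rewrite ripBl ripRl S2_rip -mulrBr mulr_ge0// subr_ge0.
  by rewrite (le_trans (rip_le _ _))// (unitop_nrm uT) -expr2 nrm2.
have BB x : bt * rip (B x) x <= rip (B x) (B x) := gap_form Blin Bsym BM bt0 Bb x.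
have kerB u : B u = 0 -> T u = u.
  move=> Bu; apply/eqP; rewrite -subr_eq0 -rip_eq0 ripBl !ripBr (unitop_rip uT)
    (ripC u (T u)).
  have : rip (B u) u = 0 by rewrite Bu rip0l.
  rewrite /B ripBl ripRl S2_rip => h; apply/eqP; lra.
pose W := range B.
have Brange : bounded_below W B.
  exists bt => // _ [x _ <-]; set y := B x.
  have [->|y0] := eqVneq y 0; first by rewrite nrm0 mulr0 nrm_ge0.
  rewrite -(@ler_pM2r _ (nrm y)) ?nrm_gt0// -mulrA -expr2 nrm2.
  rewrite (le_trans _ (rip_le _ _))//.
  (* Nonnegativity of the form at y - bt x, where y = B x, combines with [BB] into <B y, y> >= bt
     |y|^2. *)
  have := B0 (y - bt%:C *: x); rewrite (rlinB Blin) (rlinZ Blin) -/y.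
  rewrite ripBl !ripBr !ripRl !ripRr (Bsym y x) -/y.
  have := BB x; rewrite -/y => h1 h2.
  have : bt * (bt * rip y x) <= bt * rip y y by rewrite ler_pM2l.
  by lra.
have sW : csubspace W.
  split; first by exists 0 => //; exact: rlin0.
  move=> a _ _ [x _ <-] [y _ <-]; exists (a *: x + y) => //.
  rewrite /B /S2 (unitop_lin uT) (unitop_lin uT') scalerDr !scalerBr scalerDr
    !scalerA mulrC.
  by rewrite [a *: T x + _ + _]addrACA opprD addrACA.
have Bbdd : hbounded B by exists 4.
have [c c0 Bc] := bounded_below_hclosure Blin Bbdd Brange.
exists (c / 2); first by rewrite divr_gt0.
(* The difference of x and its projection p on the closed range is killed by B, hence fixed by T; it
   is then orthogonal to x by [Fx] and to p, so it vanishes. *)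
move=> x Fx; have cx : hclosure W x.
  have [p Wp xp] := projection x (csubspace_rsubspace (csubspace_hclosure sW))
    (@hclosed_hclosure _ _ W).
  suff /eqP : x - p = 0 by rewrite subr_eq0 => /eqP ->.
  have Bu : B (x - p) = 0.
    apply: rip_eqP => z; rewrite Bsym rip0l; apply: xp; apply: hclosure_sub.
    by exists z.
  have Tu := kerB _ Bu.
  apply/eqP; rewrite -rip_eq0 {1}(ripBl x p) (Fx _ Tu) sub0r oppr_eq0 ripC.
  by apply/eqP; apply: xp.
(* B x has the norm of (T - 1)^2 x, and one of the two factors costs at most 2. *)
have := Bc _ cx; have : nrm (B x) <= 2 * nrm (T x - x).
  have -> : nrm (B x) = nrm (T (T x - x) - (T x - x)).
    have := @S2_factor 0 x; rewrite /= oppr0 cis0 !scale1r cos0 mulr1 => <-.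
    by rewrite (unitop_nrm uT) nrmC.
  by rewrite (le_trans (nrmB _ _))// (unitop_nrm uT) mulr_natl mulr2n.
by lra.
Qed.

End Pair.
End Spectral.

(** Finiteness makes strict bounds uniform. It isolates an angle among finitely many, and later
    provides one radius for all intervals of a partition. *)
Lemma seq_lt_gap (R : realType) (T : eqType) (s : seq T) (f : T -> R) m :
  (forall t, t \in s -> m < f t) -> exists2 e, 0 < e & forall t, t \in s ->
    m + e <= f t.
Proof.
elim: s => [|a s IH] H; first by exists 1.
have [t ts|e e0 He] := IH; first by apply: H; rewrite in_cons ts orbT.
exists (Num.min e (f a - m)); first by rewrite lt_min e0 subr_gt0 H ?mem_head.
move=> t; rewrite in_cons => /predU1P[->|ts];
  rewrite -lerBrDl ge_min ?lexx ?orbT//.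
by rewrite lerBrDl He.
Qed.

(** * From isolated eigenvalues to a gap of the quadratic form *)

Section Gap.
Local Open Scope complex_scope.
Variables (R : realType) (V : hilbert R).
Local Notation C := (complex R).
Implicit Types (x y z : V) (W F : set V) (T D : V -> V).

Definition eigen T (t : R) : set V := [set x | T x = cis t *: x].

(* T has eigenvalues of total multiplicity n in the arc of half-opening h around
   1, no other spectrum there, and none at the end points of the arc; see
   [gap_exist] and [gap_sum]. *)
Definition spectral_gap T (h : R) n := exists2 v : 'I_n -> V, lin_indep v &
  exists2 d, 0 < d &
    (forall x, (forall i, hp x (v i) = 0) ->
      rip (T x) x <= (cos h - d) * rip x x) /\
    (forall x, span v x -> (cos h + d) * rip x x <= rip (T x) x).

Lemma isolated_bounded_below T t : unitop T ->
  (exists2 e, 0 < e & forall s, 0 < `|s| < e -> regular_pt T (cis (t + s))) ->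
  bounded_below [set x | forall y, eigen T t y -> hp x y = 0] (fun x =>
    T x - cis t *: x).
Proof.
move=> uT [e e0 Te]; pose T1 x := cis (- t) *: T x.
have uT1 : unitop T1 by exact: unitop_rot.
have [T' [uT' TK TK']] := unitop_inv uT1.
have nE x a : nrm (T1 x - cis a *: x) = nrm (T x - cis (t + a) *: x).
  by rewrite -(nrm_cis t) scalerBr /T1 !scalerA cisVr scale1r cisD.
have [|c c0 Tc] := isolated_bounded_below1 uT1 uT' TK'.
  exists e => // s /Te[c c0 Tc]; exists c => // x Wx; rewrite nE; exact: Tc.
exists c => // x Fx; have := nE x 0; rewrite cis0 scale1r addr0 => <-; apply: Tc.
move=> y /= Ty; apply: hp_eq0; apply: Fx.
by rewrite /eigen /= -{2}Ty /T1 scalerA cisVr scale1r.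
Qed.

(** Eigenspaces of distinct angles are orthogonal, so bases concatenate and forms add. The last two
    conclusions carry the induction: invariance of the span and orthogonality to angles not yet
    listed kill the cross terms. *)
Lemma eigen_family T k (ts : seq R) : unitop T -> uniq ts ->
  (forall t, t \in ts -> - pi < t < pi) -> (forall t, t \in ts -> k <= cos t) ->
  (forall t, t \in ts -> finite_dim (eigen T t)) ->
  exists v : 'I_(\sum_(t <- ts) dim (eigen T t)) -> V, [/\ lin_indep v,
    forall x, (forall i, hp x (v i) = 0) ->
      forall t y, t \in ts -> eigen T t y -> hp x y = 0,
    forall x, span v x -> k * rip x x <= rip (T x) x,
    forall x, span v x -> span v (T x) &
    forall x t y, span v x -> - pi < t < pi -> t \notin ts -> eigen T t y ->
      hp x y = 0].
Proof.
move=> uT; have [T' [uT' TK TK']] := unitop_inv uT.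
elim: ts => [|t ts IH] /=.
  move=> _ _ _ _; rewrite big_nil; exists (fun=> 0); split => //.
  - exact: lin_indep0.
  - by move=> x [a ->]; rewrite big_ord0 !rip0r mulr0.
  - by move=> x [a ->]; rewrite big_ord0 (rlin0 (unitop_rlin uT)); exact: span0.
  - by move=> x s y [a ->]; rewrite big_ord0 hp0l.
move=> /andP[tts uts] tpi tk tf; rewrite big_cons.
have [||||v' [v'i v'o v'k v'T v'n]] := IH => //.
- by move=> s sts; apply: tpi; rewrite in_cons sts orbT.
- by move=> s sts; apply: tk; rewrite in_cons sts orbT.
- by move=> s sts; apply: tf; rewrite in_cons sts orbT.
have [w [wi wE]] := finite_dimE (tf t (mem_head _ _)).
have hwv x y : span w x -> span v' y -> hp x y = 0.
  rewrite -wE => Ex Sy; apply: hp_eq0C; apply: v'n Sy _ tts Ex.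
  by apply: tpi; rewrite mem_head.
exists (cat_fam w v'); split.
- move=> a; rewrite sum_cat_fam.
  set y := \sum_i _; set z := \sum_i _ => /eqP; rewrite addr_eq0 => /eqP yz.
  have Sy : span w y by exists (fun i => a (lshift _ i)).
  have Sz : span v' z by exists (fun i => a (rshift _ i)).
  have y0 : y = 0.
    apply/eqP; rewrite -rip_eq0 {2}yz ripNr oppr_eq0; apply/eqP.
    exact/hp_eq0/hwv.
  have z0 : z = 0 by apply/eqP; rewrite -oppr_eq0 -yz y0.
  move=> i; case: (fintype.splitP i) => j ij.
    by have -> : i = lshift _ j; [exact: val_inj | exact: (wi (fun i =>
      a (lshift _ i)))].
  by have -> : i = rshift _ j; [exact: val_inj | exact: (v'i (fun i =>
    a (rshift _ i)))].
- move=> x xv s y; rewrite in_cons => /predU1P[->|sts] Ey.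
    move: Ey; rewrite wE => -[a ->]; apply: hp_eq0C; rewrite hp_suml big1// =>
      i _.
    by rewrite hpZl hp_eq0C ?mulr0// -(cat_famL w v').
  by apply: v'o sts Ey => i; rewrite -(cat_famR w v').
- move=> _ /span_catP[y [z [Sy Sz ->]]].
  have Ey : eigen T t y by rewrite wE.
  have yz := hwv _ _ Sy Sz.
  have yTz := hwv _ _ Sy (v'T _ Sz).
  have -> : rip (y + z) (y + z) = rip y y + rip z z.
    by rewrite ripDl !ripDr (ripC z y) (hp_eq0 yz) addr0 add0r.
  have Tyz : rip (cis t *: y) z = 0 by rewrite /rip hpZl yz mulr0.
  have -> : rip (T (y + z)) (y + z) = rip (cis t *: y) y + rip (T z) z.
    rewrite (unitopD uT) ripDl !ripDr (ripC (T z) y) (hp_eq0 yTz) Ey.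
    by rewrite Tyz addr0 add0r.
  have -> : rip (cis t *: y) y = cos t * rip y y.
    rewrite /rip hpZl /=; have := hpC y y; case: (hp y y) => p q [] /=.
    move=> qq; have -> : q = 0 by lra.
    by rewrite mulr0 subr0.
  have := v'k _ Sz; have : k * rip y y <= cos t * rip y y.
    by rewrite ler_wpM2r ?rip_ge0// tk ?mem_head.
  by rewrite mulrDr => *; apply: lerD.
- move=> _ /span_catP[y [z [Sy Sz ->]]]; rewrite (unitopD uT); apply/span_catP.
  exists (T y), (T z); split => //; last exact: v'T.
  have Ey : eigen T t y by rewrite wE.
  rewrite Ey -[_ *: _]addr0; apply: spanP => //; exact: span0.
- move=> _ s u /span_catP[y [z [Sy Sz ->]]] spi; rewrite in_cons negb_or =>
  /andP[st sts] Eu.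
  rewrite hpDl (v'n z s u)// addr0.
  have Ey : eigen T t y by rewrite wE.
  by apply: eigen_orth uT _ spi _ Ey Eu; rewrite 1?eq_sym// tpi ?mem_head.
Qed.

(** On the orthogonal complement F of the listed eigenspaces every T - e^it with |t| <= h is bounded
    below, by regularity or because t is isolated. Hence T + T^-1 - m is bounded below on F for all
    m >= 2 cos h, and [form_sup] pushes its form strictly below 2 cos h. *)
Lemma gap_exist T h (ts : seq R) : unitop T -> 0 < h < pi -> uniq ts ->
  (forall t, t \in ts -> - h < t < h) ->
  (forall t, t \in ts -> finite_dim (eigen T t)) ->
  (forall t, t \in `[- h, h] -> t \notin ts -> regular_pt T (cis t)) ->
  spectral_gap T h (\sum_(t <- ts) dim (eigen T t)).
Proof.
move=> uT /andP[h0 hpi] uts tsh tsf tsr.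
have tspi t : t \in ts -> - pi < t < pi by move=> /tsh; lra.
have [t tts|e e0 he] := @seq_lt_gap _ _ ts cos (cos h).
  have /andP[t1 t2] := tsh _ tts.
  have -> : cos t = cos `|t| by case: (ger0P t); rewrite ?cosN.
  have th : `|t| < h by rewrite ltr_norml t1 t2.
  by rewrite ltr_cos ?in_itv /= ?normr_ge0 ?(ltW h0) ?(ltW hpi)// ltW//
    (lt_trans th).
have [v [vi vo vk vT _]] := eigen_family uT uts tspi he tsf.
exists v => //; have [T' [uT' TK TK']] := unitop_inv uT.
pose F := [set x | forall t y, t \in ts -> eigen T t y -> hp x y = 0].
have Fv x : (forall i, hp x (v i) = 0) -> F x by exact: vo.
have FT x : F x -> F (T x).
  move=> Fx t y tts Ey; have -> : y = T (cis (- t) *: y).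
    by rewrite (unitopZ uT) Ey scalerA cisVl scale1r.
  by rewrite (unitop_hp uT) hpZr (Fx _ _ tts Ey) mulr0.
have FT' x : F x -> F (T' x).
  move=> Fx t y tts Ey; rewrite -(unitop_hp uT) TK' Ey hpZr.
  by rewrite (Fx _ _ tts Ey) mulr0.
have sF : csubspace F.
  split; first by move=> t y _ _; rewrite hp0l.
  by move=> a x y Fx Fy t z tts Ez; rewrite hpPl (Fx _ _ tts Ez) (Fy _ _ tts Ez)
    mulr0 addr0.
have Fres t : t \in `[- h, h] -> bounded_below F (fun x => T x - cis t *: x).
  move=> th; have [tts|tts] := boolP (t \in ts); last first.
    by have [c c0 Tc] := tsr _ th tts; exists c => // x _; exact: Tc.
  have [|c c0 Tc] := @isolated_bounded_below T t uT; last first.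
    by exists c => // x Fx; apply: Tc => y; exact: Fx.
  have [s|e2 e20 he2] := @seq_lt_gap _ _ [seq s <- ts | s != t] (fun s =>
    `|s - t|) 0.
    by rewrite mem_filter normr_gt0 subr_eq0 => /andP[].
  have /andP[t1 t2] := tsh _ tts.
  (* Within this radius t + s avoids the other listed angles and stays in the arc, so it is
     regular. *)
  exists (Num.min e2 (Num.min (h - t) (t + h))).
    by rewrite !lt_min e20 subr_gt0 t2 /=; lra.
  move=> s /andP[s0]; rewrite !lt_min => /and3P[s1 s2 s3].
  apply: tsr.
    by rewrite in_itv /=; move: s2 s3; rewrite !ltr_norml; lra.
  apply/negP => sts; have tst : t + s != t by rewrite -subr_eq0 addrAC subrr
    add0r -normr_gt0.
  have := he2 (t + s); rewrite mem_filter tst sts addrAC subrr !add0r leNgt s1.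
  by move=> /(_ isT).
pose S x := T x + T' x.
have Slin := S2_lin uT uT'.
have [x Fx|m hm|c c0 Sc] := @form_sup _ _ F S 2 (2 * cos h) Slin (S2_sym uT TK')
  (csubspace_rsubspace sF) _ (S2_nrm uT uT').
- by apply: (rsubspaceD (csubspace_rsubspace sF)); [exact: FT|exact: FT'].
(* Above 2 the norm bound on S suffices; otherwise m = 2 cos t with 0 <= t <= h. *)
- have [m2|m2] := ltP 2 m.
    exists (m - 2); first by rewrite subr_gt0.
    move=> x _; have := nrm_lerB (m%:C *: x) (S x); rewrite nrmC nrm_R ger0_norm;
      last by lra.
    by apply: le_trans; rewrite mulrBl lerD2l lerN2; exact: S2_nrm.
  pose t := acos (m / 2).
  have m11 : -1 <= m / 2 <= 1 by have := cos_geN1 h; lra.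
  have ct : m = 2 * cos t by rewrite /t acosK//; lra.
  have t0 : 0 <= t by rewrite acos_ge0.
  have th : t <= h.
    rewrite leNgt; apply/negP => ht; have : cos t < cos h.
      by rewrite ltr_cos ?in_itv /= ?(ltW h0) ?(ltW hpi) ?t0 ?acos_lepi.
    by move: hm; rewrite {1}ct; lra.
  rewrite ct; apply: S2_bounded_below => //.
  + move=> x Fx; rewrite addrC -scaleNr; apply: sF.2 => //; exact: FT.
  + by apply: Fres; rewrite in_itv /=; lra.
  + by apply: Fres; rewrite in_itv /=; lra.
(* On the eigenvectors cos t >= cos h + e; on F the constant c is halved because the form of S is
   twice that of T. *)
exists (Num.min e (c / 2)); first by rewrite lt_min e0 divr_gt0.
split => x.
  move=> /Fv/Sc; rewrite (S2_rip uT TK') => h1.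
  have : Num.min e (c / 2) * rip x x <= c / 2 * rip x x.
    by rewrite ler_wpM2r ?rip_ge0// ge_min lexx orbT.
  by move: (Num.min _ _) => m; rewrite !mulrBl in h1 *; lra.
move=> /vk; apply: le_trans; rewrite ler_wpM2r ?rip_ge0// lerD2l.
by rewrite ge_min lexx.
Qed.

End Gap.

(** * From a gap back to eigenvalues: counting, uniqueness, stability *)

Section Count.
Local Open Scope complex_scope.
Variables (R : realType) (V : hilbert R).
Local Notation C := (complex R).
Implicit Types (x y z : V) (T D : V -> V).

(** The upper half of [spectral_gap], on the kernel of a linear map instead of an orthogonal
    complement. The Fredholm condition gives this half before any eigenvalue is known. *)
Definition upper_gap T (h : R) n := exists2 f : V -> 'rV[C]_n, linear f &
  exists2 d, 0 < d & forall x, f x = 0 -> rip (T x) x <= (cos h - d) * rip x x.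

Lemma gap_upper_gap T h n : spectral_gap T h n -> upper_gap T h n.
Proof.
move=> [v _ [d d0 [dv _]]]; exists (fun x => \row_i hp x (v i)).
  by move=> a x y; apply/rowP => i; rewrite !mxE hpPl.
by exists d => // x /rowP fx; apply: dv => i; have := fx i; rewrite !mxE.
Qed.

(** With m > n, some nonzero combination of the [w i] would lie in the kernel of f, where the form
    is at most cos h - d. *)
Lemma upper_gap_size T h n m (w : 'I_m -> V) : upper_gap T h n -> lin_indep w ->
  (forall x, span w x -> cos h * rip x x <= rip (T x) x) -> (m <= n)%N.
Proof.
move=> [f lf [d d0 fd]] wi wh; rewrite leqNgt; apply/negP => nm.
have [u u0 uA] := @exists_kernel_comb _ _ _ (\matrix_i f (w i)) nm.
pose x := \sum_i u 0 i *: w i.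
have fx : f x = 0.
  have f00 : f 0 = 0 by have := lf (-1) 0 0; rewrite scaler0 addr0 scaleN1r addNr.
  rewrite -uA mulmx_sum_row /x; elim/big_rec2: _ => // i y z _ <-.
  by rewrite lf rowK.
have sx : span w x by exists (u 0).
have x0 : x != 0.
  apply: contraNneq u0 => /wi ui; apply/eqP/rowP => i; by rewrite ui mxE.
have := le_trans (wh _ sx) (fd _ fx).
by rewrite ler_pM2r ?rip_gt0//; lra.
Qed.

Lemma rip_cisl t x : rip (cis t *: x) x = cos t * rip x x.
Proof.
rewrite /rip hpZl /=; have := hpC x x; case: (hp x x) => p q [] /=.
by move=> qq; have -> : q = 0 by [lra]; rewrite mulr0 subr0.
Qed.

Lemma rip_eigen T t x : eigen T t x -> rip (T x) x = cos t * rip x x.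
Proof. by move=> ->; exact: rip_cisl. Qed.

Lemma csubspace_eigen T t : unitop T -> csubspace (eigen T t).
Proof.
move=> uT; split; first by rewrite /eigen /= (rlin0 (unitop_rlin uT)) scaler0.
move=> a x y; rewrite /eigen /= => Ex Ey; rewrite (unitop_lin uT) Ex Ey scalerDr.
by rewrite !scalerA mulrC.
Qed.

Lemma upper_gap_finite_dim T h n t : unitop T -> 0 <= h <= pi ->
  upper_gap T h n ->
  t \in `[- h, h] -> finite_dim (eigen T t).
Proof.
move=> uT hpi eT th; have [E0 sE] := csubspace_eigen t uT.
have [|m _ Em] := @finite_dim_bounded _ _ (eigen T t) n E0 sE; last by exists m.
move=> m w wi wE; apply: (upper_gap_size eT wi) => x [a ->].
have Ex : eigen T t (\sum_i a i *: w i).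
  elim/big_ind: _ => // [y z Ey Ez|i _].
    by rewrite -[y]scale1r; apply: sE.
  by rewrite -[_ *: _]addr0; apply: sE.
by rewrite (rip_eigen Ex) ler_wpM2r ?rip_ge0// cos_le_itv.
Qed.

(** On the kernel of f the forms of e^it and T differ by at least d, which bounds T - e^it below
    there; injectivity extends the bound to the whole space by [bounded_below_fin_codim]. *)
Lemma upper_gap_res T h n t : unitop T -> 0 <= h <= pi -> upper_gap T h n ->
  t \in `[- h, h] -> (forall x, eigen T t x -> x = 0) -> regular_pt T (cis t).
Proof.
move=> uT hpi [f lf [d d0 fd]] th E0.
have lD := combK_lin uT 1 (cis t); have bD := combK_hbounded uT 1 (cis t).
have scE x : 1 *: T x - cis t *: x = T x - cis t *: x by rewrite scale1r.
apply: (bounded_below_ext scE); apply: (@bounded_below_fin_codim _ _ _ [set x | f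
  x = 0]) => //.
- by move=> x /eqP; rewrite scale1r subr_eq0 => /eqP; exact: E0.
- by exists n, f.
exists d => // x fx; rewrite scale1r.
have [->|x0] := eqVneq x 0; first by rewrite nrm0 mulr0 nrm_ge0.
rewrite -(@ler_pM2r _ (nrm x)) ?nrm_gt0// -mulrA -expr2 nrm2 nrmC.
rewrite (le_trans _ (rip_le _ _))// ripBl rip_cisl lerBrDr -lerBrDl.
rewrite (le_trans (fd _ fx))// -mulrBl ler_wpM2r ?rip_ge0// lerD2r.
exact: cos_le_itv.
Qed.

Lemma has_dim_gt0 (S : set V) : finite_dim S -> S <> [set 0] -> (0 < dim S)%N.
Proof.
move=> /finite_dimE; case: (dim S) => // -[v [_ ->]] []; apply/seteqP; split.
  by move=> x [a ->]; rewrite big_ord0.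
by move=> x ->; exact: span0.
Qed.

(** Take a list of eigenangles of maximal length, which [upper_gap_size] bounds by n. Any other
    angle of the arc has trivial eigenspace, hence is regular. *)
Lemma upper_gap_spec T h n : unitop T -> 0 <= h < pi -> upper_gap T h n ->
  exists ts : seq R, [/\ uniq ts,
    forall t, t \in ts -> t \in `[- h, h] /\ eigen T t <> [set 0] &
    forall t, t \in `[- h, h] -> t \notin ts -> regular_pt T (cis t)].
Proof.
move=> uT /andP[h0 hpi] eT.
have h0pi : 0 <= h <= pi by rewrite h0 ltW.
pose good ts := uniq ts /\ forall t, t \in ts -> t \in `[- h,
  h] /\ eigen T t <> [set 0].
pose P m := `[< exists ts : seq R, good ts /\ size ts = m >].
have P0 : exists m, P m by exists 0%N; apply/asboolP; exists [::].
have Pn m : P m -> (m <= n)%N.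
  move=> /asboolP[ts [[uts tsg] <-]].
  have fd t : t \in ts -> finite_dim (eigen T t).
    by move=> /tsg[th _]; exact: upper_gap_finite_dim eT th.
  have [t tts|t tts||v [vi _ vk _ _]] := @eigen_family _ _ T (cos h) ts uT uts.
  - by have [] := tsg _ tts; rewrite in_itv /= => th _; move: hpi; lra.
  - by have [th _] := tsg _ tts; exact: cos_le_itv.
  - exact: fd.
  apply: leq_trans (upper_gap_size eT vi vk).
  rewrite -sum1_size big_seq [leqRHS]big_seq; apply: leq_sum => t tts.
  by apply: has_dim_gt0; [exact: fd | have [] := tsg _ tts].
case: (ex_maxnP P0 Pn) => m /asboolP[ts [[uts tsg] tsm]] mmax.
exists ts; split => // t th tts; apply: upper_gap_res eT (th) _ => //.
apply: contrapT => E0; have : P m.+1.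
  apply/asboolP; exists (t :: ts); split; last by rewrite /= tsm.
  split; first by rewrite /= tts.
  move=> s; rewrite in_cons => /predU1P[->|/tsg//]; split => //.
  by move=> E; apply: E0 => x; rewrite E.
by move=> /mmax; rewrite ltnn.
Qed.

(** Gram-Schmidt, one vector at a time. The orthogonality obtained is Hermitian, whereas
    [projection] states it for the real form. *)
Lemma proj_span n (v : 'I_n -> V) x :
  exists2 p, span v p & forall i, hp (x - p) (v i) = 0.
Proof.
elim: n v x => [|n IH] v x; first by exists 0; [exact: span0|case].
pose w i := v (widen_ord (leqnSn n) i); pose u := v ord_max.
have wv y : span w y -> span v y.
  by move=> [a ->]; apply: span_sum => i; exact: span_mem.
have w_orth y z : span w z -> (forall i, hp y (w i) = 0) -> hp y z = 0.
  move=> [a ->] yw; apply: hp_eq0C; rewrite hp_suml big1// => i _.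
  by rewrite hpZl hp_eq0C ?mulr0.
have vE y : (forall i, hp y (w i) = 0) -> hp y u = 0 -> forall i, hp y (v i) = 0.
  move=> yw yu i; case: (unliftP ord_max i) => [j|] ->//.
  rewrite -(yw j) /w; congr (hp _ (v _)); apply: val_inj.
  by rewrite /= /bump leqNgt ltn_ord.
have [p wp xp] := IH w x; have [q wq uq] := IH w u.
have [u0|u0] := eqVneq (u - q) 0.
  exists p; first exact: wv.
  by apply: vE => //; move/eqP: u0; rewrite subr_eq0 => /eqP ->; exact: w_orth.
pose c := hp (x - p) (u - q) / hp (u - q) (u - q).
have uu : hp (u - q) (u - q) != 0.
  by apply: contraNneq u0 => E; rewrite -rip_eq0 (hp_eq0 E).
have wc i : hp (x - (c *: (u - q) + p)) (w i) = 0.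
  by rewrite opprD addrCA hpDl xp addr0 hpNl hpZl uq mulr0 oppr0.
exists (c *: (u - q) + p).
  apply: spanP; last exact: wv.
  have := spanP (-1) (wv _ wq) (span_mem v ord_max).
  by rewrite scaleN1r addrC.
have cu : hp (x - (c *: (u - q) + p)) (u - q) = 0.
  by rewrite opprD addrCA hpDl hpNl hpZl /c divfK// addNr.
apply: vE => //; move: cu; rewrite hpBr => /eqP; rewrite subr_eq0 => /eqP ->.
exact: w_orth wq wc.
Qed.

(** The span of v need not be invariant, so T + T^-1 - 2 cos h is tested against p - q, where x = p
    + q with p in the span and q orthogonal to it. The cross terms cancel by symmetry, the two
    halves of the gap add up, and |p - q| = |x|. The factorization then bounds both T - e^(ih) and T
    - e^(-ih) below. *)
Lemma gap_ends T h n : unitop T -> spectral_gap T h n ->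
  regular_pt T (cis h) /\ regular_pt T (cis (- h)).
Proof.
move=> uT [v vi [d d0 [dn dp]]]; have [T' [uT' TK TK']] := unitop_inv uT.
have Tlin := unitop_rlin uT.
have Sd x : d * nrm x <= nrm (T x + T' x - (2 * cos h)%:C *: x).
  have [p vp px] := proj_span v x; pose q := x - p.
  have pq : rip p q = 0.
    rewrite ripC; move: vp => [a ->]; apply: hp_eq0; apply: hp_eq0C.
    by rewrite hp_suml big1// => i _; rewrite hpZl hp_eq0C ?mulr0.
  have xE : x = p + q by rewrite /q addrC subrK.
  have [->|x0] := eqVneq x 0; first by rewrite nrm0 mulr0 nrm_ge0.
  have nx : nrm (p - q) = nrm x.
    apply: eq_nrm; rewrite {}xE; move: (q) pq => {}q pq.
    rewrite ripBl ripDl !ripBr !ripDr (ripC q p) pq; lra.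
  rewrite -(@ler_pM2r _ (nrm x)) ?nrm_gt0// -mulrA -expr2 nrm2 -nx.
  rewrite (le_trans _ (rip_le _ _))//.
  have := dn _ px; have := dp _ vp; rewrite -/q.
  clear nx px; move: (q) pq xE => {}q pq ->.
  have -> : rip (p + q) (p + q) = rip p p + rip q q.
    by rewrite ripDl !ripDr (ripC q p) pq addr0 add0r.
  rewrite (unitopD uT) (unitopD uT') scalerDr.
  rewrite opprD !(ripBl, ripDl, ripNl) !(ripBr, ripDr) !ripRl.
  rewrite (ripC (T' p) p) (ripC (T' q) q) (ripC (T' p) q) (ripC (T' q) p).
  rewrite -!(rip_adj uT TK') (ripC q p) pq.
  have := mulr_ge0 (ltW d0) (rip_ge0 p); have := mulr_ge0 (ltW d0) (rip_ge0 q).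
  rewrite !mulrBl !mulrDl; lra.
have key s : cos s = cos h -> regular_pt T (cis s).
  move=> cs; exists (d / 2); first by rewrite divr_gt0.
  move=> x _; have := Sd x; rewrite -cs -(cosN s).
  rewrite -(unitop_nrm uT (T x + T' x - _)) (S2_factor uT TK') opprK.
  set u := T x - _.
  have : nrm (T u - cis (- s) *: u) <= nrm u + nrm u.
    by rewrite (le_trans (nrmB _ _))// (unitop_nrm uT) nrm_cis.
  by lra.
by split; apply: key => //; rewrite cosN.
Qed.

Lemma gap_uniq T h n m : spectral_gap T h n -> spectral_gap T h m -> n = m.
Proof.
suff le n' m' : spectral_gap T h n' -> spectral_gap T h m' -> (n' <= m')%N.
  by move=> gn gm; apply/eqP; rewrite eqn_leq !le.
move=> [v vi [d d0 [_ dp]]] /gap_upper_gap e; apply: (upper_gap_size e vi) =>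
  x /dp.
by apply: le_trans; rewrite ler_wpM2r ?rip_ge0// lerDl ltW.
Qed.

(** [gap_exist] on the list of all eigenangles of the arc gives a second gap, and [gap_uniq]
    identifies its dimension with n. [gap_ends] keeps the angles off the end points. *)
Lemma gap_sum T h n : unitop T -> 0 < h < pi -> spectral_gap T h n ->
  exists ts : seq R, [/\ uniq ts,
    forall t, t \in ts -> [/\ - h < t < h, eigen T t <> [set 0] &
      finite_dim (eigen T t)],
    forall t, t \in `[- h, h] -> t \notin ts -> regular_pt T (cis t) &
    n = \sum_(t <- ts) dim (eigen T t)].
Proof.
move=> uT hpi gT; have eT := gap_upper_gap gT; have /andP[h0 hp'] := hpi.
have [|ts [uts tsE tsr]] := upper_gap_spec uT _ eT; first by rewrite ltW.
have fd t : t \in ts -> finite_dim (eigen T t).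
  by move=> /tsE[th _]; apply: upper_gap_finite_dim eT th => //; rewrite !ltW.
have [r1 r2] := gap_ends uT gT.
have res0 t : regular_pt T (cis t) -> eigen T t = [set 0].
  move=> [c c0 Tc]; apply/seteqP; split => x /=.
    move=> Ex; have := Tc x Logic.I; rewrite Ex subrr nrm0 pmulr_rle0//.
    by move=> h1; apply/eqP; rewrite -nrm_eq0 eq_le h1 nrm_ge0.
  by move=> ->; have [] := csubspace_eigen t uT.
have tsh t : t \in ts -> - h < t < h.
  move=> /tsE[]; rewrite in_itv /= !lt_neqAle => /andP[-> ->] E; rewrite !andbT.
  by apply/andP; split; apply/eqP => eh; apply: E; [rewrite -eh|rewrite eh];
    exact: res0.
exists ts; split => //.
  by move=> t tts; split; [exact: tsh|have [] := tsE _ tts|exact: fd].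
by apply: (gap_uniq gT); apply: gap_exist.
Qed.

(** The same family v serves for T1: only quadratic forms enter, and half of d absorbs the
    perturbation. *)
Lemma gap_open T h n : spectral_gap T h n -> exists2 e, 0 < e &
  forall T1, (forall x, nrm (T1 x - T x) <= e * nrm x) -> spectral_gap T1 h n.
Proof.
move=> [v vi [d d0 [dn dp]]]; exists (d / 2); first by rewrite divr_gt0.
move=> T1 T1e; exists v => //; exists (d / 2); first by rewrite divr_gt0.
have T1x x : `|rip (T1 x) x - rip (T x) x| <= d / 2 * rip x x.
  rewrite -ripBl (le_trans (rip_normM _ _))// -nrm2 expr2 mulrA.
  by rewrite ler_wpM2r ?nrm_ge0.
split => x.
  by move=> /dn; have := T1x x; rewrite ler_norml !mulrBl; lra.
by move=> /dp; have := T1x x; rewrite ler_norml !mulrDl; lra.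
Qed.

End Count.

(** * The spectrum near -1 and crossing counts *)

Section Crossing.
Local Open Scope complex_scope.
Variables (R : realType) (V : hilbert R).
Local Notation C := (complex R).
Implicit Types (x y z : V) (T D : V -> V).

(* Moves the center of an arc from e^ic to 1. *)
Definition rotop (c : R) T x := cis (- c) *: T x.
(* For unitary T this amounts to T + Id being Fredholm. *)
Definition fredholm_m1 T := exists2 d, 0 < d &
  fin_codim [set x | d * nrm x <= nrm (T x + x)].
Definition admissible T (e : R) := 0 < e < pi /\ exists n,
  spectral_gap (rotop pi T) e n.
Definition crossing_count T (e : R) : int := \sum_(th \in `[0,
  e]) (dim (eigen T (pi + th)))%:Z.

Lemma unitop_rotop c T : unitop T -> unitop (rotop c T).
Proof. exact: unitop_rot. Qed.

Lemma rotop_sub c T s x : nrm (rotop c T x - cis s *: x) = nrm (T x - cis (c + s)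
  *: x).
Proof. by rewrite -(nrm_cis c) scalerBr /rotop !scalerA cisVr scale1r cisD. Qed.

Lemma eigen_rotop c T s : eigen (rotop c T) s = eigen T (c + s).
Proof.
have E x : eigen (rotop c T) s x <-> eigen T (c + s) x.
  rewrite /eigen /=; split => /eqP; rewrite -subr_eq0 -nrm_eq0.
    by rewrite rotop_sub nrm_eq0 subr_eq0 => /eqP.
  by rewrite -rotop_sub nrm_eq0 subr_eq0 => /eqP.
by apply/seteqP; split => x /E.
Qed.

Lemma res_rotop c T s : regular_pt (rotop c T) (cis s) <-> regular_pt T (cis (c +
  s)).
Proof.
split=> -[e e0 Te]; exists e => // x _; have := Te x Logic.I;
  by rewrite rotop_sub.
Qed.

Lemma cispi : cis (- pi) = -1 :> C.
Proof. by rewrite /cis cosN sinN cospi sinpi oppr0; apply/eqP;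
  rewrite eq_complex /= oppr0 !eqxx. Qed.

(** Since |T x + x|^2 = 2 |x|^2 + 2 Re <T x, x>, the Fredholm bound is an [upper_gap] for -T. Only
    finitely many eigenangles then lie near pi, so a punctured neighbourhood of -1 is regular. *)
Lemma fredholm_m1_gap T : unitop T -> fredholm_m1 T -> exists e, [/\ 0 < e < pi,
  finite_dim (eigen T pi) &
  forall s, 0 < `|s| <= e -> regular_pt T (cis (pi + s))].
Proof.
move=> uT [d' d'0 [n [f [lf fP']]]].
pose d := Num.min d' 1.
have d0 : 0 < d by rewrite lt_min d'0 ltr01.
have d1 : d <= 1 by rewrite ge_min lexx orbT.
have fP x : f x = 0 -> d * nrm x <= nrm (T x + x).
  by move=> /fP'; apply: le_trans; rewrite ler_wpM2r ?nrm_ge0// ge_min lexx.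
have dd : d ^+ 2 <= 1 by rewrite expr_le1// ltW.
have dd0 : 0 < d ^+ 2 by rewrite exprn_gt0.
(* On the kernel of f the form of -T is at most 1 - d^2/2 = cos h - d^2/4; the truncation d <= 1
   puts cos h in ]-1, 1[. *)
pose h := acos (1 - d ^+ 2 / 4).
have hb : -1 <= 1 - d ^+ 2 / 4 <= 1 by lra.
have ch : cos h = 1 - d ^+ 2 / 4 by rewrite acosK.
have h0 : 0 < h.
  rewrite lt_neqAle acos_ge0// andbT; apply/eqP => h0.
  by move: ch; rewrite -h0 cos0; lra.
have hpi : h < pi.
  rewrite lt_neqAle acos_lepi// andbT; apply/eqP => hpi.
  by move: ch; rewrite hpi cospi; lra.
have uM := unitop_rotop pi uT.
have eM : upper_gap (rotop pi T) h n.
  exists f => //; exists (d ^+ 2 / 4); first by rewrite divr_gt0.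
  move=> x /fP; rewrite -[nrm (T x + x)]mul1r nrm_rip_le ?(ltW d0)// expr1n mul1r.
  rewrite /rotop cispi scaleN1r ripNl ripDl !ripDr (unitop_rip uT) (ripC x (T x))
    ch.
  by rewrite !mulrBl; lra.
have [|ts [uts tsE tsr]] := upper_gap_spec uM _ eM; first by rewrite hpi ltW.
have [t|e0 e00 he0] := @seq_lt_gap _ _ [seq t <- ts | t != 0] (fun t => `|t|) 0.
  by rewrite mem_filter normr_gt0 => /andP[].
pose e := Num.min e0 h / 2.
have m0 : 0 < Num.min e0 h by rewrite lt_min e00 h0.
have e_0 : 0 < e by rewrite divr_gt0.
have ee0 : e < e0.
  have : Num.min e0 h <= e0 by rewrite ge_min lexx.
  by rewrite /e; lra.
have eh : e < h.
  have : Num.min e0 h <= h by rewrite ge_min lexx orbT.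
  by rewrite /e; lra.
exists e; split.
- by rewrite e_0 (lt_trans eh).
- have := @upper_gap_finite_dim _ _ (rotop pi T) h n 0 uM;
  rewrite eigen_rotop addr0; apply => //.
    by rewrite !ltW.
  by rewrite in_itv /=; lra.
move=> s /andP[s0 se]; apply/res_rotop/tsr.
  by rewrite in_itv /=; move: se; rewrite ler_norml; lra.
apply/negP => sts; have := he0 s; rewrite mem_filter sts -normr_gt0 s0 =>
  /(_ isT).
by lra.
Qed.

Lemma fredholm_m1_admissible T : unitop T -> fredholm_m1 T -> exists e,
  admissible T e.
Proof.
move=> uT /(fredholm_m1_gap uT)[e [epi fd er]]; exists e; split => //.
(* The singleton list also covers the case where -1 is no eigenvalue: the angle 0 then contributes
   dimension 0. *)
exists (\sum_(t <- [:: 0]) dim (eigen (rotop pi T) t)); apply: gap_exist => //.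
- exact: unitop_rotop.
- by move=> t; rewrite inE => /eqP ->; lra.
- by move=> t; rewrite inE => /eqP ->; rewrite eigen_rotop addr0.
move=> t; rewrite in_itv /= inE => te t0; apply/res_rotop/er.
by rewrite normr_gt0 t0 ler_norml.
Qed.

Lemma res_eigen0 T t : unitop T -> regular_pt T (cis t) -> eigen T t = [set 0].
Proof.
move=> uT [c c0 Tc]; apply/seteqP; split => x /=; last first.
  by move=> ->; have [] := csubspace_eigen t uT.
move=> Ex; have := Tc x Logic.I; rewrite Ex subrr nrm0 pmulr_rle0//.
by move=> h1; apply/eqP; rewrite -nrm_eq0 eq_le h1 nrm_ge0.
Qed.

Lemma res_dim0 T t : unitop T -> regular_pt T (cis t) -> dim (eigen T t) = 0%N.
Proof. by move=> uT /(res_eigen0 uT) ->; apply: dimE; exact: has_dim0. Qed.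

(* The eigenvalue at angle pi, which may leave or enter the counted half-arc, is
   counted on both sides, so only an arc with regular end points remains. *)
Lemma crossing_count_arc T e e' : unitop T -> admissible T e ->
  admissible T e' -> e' < e ->
  exists2 n, spectral_gap (rotop (pi + (e + e') / 2) T) ((e - e') / 2) n &
    crossing_count T e - crossing_count T e' = n%:Z.
Proof.
move=> uT [/andP[e0 epi] [n gT]] [/andP[e'0 e'pi] [n' gT']] lt.
have uM := unitop_rotop pi uT.
have [|ts [uts tsE tsr _]] := gap_sum uM _ gT; first by rewrite e0.
have /(gap_ends uM)[r1 r2] := gT'.
have e'ts : e' \notin ts by apply/negP => /tsE[_ []]; exact: res_eigen0.
(* The eigenangles between e' and e, to be recentred at the midpoint c. The angle e' is regular as
   an end point of the smaller gap. *)
pose us := [seq t <- ts | e' < t]; pose c := (e + e') / 2.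
have kE (x : R) : 0 < x <= e -> crossing_count T x = \sum_(t <- ts | 0 <= t <= x)
  (dim (eigen (rotop pi T) t))%:Z.
  move=> /andP[x0 xe]; rewrite /crossing_count (@fsbigE _ _ _ _ _ [seq t <- ts |
    0 <= t <= x]).
  - rewrite big_filter_cond; apply: eq_big => [t|t _];
    last by rewrite eigen_rotop.
    by rewrite mem_setE in_itv /= andbb.
  - exact: filter_uniq.
  - by move=> t /=; rewrite mem_filter in_itv /= => /andP[].
  move=> t /=; rewrite in_itv /= mem_filter => tx; rewrite tx /= => tts.
  rewrite res_dim0//; apply/res_rotop/tsr => //; rewrite in_itv /=; lra.
have pct t : pi + c + (t - c) = pi + t by ring.
exists (\sum_(t <- [seq t - c | t <- us]) dim (eigen (rotop (pi + c) T) t)).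
  apply: gap_exist.
  - exact: unitop_rotop.
  - by apply/andP; split; lra.
  - by rewrite map_inj_uniq ?filter_uniq//; exact: addIr.
  - move=> s /mapP[t]; rewrite mem_filter => /andP[e't /tsE[h _ _]] ->.
    by rewrite /c; lra.
  - move=> s /mapP[t]; rewrite mem_filter => /andP[e't /tsE[h _ fd]] ->.
    by move: fd; rewrite !eigen_rotop pct.
  move=> t; rewrite in_itv /= => tc tus; apply/res_rotop; rewrite -addrA;
    apply/res_rotop.
  have [->|ne] := eqVneq (c + t) e'; first exact: r1.
  have ct : e' < c + t by rewrite lt_neqAle eq_sym ne /=; rewrite /c in tc *; lra.
  apply: tsr; first by rewrite in_itv /=; rewrite /c in tc ct *; lra.
  apply: contra tus => cts; apply/mapP; exists (c + t).
    by rewrite mem_filter ct.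
  by rewrite addrC addKr.
rewrite !kE ?e0 ?e'0 ?lexx ?(ltW lt)// big_map big_filter.
rewrite (bigID (fun t => t <= e')) /=.
rewrite [X in X + _ - _](eq_bigl (fun t => 0 <= t <= e')); last first.
  by move=> t; apply/idP/idP => [/andP[/andP[-> _] ->]//|/andP[-> h]];
    rewrite h (le_trans h (ltW lt)).
rewrite addrAC subrr add0r.
rewrite (big_morph Posz PoszD erefl) big_seq_cond [RHS]big_seq_cond.
apply: eq_big => [t|t _]; last first.
  by rewrite !eigen_rotop pct.
have [tts|//] := boolP (t \in ts); have [/andP[_ te] _ _] := tsE _ tts.
rewrite /= -ltNge (ltW te) andbT; apply/andP/idP => [[]//|h].
by rewrite h (ltW (lt_trans _ h)).
Qed.

End Crossing.

(** * The Maslov index of a path of unitaries *)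

(** Compactness of [a, b] by a supremum: let s be the supremum of the points reachable by a chain. A
    reachable point close to s can be joined to the minimum of b and s + e/2, which exceeds s unless
    s = b. *)
Lemma interval_chain (R : realType) (P : R -> R -> Prop) (a b : R) : a < b ->
  (forall t, a <= t <= b -> exists2 e, 0 < e & forall x y, a <= x -> x < y ->
    y <= b ->
     `|x - t| < e -> `|y - t| < e -> P x y) ->
  exists N (t : nat -> R), [/\ t 0%N = a, t N = b &
    forall j, (j < N)%N -> t j < t j.+1 /\ P (t j) (t j.+1)].
Proof.
move=> ab loc; pose chain x := exists N (t : nat -> R), [/\ t 0%N = a, t N = x &
    forall j, (j < N)%N -> t j < t j.+1 /\ P (t j) (t j.+1)].
pose S := [set x | a <= x <= b /\ chain x].
have Sa : S a by split; [rewrite lexx ltW|exists 0%N, (fun=> a)].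
have hS : has_sup S by split; [exists a|exists b => x [/andP[]]].
have step x y : chain x -> x < y -> P x y -> chain y.
  move=> [N [t [t0 tN tj]]] xy Pxy; exists N.+1, (fun j =>
    if (j <= N)%N then t j else y).
  split => //; first by rewrite ltnn.
  move=> j; rewrite ltnS => jN; rewrite jN; case: ltnP => [jN'|Nj];
    first exact: tj.
  by have -> : j = N; [apply/eqP; rewrite eqn_leq jN|rewrite tN].
pose s := sup S.
have as_ : a <= s by apply: sup_ubound; [exact: hS.2|].
have sb : s <= b by apply: ge_sup; [exact: hS.1|move=> x [/andP[]]].
have [|e e0 Pe] := loc s; first by rewrite as_.
have [x [/andP[ax xb] cx] xs] := sup_adherent e0 hS; rewrite -/s in xs.
have xles : x <= s by apply: sup_ubound; [exact: hS.2|split => //; rewrite ax].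
have xse : `|x - s| < e by rewrite ltr_norml; apply/andP; split; lra.
pose y := Num.min b (s + e / 2).
have ys : s <= y by rewrite le_min sb lerDl divr_ge0 ?ltW.
have yb : y <= b by rewrite ge_min lexx.
have yse : `|y - s| < e.
  have : y <= s + e / 2 by rewrite ge_min lexx orbT.
  by rewrite ltr_norml => ?; apply/andP; split; lra.
have cy : chain y.
  have [<-//|xy] := eqVneq x y.
  have {}xy : x < y by rewrite lt_neqAle xy (le_trans xles).
  exact: (step _ _ cx xy (Pe _ _ ax xy yb xse yse)).
have : y <= s by apply: sup_ubound; [exact: hS.2|split => //;
  rewrite yb (le_trans as_)].
rewrite ge_min => /orP[bs|]; last by lra.
have <- // : y = b by apply/eqP; rewrite eq_le yb (le_trans bs).
Qed.

Lemma loc_const (R : realType) (T : Type) (f : R -> T) (a b : R) : a <= b ->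
  (forall t, a <= t <= b -> exists2 e, 0 < e &
     forall s, a <= s <= b -> `|s - t| < e -> f s = f t) -> f a = f b.
Proof.
rewrite le_eqVlt => /predU1P[->//|ab] loc.
have [t /loc[e e0 fe]|N [t [<- <- tj]]] := @interval_chain _ (fun x y =>
  f x = f y) a b ab.
  exists e => // x y ax xy yb xt yt.
  have ay : a <= y <= b by rewrite yb (le_trans ax)// ltW.
  have xb : a <= x <= b by rewrite ax (le_trans (ltW xy)).
  by rewrite (fe x xb xt) (fe y ay yt).
elim: N tj => // N IH tj; rewrite IH; last by move=> j jN; apply: tj;
  rewrite ltnS ltnW.
by have [] := tj N (ltnSn N).
Qed.

(** When clamping does not merge x and y, the clamped points bound the intersection of [x, y] with
    [a, b]. *)
Lemma clamp_lt (R : realType) (a b x y : R) : a < b ->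
  Num.min (Num.max x a) b < Num.min (Num.max y a) b ->
  x <= Num.min (Num.max x a) b /\ Num.min (Num.max y a) b <= y.
Proof.
by move=> ?; have [?|?] := leP x a; have [?|?] := leP y a; have [?|?] := leP a b;
  have [?|?] := leP x b; have [?|?] := leP y b => *; split; lra.
Qed.

(** Intervals to the left of x contribute their full increment, those to the right contribute 0, and
    the one containing x contributes the increment up to x. *)
Lemma telescope_clamp (R : realType) (G : zmodType) (g : R -> G) N (t : nat ->
  R) x :
  (forall j, (j < N)%N -> t j < t j.+1) -> t 0%N <= x <= t N ->
  \sum_(j < N) (g (Num.min (Num.max x (t j)) (t j.+1)) - g (t j)) = g x - g (t
    0%N).
Proof.
elim: N x => [|N IH] x tj /andP[x0 xN].
  by rewrite big_ord0 (_ : x = t 0%N) ?subrr//; apply/eqP; rewrite eq_le xN x0.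
have tj' j : (j < N)%N -> t j < t j.+1 by move=> jN; apply: tj; rewrite ltnS ltnW.
have tmono j : (j <= N)%N -> t j <= t N.
  move=> jN; have : forall k, (j + k <= N)%N -> t j <= t (j + k)%N.
    elim=> [|k IHk]; rewrite ?addn0// addnS => jk.
    by rewrite (le_trans (IHk (ltnW jk)))// ltW// tj'.
  by move=> /(_ (N - j)%N); rewrite subnKC// => /(_ (leqnn _)).
rewrite big_ord_recr /=; have [xt|xt] := leP x (t N).
  rewrite IH ?x0// min_l; last by rewrite ltW// tj.
  by rewrite subrr addr0.
rewrite (min_l xN).
rewrite (eq_bigr (fun j : 'I_N => g (Num.min (Num.max (t N) (t j)) (t j.+1)) - g
  (t j))).
  by rewrite IH ?lexx ?tmono// addrC addrA subrK.
move=> j _; rewrite (max_l (tmono j (ltnW (ltn_ord j)))).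
rewrite (max_l (le_trans (tmono j (ltnW (ltn_ord j))) (ltW xt))).
by rewrite (min_r (tmono _ (ltn_ord j))) (min_r (le_trans (tmono _ (ltn_ord j))
  (ltW xt))).
Qed.

Lemma subr_swap (G : zmodType) (a b c e : G) : a - b = c - e -> a - c = b - e.
Proof.
by move=> E; rewrite -(subrK b a) E addrAC [c - e]addrC addrK addrC.
Qed.

Section Maslov.
Local Open Scope complex_scope.
Variables (R : realType) (V : hilbert R).
Local Notation C := (complex R).
Implicit Types (x y z : V) (T D : V -> V) (d : R -> V -> V).

Definition near_op (r : R) T D := forall x, nrm (T x - D x) <= r * nrm x.

Lemma rotop_near c r T D : near_op r T D -> near_op r (rotop c T) (rotop c D).
Proof. by move=> TD x; rewrite /rotop -scalerBr nrm_cis. Qed.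

Lemma near_op_le r r' T D : r <= r' -> near_op r T D -> near_op r' T D.
Proof. by move=> rr TD x; rewrite (le_trans (TD x))// ler_wpM2r ?nrm_ge0. Qed.

Lemma admissible_open T e : admissible T e -> exists2 r, 0 < r & forall T1,
  near_op r T1 T -> admissible T1 e.
Proof.
move=> [epi [n /gap_open[r r0 gr]]]; exists r => // T1 T1r; split => //.
by exists n; apply: gr; exact: rotop_near.
Qed.

(** Each count may jump when an eigenvalue passes -1, but by [crossing_count_arc] their difference
    is the number of eigenvalues in an arc with regular end points, which [gap_open] and [gap_uniq]
    keep fixed. *)
Lemma crossing_count_stable T e e' : unitop T -> admissible T e ->
  admissible T e' ->
  exists2 r, 0 < r & forall T1, unitop T1 -> near_op r T1 T ->
    [/\ admissible T1 e, admissible T1 e' &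
      crossing_count T1 e - crossing_count T e = crossing_count T1 e' -
        crossing_count T e'].
Proof.
move=> uT; wlog lt : e e' / e' < e => [W|] ae ae'.
  have [lt|lt|<-] := ltgtP e' e; first exact: W.
    have [r r0 rT] := W _ _ lt ae' ae; exists r => // T1 uT1 /(rT _ uT1)[? ? E].
    by split.
  have [r r0 rT] := admissible_open ae'; exists r => // T1 uT1 T1r.
  by split; rewrite ?subrr//; exact: rT.
have [r1 r10 rT1] := admissible_open ae; have [r2 r20 rT2] := admissible_open ae'.
have [n gn kn] := crossing_count_arc uT ae ae' lt.
have [r3 r30 rT3] := gap_open gn.
exists (Num.min r1 (Num.min r2 r3)); first by rewrite !lt_min r10 r20 r30.
move=> T1 uT1 T1r.
have a1 : admissible T1 e by apply: rT1; apply: near_op_le T1r;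
  rewrite ge_min lexx.
have a1' : admissible T1 e'.
  by apply: rT2; apply: near_op_le T1r; rewrite !ge_min lexx orbT.
split => //; have [m gm km] := crossing_count_arc uT1 a1 a1' lt.
have E : m = n.
  apply: gap_uniq gm _; apply: rT3; apply: rotop_near; apply: near_op_le T1r.
  by rewrite !ge_min lexx !orbT.
apply/eqP; rewrite subr_eq addrAC -subr_eq opprK; apply/eqP.
have -> : crossing_count T1 e = m%:Z + crossing_count T1 e' by rewrite -km subrK.
have -> : crossing_count T e = n%:Z + crossing_count T e' by rewrite -kn subrK.
by rewrite E; ring.
Qed.

Definition unitary_path d := (forall t, 0 <= t <= 1 -> unitop (d t)) /\
  (forall t, 0 <= t <= 1 -> forall r, 0 < r -> exists2 e, 0 < e &
     forall s, 0 <= s <= 1 -> `|s - t| < e -> near_op r (d s) (d t)).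

Definition adm_partition d N (t e : nat -> R) := [/\ t 0%N = 0, t N = 1,
  forall j, (j < N)%N -> t j < t j.+1 &
  forall j s, (j < N)%N -> t j <= s <= t j.+1 -> admissible (d s) (e j)].

Definition crossing_sum d N (t e : nat -> R) : int :=
  \sum_(j < N) (crossing_count (d (t j.+1)) (e j) - crossing_count (d (t j)) (e
    j)).

Lemma crossing_count_path d a b e e' : unitary_path d -> 0 <= a -> a <= b ->
  b <= 1 ->
  (forall s, a <= s <= b -> admissible (d s) e) ->
  (forall s, a <= s <= b -> admissible (d s) e') ->
  crossing_count (d b) e - crossing_count (d a) e = crossing_count (d b) e' -
    crossing_count (d a) e'.
Proof.
move=> [ud cd] a0 ab b1 ae ae'.
have in01 s : a <= s <= b -> 0 <= s <= 1.
  by move=> /andP[as_ sb]; rewrite (le_trans a0)//= (le_trans sb).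
suff : crossing_count (d a) e - crossing_count (d a) e' = crossing_count (d b) e
  - crossing_count (d b) e' by move=> E; apply: subr_swap; rewrite E.
apply: (@loc_const _ _ (fun s => crossing_count (d s) e - crossing_count (d s)
  e') a b ab) => t tab.
have [r r0 rT] := crossing_count_stable (ud _ (in01 _ tab)) (ae _ tab) (ae' _
  tab).
have [h h0 ht] := cd _ (in01 _ tab) _ r0; exists h => // s sab st.
have [_ _ E'] := rT _ (ud _ (in01 _ sab)) (ht _ (in01 _ sab) st).
exact: subr_swap.
Qed.

Lemma adm_partition_le d N t e i j : adm_partition d N t e -> (i <= j)%N ->
  (j <= N)%N -> t i <= t j.
Proof.
move=> [_ _ tj _] ij jN; rewrite -(subnKC ij) in jN *.
elim: (j - i)%N jN => [|k IH]; rewrite ?addn0// addnS => jk.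
by rewrite (le_trans (IH (ltnW jk)))// ltW// tj.
Qed.

(* The first partition defines a primitive f on [0, 1], by clamping to each of its
   intervals; the increments of f over the second partition are the summands of
   the other sum. *)
Lemma crossing_sum_uniq d N t e N' t' e' : unitary_path d ->
  adm_partition d N t e -> adm_partition d N' t' e' ->
  crossing_sum d N t e = crossing_sum d N' t' e'.
Proof.
move=> pd mp mp'; have [t0 tN tj ae] := mp; have [t'0 t'N t'j ae'] := mp'.
pose cl (j : nat) (x : R) := Num.min (Num.max x (t j)) (t j.+1).
pose f (x : R) : int := \sum_(j < N) (crossing_count (d (cl j x)) (e j) -
  crossing_count (d (t j)) (e j)).
have f0 : f 0 = 0.
  rewrite /f big1// => j _; rewrite /cl -t0 max_r; last first.
    by rewrite (adm_partition_le mp)// ltnW.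
  by rewrite min_l ?subrr// ltW// tj.
have f1 : f 1 = crossing_sum d N t e.
  apply: eq_bigr => j _; rewrite /cl -tN max_l;
    last by rewrite (adm_partition_le mp)// ltnW.
  by rewrite min_r// (adm_partition_le mp).
have t'01 i : (i <= N')%N -> 0 <= t' i <= 1.
  by move=> iN; rewrite -{1}t'0 -{1}t'N !(adm_partition_le mp').
have fi i : (i < N')%N -> f (t' i.+1) - f (t' i) = crossing_count (d (t' i.+1))
  (e' i) - crossing_count (d (t' i)) (e' i).
  move=> iN; pose g (x : R) := crossing_count (d x) (e' i).
  have gE (x : R) : 0 <= x <= 1 -> \sum_(j < N) (g (cl j x) - g (t j)) = g x - g
    (t 0%N).
    by move=> x01; apply: telescope_clamp => //; rewrite t0 tN.
  have -> : crossing_count (d (t' i.+1)) (e' i) - crossing_count (d (t' i)) (e'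
    i) =
      (g (t' i.+1) - g (t 0%N)) - (g (t' i) - g (t 0%N)) by rewrite /g; ring.
  rewrite -!gE ?t'01// ?(ltnW iN)// /f -!sumrB; apply: eq_bigr => j _.
  rewrite !opprB !addrA !subrK /g.
  have clj (x : R) : t j <= cl j x <= t j.+1.
    by rewrite /cl le_min ge_min lexx orbT le_max lexx orbT /= ltW ?tj.
  have ii : t' i <= t' i.+1 by rewrite ltW// t'j.
  have cc : cl j (t' i) <= cl j (t' i.+1).
    by rewrite /cl le_min2// le_max2.
  have [->|ne] := eqVneq (cl j (t' i)) (cl j (t' i.+1)); first by rewrite !subrr.
  have tj0 : 0 <= t j by rewrite -t0 (adm_partition_le mp)// ltnW.
  have tj1 : t j.+1 <= 1 by rewrite -tN (adm_partition_le mp).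
  have /andP[c1 c2] := clj (t' i); have /andP[c3 c4] := clj (t' i.+1).
  apply: crossing_count_path => //; first exact: le_trans c1.
  - exact: le_trans tj1.
  - by move=> s /andP[s1 s2]; apply: ae => //;
    rewrite (le_trans c1)//= (le_trans s2).
  (* Distinct clamped points bound a segment inside both the j-th interval of the first partition
     and the i-th of the second, so both half-openings are admissible along it. *)
  have [|h1 h2] := @clamp_lt _ (t j) (t j.+1) (t' i) (t' i.+1) (tj _ (ltn_ord
    j)); first by rewrite lt_neqAle ne.
  by move=> s /andP[s1 s2]; apply: ae' => //;
    rewrite (le_trans h1)//= (le_trans s2).
rewrite -f1 -[f 1]subr0 -f0 -t'0 -t'N; clear -fi.
elim: N' fi => [|n IH] fi; first by rewrite subrr /crossing_sum big_ord0.
rewrite /crossing_sum big_ord_recr /= -/(crossing_sum d n t' e') -IH;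
  last by move=> i iN; apply: fi; rewrite ltnW.
by rewrite -fi//; ring.
Qed.
End Maslov.

(** * Existence of partitions and homotopy of pairs of paths *)

Section Homotopy.
Local Open Scope complex_scope.
Variables (R : realType) (V : hilbert R).
Local Notation C := (complex R).
Implicit Types (x y z : V) (T D : V -> V) (d : R -> V -> V).

Definition is_maslov_index d m := exists N t e,
  adm_partition d N t e /\ m = crossing_sum d N t e.
Definition maslov_index d : int := xget 0 [set m | is_maslov_index d m].

Lemma maslov_indexE d N t e : unitary_path d -> adm_partition d N t e ->
  maslov_index d = crossing_sum d N t e.
Proof.
move=> ud md; rewrite /maslov_index; case: xgetP =>
  [m _ [N' [t' [e' [md' ->]]]]|].
  exact: crossing_sum_uniq md' md.
by move=> /(_ (crossing_sum d N t e)); case; exists N, t, e.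
Qed.

Lemma near_op_trans r s T D U : near_op r T D -> near_op s D U ->
  near_op (r + s) T U.
Proof.
move=> TD DU x; rewrite -(subrK (D x) (T x)) -addrA (le_trans (nrmD _ _))//.
by rewrite mulrDl lerD.
Qed.

Lemma near_op_refl r T : 0 <= r -> near_op r T T.
Proof. by move=> r0 x; rewrite subrr nrm0 mulr_ge0 ?nrm_ge0. Qed.

Lemma adm_partition_exist d : unitary_path d -> (forall t, 0 <= t <= 1 ->
  fredholm_m1 (d t)) ->
  exists N t e, [/\ (0 < N)%N, adm_partition d N t e & exists2 r, 0 < r &
    forall j s T, (j < N)%N -> t j <= s <= t j.+1 -> near_op r T (d s) ->
      admissible T (e j)].
Proof.
move=> [ud cd] de.
pose P (x y : R) := exists er : R * R, 0 < er.2 /\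
  forall s, x <= s <= y -> forall T, near_op er.2 T (d s) -> admissible T er.1.
have [||N [t [t0 tN tj]]] := @interval_chain R P 0 1; first exact: ltr01.
  move=> t t01; have [e ae] := fredholm_m1_admissible (ud _ t01) (de _ t01).
  have [r r0 rT] := admissible_open ae.
  (* One half of r pays for the motion of d s away from d t, the other for the perturbation T of d
     s. *)
  have r20 : 0 < r / 2 by rewrite divr_gt0.
  have [h h0 ht] := cd _ t01 _ r20; exists h => // x y x0 xy y1 xt yt.
  exists (e, r / 2); split => // s /andP[xs sy] T Ts; apply: rT.
  rewrite [r]splitr; apply: near_op_trans Ts (ht _ _ _).
    by rewrite (le_trans x0)//= (le_trans sy).
  by move: xt yt; rewrite !ltr_norml; lra.
have N0 : (0 < N)%N.
  rewrite lt0n; apply/eqP => N0; move: tN; rewrite N0 t0 => /eqP.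
  by rewrite eq_sym oner_eq0.
have /(_ _)/cid-/all_sig[er erP] j : exists er : R * R, (j < N)%N -> 0 < er.2 /\
  forall s, t j <= s <= t j.+1 -> forall T, near_op er.2 T (d s) ->
    admissible T er.1.
  case: (ltnP j N) => [/tj[_ [p pP]]|_]; [by exists p|by exists (0, 0)].
have [j|r r0 hr] := @seq_lt_gap R _ (iota 0 N) (fun j => (er j).2) 0.
  by rewrite mem_iota => /andP[_ /erP[]].
have key j s T : (j < N)%N -> t j <= s <= t j.+1 -> near_op r T (d s) ->
  admissible T (er j).1.
  move=> jN sj Ts; apply: (erP _ jN).2 sj _ _; apply: near_op_le Ts.
  by have := hr j; rewrite add0r; apply; rewrite mem_iota.
exists N, t, (fun j => (er j).1); split => //; last by exists r.
split => //; first by move=> j /tj[].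
by move=> j s jN sj; apply: key (sj) _ => //; apply/near_op_refl/ltW.
Qed.

(** At an interior partition point the half-openings of both neighbouring intervals are admissible,
    so [crossing_count_stable] makes them register the same change. *)
Lemma crossing_sum_local d N t e r : unitary_path d -> (0 < N)%N ->
  adm_partition d N t e -> 0 < r ->
  (forall j s T, (j < N)%N -> t j <= s <= t j.+1 -> near_op r T (d s) ->
    admissible T (e j)) ->
  exists2 r', 0 < r' & forall d', unitary_path d' ->
    (forall s, 0 <= s <= 1 -> near_op r' (d' s) (d s)) ->
    adm_partition d' N t e /\
    crossing_sum d' N t e - crossing_sum d N t e =
      (crossing_count (d' 1) (e N.-1) - crossing_count (d 1) (e N.-1)) -
        (crossing_count (d' 0) (e 0%N) - crossing_count (d 0) (e 0%N)).
Proof.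
move=> pd N0 mp r0 rT; have [t0 tN tj ae] := mp; have [ud cd] := pd.
have t01 i : (i <= N)%N -> 0 <= t i <= 1.
  by move=> iN; rewrite -{1}t0 -{1}tN !(adm_partition_le mp).
have /(_ _)/cid2-/all_sig2[rr rr0 rrP] j : exists2 q : R, 0 < q & (j.+1 < N)%N ->
    forall T, unitop T -> near_op q T (d (t j.+1)) ->
    crossing_count T (e j) - crossing_count (d (t j.+1)) (e j) = crossing_count T
      (e j.+1) - crossing_count (d (t j.+1)) (e j.+1).
  case: (ltnP j.+1 N) => [jN|_]; last by exists 1.
  have tj1 := t01 _ (ltnW jN).
  have [||q q0 qT] := @crossing_count_stable _ _ (d (t j.+1)) (e j) (e j.+1) (ud
    _ tj1).
  - by apply: ae; [exact: ltnW|rewrite lexx ltW// tj// ltnW].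
  - by apply: ae => //; rewrite lexx ltW// tj.
  by exists q => // _ T uT /(qT _ uT)[].
have [j _|q q0 hq] := @seq_lt_gap R _ (iota 0 N) rr 0; first exact: rr0.
exists (Num.min r q); first by rewrite lt_min r0.
move=> d' pd' dd'; have [ud' _] := pd'.
have mp' : adm_partition d' N t e.
  split => // j s jN sj; apply: rT (sj) _ => //; apply: near_op_le (dd' s _).
    by rewrite ge_min lexx.
  have /andP[j1 j2] := sj.
  have /andP[h1 _] := t01 j (ltnW jN); have /andP[_ h2] := t01 _ jN.
  by rewrite (le_trans h1)//= (le_trans j2).
split => //.
(* The change at the point [t i] as seen with the half-opening of interval j; the sum telescopes
   once [g j.+1 j = g j.+1 j.+1]. *)
pose g i j := crossing_count (d' (t i)) (e j) - crossing_count (d (t i)) (e j).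
have gg j : (j.+1 < N)%N -> g j.+1 j = g j.+1 j.+1.
  move=> jN; apply: rrP => //; first exact/ud'/t01/ltnW.
  apply: near_op_le (dd' _ (t01 _ (ltnW jN))).
  rewrite ge_min; apply/orP; right; have := hq j; rewrite add0r; apply.
  by rewrite mem_iota (ltn_trans (ltnSn j)).
have -> : crossing_sum d' N t e - crossing_sum d N t e = \sum_(j < N) (g j.+1 j -
  g j j).
  by rewrite /crossing_sum -sumrB; apply: eq_bigr => j _; rewrite /g; ring.
have -> : crossing_count (d' 1) (e N.-1) - crossing_count (d 1) (e N.-1) = g N
  N.-1 by rewrite /g tN.
have -> : crossing_count (d' 0) (e 0%N) - crossing_count (d 0) (e 0%N) = g 0%N
  0%N by rewrite /g t0.
case: N N0 gg {mp tN tj ae rT t01 rrP hq mp'} => // N _ gg /=.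
elim: N gg => [|N IH] gg; first by rewrite big_ord1.
rewrite big_ord_recr /= IH; last by move=> j jN; apply: gg; rewrite ltnS ltnW.
by rewrite gg//; ring.
Qed.

(** The end contributions of d and d' use half-openings from different partitions but concern the
    same operators, as the two families share their ends. [crossing_count_stable] equates them, so
    the difference of the indices is locally constant in s. *)
Lemma mas_homotopy (d d' : R -> R -> V -> V) :
  (forall s, 0 <= s <= 1 -> unitary_path (d s)) -> (forall s, 0 <= s <= 1 ->
    unitary_path (d' s)) ->
  (forall s t, 0 <= s <= 1 -> 0 <= t <= 1 -> fredholm_m1 (d s t)) ->
  (forall s t, 0 <= s <= 1 -> 0 <= t <= 1 -> fredholm_m1 (d' s t)) ->
  (forall s, d s 0 = d' s 0) -> (forall s, d s 1 = d' s 1) ->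
  (forall s r, 0 <= s <= 1 -> 0 < r -> exists2 h, 0 < h & forall s',
    0 <= s' <= 1 ->
    `|s' - s| < h -> forall t, 0 <= t <= 1 ->
    near_op r (d s' t) (d s t) /\ near_op r (d' s' t) (d' s t)) ->
  maslov_index (d 0) - maslov_index (d' 0) = maslov_index (d 1) - maslov_index
    (d' 1).
Proof.
move=> pd pd' ed ed' d0 d1 cont.
apply: (@loc_const _ _ (fun s => maslov_index (d s) - maslov_index (d' s)) 0 1);
  first exact: ler01.
move=> s s01.
have [N [t [e [N0 mp [r r0 rT]]]]] := adm_partition_exist (pd _ s01) (fun t =>
  ed s t s01).
have [N' [t' [e' [N'0 mp' [r' r'0 rT']]]]] := adm_partition_exist (pd' _ s01)
  (fun t => ed' s t s01).
have [q q0 qd] := crossing_sum_local (pd _ s01) N0 mp r0 rT.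
have [q' q'0 qd'] := crossing_sum_local (pd' _ s01) N'0 mp' r'0 rT'.
have z01 : 0 <= (0 : R) <= 1 by rewrite lexx ler01.
have o01 : 0 <= (1 : R) <= 1 by rewrite lexx ler01.
have [t0 tN tj ae] := mp; have [t'0 t'N t'j ae'] := mp'.
have [||p0 p00 pd0] := @crossing_count_stable _ _ (d s 0) (e 0%N) (e' 0%N) ((pd _
  s01).1 _ z01).
- by apply: ae => //; rewrite t0 lexx -{1}t0 ltW// tj.
- by rewrite d0; apply: ae' => //; rewrite t'0 lexx -{1}t'0 ltW// t'j.
have [||p1 p10 pd1] := @crossing_count_stable _ _ (d s 1) (e N.-1) (e' N'.-1)
  ((pd _ s01).1 _ o01).
- by apply: ae; rewrite prednK// tN lexx -{1}tN andbT ltW// -{2}(prednK N0) tj//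
  prednK.
- by rewrite d1; apply: ae'; rewrite prednK// t'N lexx -{1}t'N andbT ltW//
  -{2}(prednK N'0) t'j// prednK.
have m0 : 0 < Num.min (Num.min q q') (Num.min p0 p1) by rewrite !lt_min q0 q'0
  p00 p10.
have [h h0 hd] := cont s _ s01 m0; exists h => // s' s'01 ss'.
have {}hd t2 t201 := hd _ s'01 ss' t2 t201.
have [|mq Eq] := qd _ (pd _ s'01).
  by move=> u /hd[+ _]; apply: near_op_le; rewrite !ge_min lexx.
have [|mq' Eq'] := qd' _ (pd' _ s'01).
  by move=> u /hd[_]; apply: near_op_le; rewrite !ge_min lexx !orbT.
rewrite (maslov_indexE (pd _ s'01) mq) (maslov_indexE (pd' _ s'01) mq')
  (maslov_indexE (pd _ s01) mp) (maslov_indexE (pd' _ s01) mp').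
have [|_ _ E0] := pd0 (d s' 0) ((pd _ s'01).1 _ z01).
  by have [+ _] := hd _ z01; apply: near_op_le; rewrite !ge_min lexx !orbT.
have [|_ _ E1] := pd1 (d s' 1) ((pd _ s'01).1 _ o01).
  by have [+ _] := hd _ o01; apply: near_op_le; rewrite !ge_min lexx !orbT.
move: Eq Eq' E0 E1.
rewrite -(d0 s') -(d0 s) -(d1 s') -(d1 s).
by move=> Eq Eq' E0 E1; apply: subr_swap; rewrite Eq Eq' E0 E1.
Qed.

End Homotopy.

(** * The space H_J *)

Section Bridge.
Local Open Scope complex_scope.
Variables (R : realType) (H : symplecticHilbert R).
Local Notation C := (complex R).
Local Notation K := (HJ H).
Local Notation ii := (Complex 0 1 : C).

Lemma HJ_scaleE (a : C) (x : K) :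
  a *: x = (complex.Re a *: (x : carrier H) + complex.Im a *: J H x) :> carrier H.
Proof. by []. Qed.

Lemma hprod_linear (a : C) (x y z : K) :
  hprod (a *: x + y) z = a * hprod x z + hprod y z.
Proof.
rewrite /hprod !omega_compatible HJ_scaleE; case: a => u v /=.
rewrite !linearD !linearZ /= J_square.
rewrite !(linearDl (ip H)) !(linearZl_LR (ip H)) /= (linearNl (ip H)).
by apply/eqP; rewrite eq_complex /=; apply/andP; split; apply/eqP; ring.
Qed.

Lemma ip_sym (x y : carrier H) : ip H x y = ip H y x.
Proof. by have := hermC (ip H) x y; rewrite expr0 mul1r. Qed.

Lemma ip_J (x y : carrier H) : ip H (J H x) y = - ip H x (J H y).
Proof. by rewrite -[LHS]J_orthogonal J_square (linearNl (ip H)). Qed.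

Lemma hprod_conj (x y : K) : hprod x y = conjc (hprod y x).
Proof.
by rewrite /hprod !omega_compatible /= opprK (ip_J x) opprK (ip_sym x y) (ip_sym
  x (J H y)).
Qed.

Lemma nrm_HJ (x : K) : Num.sqrt (complex.Re (hprod x x)) = `|x : carrier H|.
Proof. by rewrite /= ip_norm sqrtr_sqr normr_id. Qed.

Lemma hprod_gt0 (x : K) : x != 0 -> 0 < complex.Re (hprod x x).
Proof. by move=> x0; rewrite /= ip_norm exprn_gt0// normr_gt0. Qed.

Lemma HJ_complete (u : nat -> K) (c : R) :
    (forall m n, (m <= n)%N ->
      Num.sqrt (complex.Re (hprod (u m - u n) (u m - u n))) <= c / m.+1%:R) ->
    exists l, forall n,
      Num.sqrt (complex.Re (hprod (u n - l) (u n - l))) <= c / n.+1%:R.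
Proof.
move=> uc; pose v : nat -> carrier H := u.
have {}uc m n : (m <= n)%N -> `|v m - v n| <= c / m.+1%:R.
  by move=> mn; rewrite -[leLHS]nrm_HJ; exact: uc.
have /cauchy_cvgP cv : cauchy (v @ \oo).
  apply: cauchy_exP => e e0; have [N cN] := archi_small c e0.
  exists (v N), N => // n /= Nn; rewrite -ball_normE /ball_ /=.
  exact: le_lt_trans (uc _ _ Nn) cN.
exists (lim (v @ \oo)) => n; rewrite nrm_HJ.
apply/ler_addgt0Pr => e e0; have /cvgrPdist_lt/(_ e e0)[N _ vN] := cv.
pose m := maxn n N.
have : v n - lim (v @ \oo) = (v n - v m) - (lim (v @ \oo) - v m).
  by rewrite opprB addrA subrK.
move=> ->; rewrite (le_trans (ler_normB _ _))// lerD ?uc ?leq_maxl//.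
by apply/ltW/vN; rewrite /= leq_maxr.
Qed.

Definition HJ_hilbert : hilbert R :=
  @Hilbert R (HJ H) (@hprod R H) hprod_linear hprod_conj hprod_gt0 HJ_complete.


Lemma rip_HJ (x y : HJ_hilbert) : rip x y = ip H x y. Proof. by []. Qed.

Lemma nrmE_HJ (x : HJ_hilbert) : nrm x = `|x : carrier H|.
Proof. exact: nrm_HJ. Qed.

Lemma unitary_unitop (T : K -> K) : unitary T -> @unitop R HJ_hilbert T.
Proof. by []. Qed.

Lemma resolvent_res (T : K -> K) (z : C) : unitary T ->
  resolvent_set T z <-> @regular_pt R HJ_hilbert T z.
Proof.
move=> uT; split=> [[S [lS [M SM] SK KS]]|rz].
  apply: (@inverse_res R HJ_hilbert T z S) => //.
  by exists M => x; rewrite !nrmE_HJ.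
have [S [lS [M SM] SK KS]] := @res_inverse R HJ_hilbert T (unitary_unitop uT) z
  rz.
exists S; split => //; exists M => x; have := SM x; by rewrite !nrmE_HJ.
Qed.

Lemma cis_pi_inj (e s t : R) : e < pi -> s \in `[- e, e] -> t \in `[- e, e] ->
  cis (pi + s) = cis (pi + t) -> s = t.
Proof.
move=> epi; rewrite !in_itv /= => hs ht /(congr1 ( *%R (cis (- pi)))).
by rewrite -!cisD !addKr; apply: cis_inj; lra.
Qed.

(** One direction feeds the angles of the finitely many spectral points to [gap_exist]; the other
    reads regularity of the ends and the eigenvalues off [gap_ends] and [gap_sum]. *)
Lemma maslov_cond_admissible (T : K -> K) (e : R) : unitary T -> 0 < e < pi ->
  [/\ resolvent_set T (cis (pi + e)), resolvent_set T (cis (pi - e)),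
      finite_set (spectrum T `&` arc e) &
      forall z, (spectrum T `&` arc e) z ->
        eigenspace T z <> [set 0] /\ finite_dim (eigenspace T z)] <->
  @admissible R HJ_hilbert T e.
Proof.
move=> uT e0pi; have /andP[e0 epi] := e0pi; have uT' := unitary_unitop uT.
have uM := unitop_rotop pi uT'.
split=> [[r1 r2 /finite_seqP[zs zsE] sE]|[_ [n gT]]].
  (* The angle of a point of the arc, measured from pi; it is unique because e < pi. *)
  pose th z := xget 0 [set t : R | t \in `[- e, e] /\ z = cis (pi + t)].
  have thE t : t \in `[- e, e] -> th (cis (pi + t)) = t.
    move=> te; rewrite /th; case: xgetP => [s _ [se st]|/(_ t)[]//].
    exact: (cis_pi_inj epi se te).
  split => //; pose ts := undup [seq th z | z <- zs].
  have zsP z : z \in zs <-> (spectrum T `&` arc e) z by rewrite zsE.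
  have tsP t : t \in ts -> t \in `[- e, e] /\ spectrum T (cis (pi + t)).
    rewrite mem_undup => /mapP[z /zsP[sz [s /= se zE]] ->].
    by rewrite -zE thE// zE; split.
  exists (\sum_(t <- ts) dim (@eigen R HJ_hilbert (@rotop R HJ_hilbert pi T) t));
    apply: gap_exist => //.
  - exact: undup_uniq.
  - move=> t /tsP[te st]; move: (te); rewrite in_itv /= => /andP[t1 t2].
    rewrite !lt_neqAle t1 t2 !andbT; apply/andP; split; apply/eqP => E; apply: st.
      by rewrite -E.
    by rewrite E.
  - move=> t /tsP[te st]; rewrite eigen_rotop.
    have [] // := sE (cis (pi + t)).
    by split => //; exists t.
  move=> t te tts; apply/res_rotop/resolvent_res => //.
  apply: contrapT => st; case/negP: tts; rewrite mem_undup; apply/mapP.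
  exists (cis (pi + t)); last by rewrite thE.
  by apply/zsP; split => //; exists t.
have [r1 r2] := gap_ends uM gT.
have [ts [uts tsE tsr _]] := gap_sum uM e0pi gT.
have st t : t \in `[- e, e] -> spectrum T (cis (pi + t)) -> t \in ts.
  move=> te sp; apply: contrapT => /negP tts; apply: sp.
  by apply/resolvent_res => //; apply/res_rotop/tsr.
split.
- by apply/resolvent_res => //; apply/res_rotop.
- by apply/resolvent_res => //; apply/res_rotop.
- apply: (@sub_finite_set _ _ ((fun t => cis (pi + t)) @` [set` ts])).
    move=> z [sp [t te zE]]; rewrite -zE in sp *; exists t => //=.
    by apply: st => //; rewrite te.
  exact: finite_image.
move=> z [sp [t te zE]]; rewrite -zE in sp *.
have [] := tsE t _; first by apply: st => //; rewrite te.
by rewrite !eigen_rotop.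
Qed.

Lemma maslov_partition_adm_partition (d : R -> K -> K) N t e :
  (forall s, 0 <= s <= 1 -> unitary (d s)) ->
  maslov_partition d N t e <-> @adm_partition R HJ_hilbert d N t e.
Proof.
move=> ud.
have mono (t0 : t 0%N = 0) (tN : t N = 1) (tj : forall j, (j < N)%N ->
  t j < t j.+1) j s :
    (j < N)%N -> t j <= s <= t j.+1 -> 0 <= s <= 1.
  have le i k : (i <= k)%N -> (k <= N)%N -> t i <= t k.
    move=> ik kN; rewrite -(subnKC ik) in kN *.
    elim: (k - i)%N kN => [|l IH]; rewrite ?addn0// addnS => kl.
    by rewrite (le_trans (IH (ltnW kl)))// ltW// tj.
  move=> jN /andP[s1 s2]; rewrite -t0 -tN (le_trans (le _ _ _ _) s1)//=;
    last exact: ltnW.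
  exact: le_trans s2 (le _ _ _ _).
split=> [[t0 tN tj ej ae]|[t0 tN tj ae]]; split => //.
- move=> j s jN sj; apply/maslov_cond_admissible;
  [exact/ud/(mono t0 tN tj j)|exact: ej|].
  exact: ae.
- by move=> j jN; have [] := ae j (t j) jN; rewrite // lexx ltW// tj.
move=> j s jN sj; apply/maslov_cond_admissible;
  [exact/ud/(mono t0 tN tj j)| |exact: ae].
by have [] := ae j (t j) jN; rewrite // lexx ltW// tj.
Qed.

Lemma unitary_maslovE (d : R -> K -> K) :
  (forall s, 0 <= s <= 1 -> unitary (d s)) ->
    unitary_maslov d = @maslov_index R HJ_hilbert d.
Proof.
move=> ud; congr (xget 0 _); apply/seteqP; split => m [N [t [e [mp ->]]]];
  exists N, t, e; split => //.
  by apply/maslov_partition_adm_partition.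
by apply/maslov_partition_adm_partition.
Qed.

End Bridge.

(** * Unitary perturbations Id + compact *)

Section Small.
Local Open Scope complex_scope.
Variables (R : realType) (V : hilbert R).
Local Notation C := (complex R).
Implicit Types (x y z : V) (T D : V -> V).

Definition near_id T := forall e, 0 < e ->
  fin_codim [set x | nrm (T x - x) <= e * nrm x].

(** On a subspace of finite codimension |T U x + U x| >= d |x| and |U x - x| <= (d/2) |x|. *)
Lemma fredholm_m1_comp T U : unitop T -> unitop U -> fredholm_m1 T ->
  near_id U -> fredholm_m1 (T \o U).
Proof.
move=> uT uU [d d0 cT] sU; exists (d / 2); first by rewrite divr_gt0.
have := fin_codimI (fin_codim_preim (unitop_lin uU) cT) (sU _ (divr_gt0 d0 (ltr0n
  _ 2))).
apply: fin_codim_sub => x [/= h1 h2].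
have -> : T (U x) + x = (T (U x) + U x) - (U x - x).
  by rewrite opprB addrACA subrr addr0.
have := nrm_lerB (T (U x) + U x) (U x - x).
by move: h1; rewrite (unitop_nrm uU); lra.
Qed.

Lemma near_id_fredholm_m1 T : unitop T -> near_id T -> fredholm_m1 T.
Proof.
move=> uT /(_ 1 ltr01) cT; exists 1; first exact: ltr01.
apply: fin_codim_sub cT => x /= h; rewrite mul1r.
have -> : T x + x = (T x - x) + (2 : R)%:C *: x.
  by rewrite rmorphD /= scalerDl scale1r -addrA [- x + _]addrA addNr add0r.
have := nrm_lerB ((2 : R)%:C *: x) (x - T x).
rewrite opprB [(2 : R)%:C *: x + _]addrC nrm_R ger0_norm// [nrm (x - _)]nrmC.
by move: h; lra.
Qed.

Lemma hp_comb U (a b : C) x y : unitop U ->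
  hp (a *: U x - b *: x) (a *: U y - b *: y) =
  (a * conjc a + b * conjc b) * hp x y
  - (a * conjc b * hp (U x) y + b * conjc a * hp x (U y)).
Proof.
by move=> uU; rewrite hpBl !hpBr !hpZl !hpZr (unitop_hp uU); ring.
Qed.

Lemma comb_sub (a b c e : C) x y :
  a *: x - b *: y - (c *: x - e *: y) = (a - c) *: x - (b - e) *: y.
Proof.
by rewrite !scalerBl !opprB [e *: y - _]addrC addrACA; congr (_ + _);
  rewrite addrC.
Qed.

Section Path.
Variables (K : V -> V) (w : C).
Hypotheses (uK : unitop K) (sK : near_id K) (rw : regular_pt K w).
Hypotheses (w1 : w * conjc w = 1) (wn1 : complex.Re w < 1).

(* The path is C_s B_s^-1, obtained by solving for f_s(z) in
   (f_s(z) - 1) / (f_s(z) - w) = s (z - 1) / (z - w). *)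
Let B (s : R) x := (1 - s)%:C *: K x - (w - s%:C) *: x.
Let Cc (s : R) x := (1 - s%:C * w) *: K x - ((1 - s)%:C * w) *: x.

(** Both sides combine hp x y, hp (K x) y and hp x (K y); for each of the three, the coefficients
    differ by a multiple of w conj w - 1. *)
Lemma path_hp s x y : hp (Cc s x) (Cc s y) = hp (B s x) (B s y).
Proof.
have cB a b : conjc (a - b) = conjc a - conjc b :> C by rewrite rmorphB.
have cM a b : conjc (a * b) = conjc a * conjc b :> C by rewrite rmorphM.
have s1 : (1 - s)%:C = 1 - s%:C :> C by rewrite rmorphB rmorph1.
rewrite /Cc /B !(hp_comb _ _ _ _ uK) s1 !(cB, cM) conjc1 conjc_real;
  move: (s%:C) (conjc w) w1 => t wb ww.
have E1 : (1 - t * w) * (1 - t * wb) + (1 - t) * w * ((1 - t) * wb) -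
  ((1 - t) * (1 - t) + (w - t) * (wb - t)) =
  (2 * t ^+ 2 - 2 * t) * (w * wb - 1) by ring.
have E2 : (1 - t * w) * ((1 - t) * wb) - (1 - t) * (wb - t) = - (t * (1 - t)) *
  (w * wb - 1) by ring.
have E3 : (1 - t) * w * (1 - t * wb) - (w - t) * (1 - t) = - (t * (1 - t)) * (w *
  wb - 1) by ring.
move/eqP: E1; rewrite ww subrr mulr0 subr_eq0 => /eqP ->.
move/eqP: E2; rewrite ww subrr mulr0 subr_eq0 => /eqP ->.
by move/eqP: E3; rewrite ww subrr mulr0 subr_eq0 => /eqP ->.
Qed.

Lemma path_nrm s x : nrm (Cc s x) = nrm (B s x).
Proof. by apply: eq_nrm; rewrite /rip path_hp. Qed.

(** At s = 0 this is the regularity of w. For s > 0, |w - s|^2 = (1 - s)^2 + 2 s (1 - Re w) exceeds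
    (1 - s)^2, so the scalar term dominates the K term. *)
Lemma path_bounded_below s : 0 <= s <= 1 -> bounded_below setT (B s).
Proof.
move=> /andP[s0 s1]; have [->|sn0] := eqVneq s 0.
  have [c c0 Kc] := rw; exists c => // x _; rewrite /B !subr0 scale1r.
  exact: Kc.
have {}s0 : 0 < s by rewrite lt_neqAle eq_sym sn0.
have ww2 : complex.Re w ^+ 2 + complex.Im w ^+ 2 = 1.
  by move: w1; case: (w) => u v /= [<- _]; ring.
pose q2 := (1 - s) ^+ 2 + 2 * s * (1 - complex.Re w).
have q20 : (1 - s) ^+ 2 < q2.
  by rewrite ltrDl !mulr_gt0// subr_gt0.
have q2ge : 0 <= q2 by rewrite (le_trans _ (ltW q20))// sqr_ge0.
pose q := Num.sqrt q2.
have q1 : 1 - s < q.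
  by rewrite -(@ltr_pXn2r _ 2) ?nnegrE ?sqrtr_ge0 ?subr_ge0// sqr_sqrtr.
exists (q - (1 - s)); first by rewrite subr_gt0.
have wx x : nrm ((w - s%:C) *: x) = q * nrm x.
  apply/eqP; rewrite -(@eqrXn2 _ 2) ?mulr_ge0 ?nrm_ge0 ?sqrtr_ge0//.
  rewrite exprMn !nrm2 sqr_sqrtr// rip_Z; apply/eqP; congr (_ * _).
  by rewrite /q2; move: ww2; case: (w) => u v /=; lra.
move=> x _; rewrite /B nrmC mulrBl -wx.
have <- : nrm ((1 - s)%:C *: K x) = (1 - s) * nrm x.
  by rewrite nrm_R (unitop_nrm uK) ger0_norm// subr_ge0.
exact: nrm_lerB.
Qed.

Definition moebius s y := xget 0 [set z | exists2 x, B s x = y & z = Cc s x].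

Lemma B_lin s : linear (B s). Proof. exact: combK_lin. Qed.
Lemma Cc_lin s : linear (Cc s). Proof. exact: combK_lin. Qed.

(** The value is independent of the preimage because [Cc s] vanishes wherever [B s] does, by
    [path_nrm]. *)
Lemma moebiusE s x : 0 <= s <= 1 -> moebius s (B s x) = Cc s x.
Proof.
move=> s01; rewrite /moebius; case: xgetP => [z _ [x' E ->]|/(_ (Cc s x))];
  last first.
  by case; exists x.
have /eqP : Cc s (x' - x) = 0.
  apply/eqP; rewrite -nrm_eq0 path_nrm (rlinB (linear_rlinear (B_lin s))) E.
  by rewrite subrr nrm0.
by rewrite (rlinB (linear_rlinear (Cc_lin s))) subr_eq0 => /eqP.
Qed.

Lemma B_surj s y : 0 <= s <= 1 -> exists x, B s x = y.
Proof. by move=> s01; exact: (combK_surj uK (path_bounded_below s01)). Qed.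

Lemma moebius_unitop s : 0 <= s <= 1 -> unitop (moebius s).
Proof.
move=> s01; split.
- move=> a y1 y2; have [x1 <-] := B_surj y1 s01; have [x2 <-] := B_surj y2 s01.
  by rewrite -B_lin !moebiusE// Cc_lin.
- move=> y1 y2; have [x1 <-] := B_surj y1 s01; have [x2 <-] := B_surj y2 s01.
  by rewrite !moebiusE// path_hp.
move=> y; have [c c0 Bc] := path_bounded_below s01.
have bC : bounded_below setT (Cc s) by exists c => // x _; rewrite path_nrm;
  exact: Bc.
have [x xy] := combK_surj uK bC y; exists (B s x); rewrite moebiusE//.
Qed.

Lemma moebius0 y : moebius 0 y = y.
Proof.
have s01 : 0 <= (0 : R) <= 1 by rewrite lexx ler01.
have [x <-] := B_surj y s01; rewrite moebiusE// /Cc /B !subr0 mul0r subr0.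
by rewrite mul1r.
Qed.

Lemma moebius1 y : moebius 1 y = K y.
Proof.
have s01 : 0 <= (1 : R) <= 1 by rewrite lexx ler01.
have [x <-] := B_surj y s01; rewrite moebiusE//
  /Cc /B subrr !scale0r !mul1r mul0r.
rewrite scale0r subr0 sub0r -scaleNr opprB (unitopZ uK).
by [].
Qed.

(** For y = B s x = B s0 x0, the isometry [path_nrm] turns Cc s (x - x0) into B s0 x0 - B s x0, so
    only the lower bound at s0 is used. *)
Lemma moebius_near s0 r : 0 <= s0 <= 1 -> 0 < r -> exists2 h, 0 < h &
  forall s, 0 <= s <= 1 -> `|s - s0| < h -> near_op r (moebius s) (moebius s0).
Proof.
move=> s01 r0; have [c c0 Bc] := path_bounded_below s01.
(* Two terms of size at most 2 |s - s0| |x0|, with c |x0| <= |y|. *)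
exists (r * c / 4); first by rewrite !mulr_gt0.
move=> s s'01 ss y; have [x Ex] := B_surj y s'01; have [x0 Ex0] := B_surj y s01.
rewrite -{1}Ex -{1}Ex0 !moebiusE//.
have K2 z : nrm (K z - z) <= 2 * nrm z.
  by rewrite (le_trans (nrmB _ _))// (unitop_nrm uK) mulr_natl mulr2n.
have dB : B s0 x0 - B s x0 = (s - s0)%:C *: (K x0 - x0).
  rewrite /B comb_sub; rewrite scalerBr !rmorphB !rmorph1 /=.
  by congr (_ *: _ - _ *: _); ring.
have dC : Cc s x0 - Cc s0 x0 = (s - s0)%:C *: (- w *: (K x0 - x0)).
  rewrite /Cc comb_sub scalerA scalerBr !rmorphB !rmorph1 /=.
  by congr (_ *: _ - _ *: _); ring.
have -> : Cc s x - Cc s0 x0 = Cc s (x - x0) + (Cc s x0 - Cc s0 x0).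
  by rewrite (rlinB (linear_rlinear (Cc_lin s))) addrA subrK.
rewrite (le_trans (nrmD _ _))// path_nrm (rlinB (linear_rlinear (B_lin s))) Ex
  -Ex0 dB dC.
have nw z : nrm (w *: z) = nrm z.
  apply: eq_nrm; rewrite rip_Z (_ : _ + _ = 1) ?mul1r//.
  by move: w1; case: (w) => u v /= [<- _]; ring.
rewrite !nrm_R scaleNr nrmN nw Ex0.
have h1 : `|s - s0| * nrm (K x0 - x0) <= `|s - s0| * (2 * nrm x0).
  by rewrite ler_wpM2l.
have h2 : `|s - s0| * nrm x0 <= r * c / 4 * nrm x0.
  by rewrite ler_wpM2r ?nrm_ge0// ltW.
have h3 : c * nrm x0 <= nrm y by rewrite -Ex0; exact: Bc.
have h4 : r * (c * nrm x0) <= r * nrm y by rewrite ler_pM2l.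
lra.
Qed.

(** Numerator minus denominator is s (1 - w) (K - Id), so smallness of K - Id passes through the
    inverse of [B s]. *)
Lemma moebius_near_id s : 0 <= s <= 1 -> near_id (moebius s).
Proof.
move=> s01 e e0; have [c c0 Bc] := path_bounded_below s01.
have /(_ _)/cid-/all_sig[S SB] := fun y => B_surj y s01.
have lS : linear S.
  move=> a y1 y2; have inj x x' : B s x = B s x' -> x = x'.
    move=> E; apply/eqP; rewrite -subr_eq0 -nrm_eq0 eq_le nrm_ge0 andbT.
    rewrite -(pmulr_rle0 _ c0) (le_trans (Bc _ Logic.I))//.
    by rewrite (rlinB (linear_rlinear (B_lin s))) E subrr nrm0.
  by apply: inj; rewrite B_lin !SB.
pose a : C := s%:C * (1 - w); pose M := `|complex.Re a| + `|complex.Im a| + 1.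
have M0 : 0 < M by rewrite ltr_wpDl// addr_ge0.
have e'0 : 0 < e * c / M by rewrite divr_gt0// mulr_gt0.
apply: fin_codim_sub (fin_codim_preim lS (sK e'0)) => y /= h.
rewrite -{1 2}(SB y) moebiusE//.
have -> : Cc s (S y) - B s (S y) = a *: (K (S y) - S y).
  rewrite /Cc /B comb_sub scalerBr !rmorphB !rmorph1 /= /a.
  by congr (_ *: _ - _ *: _); ring.
rewrite (le_trans (nrm_Z _ _))// (@le_trans _ _ (M * nrm (K (S y) - S y)))//.
  by rewrite ler_wpM2r ?nrm_ge0// lerDl.
rewrite (@le_trans _ _ (M * (e * c / M * nrm (S y))))//.
  by rewrite ler_pM2l.
have -> : M * (e * c / M * nrm (S y)) = e * (c * nrm (S y)).
  by field; rewrite gt_eqF.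
by rewrite ler_pM2l// -{2}(SB y); exact: Bc.
Qed.

End Path.

Lemma near_id_path K : unitop K -> near_id K -> exists Ks : R -> V -> V, [/\
  forall s, 0 <= s <= 1 -> unitop (Ks s) /\ near_id (Ks s),
  forall y, Ks 0 y = y, forall y, Ks 1 y = K y &
  forall s0 r, 0 <= s0 <= 1 -> 0 < r -> exists2 h, 0 < h &
  forall s, 0 <= s <= 1 -> `|s - s0| < h -> near_op r (Ks s) (Ks s0)].
Proof.
move=> uK sK; have [e [/andP[e0 epi] _ er]] := fredholm_m1_gap uK
  (near_id_fredholm_m1 uK sK).
(* K is itself close to Id, so -1 has a regular punctured neighbourhood; w is taken there. *)
have rw : regular_pt K (cis (pi + e)) by apply: er; rewrite gtr0_norm// e0 lexx.
have w1 : cis (pi + e) * conjc (cis (pi + e)) = 1 by rewrite cisN cisVr.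
have wn1 : complex.Re (cis (pi + e)) < 1.
  rewrite /= addrC cosDpi ltrNl -cospi ltr_cos//
    in_itv /= ?pi_ge0 ?lexx ?(ltW e0) ?(ltW epi)//.
exists (moebius K (cis (pi + e))); split.
- by move=> s s01; split; [exact: moebius_unitop|exact: moebius_near_id].
- by move=> y; exact: moebius0.
- by move=> y; exact: moebius1.
- by move=> s0 r; exact: moebius_near.
Qed.

End Small.

(** * Lagrangian subspaces and the Souriau map *)

Section Lagr.
Local Open Scope complex_scope.
Variables (R : realType) (V : hilbert R).
Local Notation C := (complex R).
Local Notation ii := (Complex 0 1 : C).
Implicit Types (x y z : V) (T D : V -> V) (lam nu : set V).

(* rip (i x) y is the symplectic form. *)
Definition lagrangian lam := forall x, lam x <-> forall y, lam y ->
  rip (ii *: x) y = 0.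
Definition lproj lam x : V := xget 0 [set p | lam p /\ forall y, lam y ->
  rip (x - p) y = 0].
Definition refl lam x : V := 2%:C *: lproj lam x - x.
Definition souriau_op lam nu x : V := let y := refl lam x in y - 2%:C *: lproj nu
  y.

Lemma iiK x : ii *: (ii *: x) = - x.
Proof. by rewrite scalerA -expr2 sqr_i scaleN1r. Qed.

Lemma rip_ii x y : rip (ii *: x) (ii *: y) = rip x y.
Proof. by rewrite rip_Z /= expr0n expr1n add0r mul1r. Qed.

Lemma rip_skew x y : rip (ii *: x) y = - rip x (ii *: y).
Proof. by rewrite -[LHS]rip_ii iiK ripNl. Qed.

Lemma nrm_ii x : nrm (ii *: x) = nrm x.
Proof. by apply: eq_nrm; rewrite rip_ii. Qed.

Lemma rsubspace_iiZ r x : ii *: (r%:C *: x) = r%:C *: (ii *: x) :> V.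
Proof. by rewrite !scalerA mulrC. Qed.

Section OneLagr.
Variables (lam : set V) (Hl : lagrangian lam).

Lemma lagrangian_rsubspace : rsubspace lam.
Proof.
split; first by apply/Hl => y _; rewrite scaler0 rip0l.
move=> r x y /Hl lx /Hl ly; apply/Hl => z lz.
by rewrite scalerDr rsubspace_iiZ ripDl ripRl lx// ly// mulr0 addr0.
Qed.

Lemma orth_closed (A : set V) : hclosed [set x | forall y, A y -> rip x y = 0].
Proof.
move=> x cx y Ay; apply/eqP; rewrite -normr_le0.
apply: (@ler_archi _ _ _ (nrm y)) => n; rewrite add0r.
have [|z zA xz] := cx n.+1%:R^-1; first by rewrite invr_gt0 ltr0n.
rewrite -[rip x y]subr0 -(zA _ Ay) -ripBl (le_trans (rip_normM _ _))// mulrC.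
by rewrite ler_wpM2l ?nrm_ge0// ltW.
Qed.

Lemma lagrangian_closed : hclosed lam.
Proof.
move=> x cx; apply/Hl => y ly; rewrite rip_skew; apply/eqP; rewrite oppr_eq0;
  apply/eqP.
pose A := [set ii *: y].
have : hclosed [set x | forall y, A y -> rip x y = 0] by exact: orth_closed.
move=> /(_ x) h; apply: (h _ _ erefl) => e /cx[z lz xz]; exists z => // _ ->.
by apply/eqP; rewrite -oppr_eq0 -rip_skew; apply/eqP; exact: (Hl z).1.
Qed.

Lemma lprojP x : lam (lproj lam x) /\ forall y, lam y ->
  rip (x - lproj lam x) y = 0.
Proof.
rewrite /lproj; case: xgetP => [p _ //|nop].
by have [p lp px] := projection x lagrangian_rsubspace lagrangian_closed;
  have := nop p; case.
Qed.

Lemma lproj_uniq x p : lam p -> (forall y, lam y -> rip (x - p) y = 0) ->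
  lproj lam x = p.
Proof.
move=> lp px; have [lq qx] := lprojP x; apply/eqP; rewrite -subr_eq0 -rip_eq0.
have lqp : lam (lproj lam x - p) by apply: rsubspaceB => //;
  exact: lagrangian_rsubspace.
have {1}-> : lproj lam x - p = (x - p) - (x - lproj lam x) by rewrite opprB
  [RHS]addrC addrA subrK.
by rewrite ripBl px// qx// subr0.
Qed.

Lemma lproj_id x : lam x -> lproj lam x = x.
Proof. by move=> lx; apply: lproj_uniq => // y _; rewrite subrr rip0l. Qed.

Lemma orth_lagrangian x : (forall y, lam y -> rip x y = 0) <-> lam (ii *: x).
Proof.
split=> [xl|/Hl xl y ly]; first by apply/Hl => y ly; rewrite iiK ripNl xl// oppr0.
by have := xl y ly; rewrite iiK ripNl => /eqP; rewrite oppr_eq0 => /eqP.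
Qed.

Lemma refl_id x : lam x -> refl lam x = x.
Proof. by move=> lx; rewrite /refl lproj_id//
  rmorphD /= scalerDl scale1r addrK. Qed.

Lemma refl_orth x : lam (ii *: x) -> refl lam x = - x.
Proof.
move=> /orth_lagrangian lx; rewrite /refl (_ : lproj lam x = 0) ?scaler0 ?sub0r//.
by apply: lproj_uniq; [exact: lagrangian_rsubspace.1|move=> y ly;
  rewrite subr0 lx].
Qed.

Lemma rlin_lproj : rlinear (lproj lam).
Proof.
move=> r x y; have [lx px] := lprojP x; have [ly py] := lprojP y.
apply: lproj_uniq; first exact: lagrangian_rsubspace.2.
move=> z lz; rewrite opprD addrACA -scalerBr ripDl ripRl px// py//.
by rewrite mulr0 addr0.
Qed.

Lemma lproj_sym : rsym (lproj lam).
Proof.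
move=> x y; have [lx px] := lprojP x; have [ly py] := lprojP y.
have h1 := px _ ly; have h2 := py _ lx.
rewrite ripBl in h1; rewrite ripBl (ripC (lproj lam y)) in h2.
by rewrite (ripC (lproj lam x) y); lra.
Qed.

Lemma lproj_ii x : lproj lam (ii *: x) = ii *: (x - lproj lam x).
Proof.
have [lx px] := lprojP x; apply: lproj_uniq; first exact/orth_lagrangian.
by move=> y ly; rewrite -scalerBr subKr; exact: (Hl _).1 lx _ ly.
Qed.

Lemma lproj_nrm x : nrm (lproj lam x) <= nrm x.
Proof.
have [lx px] := lprojP x.
have h : rip x x = rip (lproj lam x) (lproj lam x) + rip (x - lproj lam x) (x -
  lproj lam x).
  have := px _ lx; move: (lproj lam x) => p;
    rewrite ripBl !ripBr !ripBl (ripC p x); lra.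
by rewrite ler_nrm h lerDl rip_ge0.
Qed.

Lemma refl_rlin : rlinear (refl lam).
Proof.
move=> r x y; rewrite /refl rlin_lproj scalerDr scalerBr !scalerA mulrC opprD.
by rewrite addrACA.
Qed.

Lemma reflK x : refl lam (refl lam x) = x.
Proof.
have [lx px] := lprojP x.
have -> : refl lam x = lproj lam x - (x - lproj lam x).
  by rewrite /refl rmorphD /= scalerDl scale1r opprB addrA.
rewrite (rlinB refl_rlin) refl_id// refl_orth; last exact/orth_lagrangian.
by rewrite opprK addrC subrK.
Qed.

Lemma refl_rip x y : rip (refl lam x) (refl lam y) = rip x y.
Proof.
have [lx px] := lprojP x; have [ly py] := lprojP y.
have := px _ ly; have := py _ lx.
rewrite /refl; move: (lproj lam x) (lproj lam y) => p q.
by rewrite !ripBl !ripBr !ripRl !ripRr (ripC q p) (ripC p y); lra.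
Qed.

Lemma refl_nrm x : nrm (refl lam x) = nrm x.
Proof. by apply: eq_nrm; rewrite refl_rip. Qed.

(** Multiplication by i exchanges lam with its orthogonal complement, the two eigenspaces of the
    reflection. Reflections are therefore antiunitary, and a product of two of them is unitary. *)
Lemma refl_ii x : refl lam (ii *: x) = - (ii *: refl lam x).
Proof.
rewrite /refl lproj_ii; move: (lproj lam x) => p.
rewrite -rsubspace_iiZ -scalerBr -scalerN; congr (_ *: _).
by rewrite opprB scalerBr rmorphD /= !scalerDl !scale1r addrAC addrK.
Qed.


Lemma refl_hp x y : hp (refl lam x) (refl lam y) = conjc (hp x y).
Proof.
rewrite !hp_rip refl_rip -[ii *: refl lam x]opprK -refl_ii ripNl refl_rip /=.
by rewrite opprK.
Qed.

Lemma refl_antilin a x y : refl lam (a *: x + y) = conjc a *: refl lam x + refl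
  lam y.
Proof.
rewrite (rlinD refl_rlin); congr (_ + _).
have aE (b : C) z : b *: z = (complex.Re b)%:C *: z + (complex.Im b)%:C *: (ii *:
  z).
  rewrite scalerA -scalerDl; congr (_ *: _).
  by apply/eqP; rewrite eq_complex /=; apply/andP; split; apply/eqP; ring.
rewrite (aE a) (aE (conjc a)) (rlinD refl_rlin) !(rlinZ refl_rlin) refl_ii
  scalerN.
by case: (a) => u v /=; rewrite rmorphN /= scaleNr.
Qed.

End OneLagr.

Lemma souriau_opE lam nu x : souriau_op lam nu x = - refl nu (refl lam x).
Proof. by rewrite /souriau_op /= {3}/refl opprB. Qed.

Lemma souriau_op_unitop lam nu : lagrangian lam -> lagrangian nu ->
  unitop (souriau_op lam nu).
Proof.
move=> ll ln; split.
- move=> a x y; rewrite !souriau_opE (refl_antilin ll) (refl_antilin ln) conjcK.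
  by rewrite opprD scalerN.
- by move=> x y; rewrite !souriau_opE hpNl hpNr opprK (refl_hp ln) (refl_hp ll)
  conjcK.
- by move=> y; exists (refl lam (refl nu (- y))); rewrite souriau_opE !reflK//
  opprK.
Qed.

(** Links the Fredholm condition at -1 with the difference of two projections. *)
Lemma souriau_op_plus lam nu x : lagrangian lam ->
  souriau_op lam nu x + x = 2%:C *: (lproj lam (refl lam x) - lproj nu (refl lam
    x)).
Proof.
move=> ll; rewrite -{2}(reflK ll x) /souriau_op /=; move: (refl lam x) => y.
by rewrite /refl scalerBr [y - _]addrC addrACA subrr addr0 addrC.
Qed.

Lemma souriau_op_comp lam mu nu x : lagrangian lam ->
  souriau_op mu nu x = souriau_op lam nu (refl lam (refl mu x)).
Proof. by move=> ll; rewrite !souriau_opE reflK. Qed.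

Lemma souriau_op_near lam nu nu' r : lagrangian lam -> 
  (forall x, nrm (lproj nu x - lproj nu' x) <= r * nrm x) ->
  near_op (2 * r) (souriau_op lam nu) (souriau_op lam nu').
Proof.
move=> ll nn x; rewrite /souriau_op /=; have := nn (refl lam x);
  rewrite (refl_nrm ll).
move: (refl lam x) => y h.
rewrite opprB addrC addrA subrK -scalerBr nrm_R ger0_norm// nrmC -mulrA.
by rewrite ler_pM2l.
Qed.

Section Fredholm.
Variables (lam nu : set V) (ll : lagrangian lam) (ln : lagrangian nu).
Let M : set V := [set x + y | x in nu & y in lam].

Lemma M_rsubspace : rsubspace M.
Proof.
split; first by exists 0; [exact: (lagrangian_rsubspace ln).1|exists 0;
  [exact: (lagrangian_rsubspace ll).1|rewrite addr0]].
move=> r _ _ [a na [b lb <-]] [c nc [d ld <-]].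
exists (r%:C *: a + c); first exact: (lagrangian_rsubspace ln).2.
exists (r%:C *: b + d); first exact: (lagrangian_rsubspace ll).2.
by rewrite scalerDr addrACA.
Qed.

Lemma M_l x : lam x -> M x.
Proof. by move=> lx; exists 0; [exact: (lagrangian_rsubspace ln).1|exists x =>
  //; rewrite add0r]. Qed.

Lemma M_n x : nu x -> M x.
Proof. by move=> nx; exists x => //; exists 0;
  [exact: (lagrangian_rsubspace ll).1|rewrite addr0]. Qed.

(** A vector orthogonal to both nu and lam becomes, after multiplication by i, an element of their
    intersection. *)
Lemma closed_sumE : hclosed M -> forall y,
  (forall z, lam z -> nu z -> rip y (ii *: z) = 0) -> M y.
Proof.
move=> cM y yz; have [p Mp yp] := projection y M_rsubspace cM.
suff /eqP : y - p = 0 by rewrite subr_eq0 => /eqP ->.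
have lq : lam (ii *: (y - p)) by apply/(orth_lagrangian ll) => z lz; apply/yp/M_l.
have nq : nu (ii *: (y - p)) by apply/(orth_lagrangian ln) => z nz; apply/yp/M_n.
apply/eqP; rewrite -rip_eq0 ripBr (yp _ Mp) subr0 ripC.
have := yz _ lq nq; rewrite iiK ripNr => /eqP; rewrite oppr_eq0 => /eqP ->.
by rewrite eqxx.
Qed.

(* If y is orthogonal to the intersection N of lam and nu and to i N, then y and
   i y lie in nu + lam, say y = b + a and i y = b' + a'. The vector u = a + i a'
   then satisfies P_lam u - P_nu u = y. So P_lam - P_nu maps onto the orthogonal
   complement of N + i N, and the uniform boundedness principle bounds it from
   below there. *)
Lemma closed_sum_fredholm_m1 n (v : 'I_n -> V) :
  (forall F : set V, (forall y, exists c, forall x, F x -> `|rip x y| <= c) ->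
     exists c, forall x, F x -> nrm x <= c) ->
  (forall x, lam x -> nu x -> exists a : 'I_n -> R, x = \sum_i (a i)%:C *: v i) ->
  (forall i, lam (v i)) -> hclosed M -> fredholm_m1 (souriau_op lam nu).
Proof.
move=> ubp vE vl cM; pose D x := lproj lam x - lproj nu x.
have Dlin : rlinear D.
  by move=> r x y; rewrite /D (rlin_lproj ll) (rlin_lproj ln) scalerBr opprD
    addrACA.
have Dsym : rsym D by move=> x y; rewrite ripBl ripBr (lproj_sym ll) (lproj_sym
  ln).
pose N := [set x | forall i, hp x (v i) = 0].
have NM x : N x -> M x.
  move=> Nx; apply: closed_sumE => // z lz nz; have [a ->] := vE z lz nz.
  apply: hp_eq0; rewrite hpZr; apply/eqP; rewrite mulf_eq0; apply/orP; right.
  apply/eqP/hp_eq0C; rewrite hp_suml big1// => i _.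
  by rewrite hpZl hp_eq0C ?mulr0.
have Nii x : N x -> N (ii *: x) by move=> Nx i; rewrite hpZl Nx mulr0.
have surj y : N y -> exists u, D u = y.
  move=> Ny; have [b nb [a la yE]] := NM _ Ny.
  have [b' nb' [a' la' yE']] := NM _ (Nii _ Ny).
  have yE2 : y = - (ii *: b') - ii *: a'.
    by rewrite -opprD -scalerDr yE' iiK opprK.
  exists (a + ii *: a'); have -> : D (a + ii *: a') = lproj lam (a + ii *: a') -
    lproj nu (a + ii *: a') by [].
  have -> : lproj lam (a + ii *: a') = a.
    apply: lproj_uniq => // z lz; rewrite addrC addKr; exact: (ll _).1 la' _ lz.
  have -> : lproj nu (a + ii *: a') = - b.
    apply: lproj_uniq => //.
      by have := rsubspaceZ (-1) (lagrangian_rsubspace ln) nb;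
        rewrite rmorphN1 scaleN1r.
    move=> z nz; have -> : a + ii *: a' - - b = - (ii *: b').
      by rewrite opprK addrAC [a + b]addrC yE yE2 subrK.
    by rewrite ripNl ((ln _).1 nb' _ nz) oppr0.
  by rewrite opprK addrC.
(* Modulo the span of v every y is some D u, so <x, y> = <D x, u> is bounded by |u| whenever |D x|
   <= 1: the set is weakly bounded, hence bounded. *)
have [c Fc] : exists c, forall x, N x -> nrm (D x) <= 1 -> nrm x <= c.
  have [|c Fc] := ubp [set x | N x /\ nrm (D x) <= 1]; last first.
    by exists c => x Nx Dx; apply: Fc.
  move=> y; have [p [b ->] py] := proj_span v y.
  have [u uE] := surj _ py; exists (nrm u) => x [Nx Dx].
  have xp : rip x (\sum_i b i *: v i) = 0.
    apply: hp_eq0; apply: hp_eq0C; rewrite hp_suml big1// => i _.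
    by rewrite hpZl hp_eq0C ?mulr0.
  have -> : rip x y = rip (D x) u.
    by rewrite Dsym uE ripBr xp subr0.
  by rewrite (le_trans (rip_normM _ _))// ler_piMl ?nrm_ge0.
pose c' := `|c| + 1; have c'0 : 0 < c' by rewrite ltr_wpDl.
have NZ r x : N x -> N (r%:C *: x) by move=> Nx i; rewrite hpZl Nx mulr0.
have Nc x : N x -> nrm x <= c' * nrm (D x).
  move=> Nx; apply: (@ler_archi _ _ _ c') => k; rewrite -mulrDr.
  have q0 : 0 < nrm (D x) + k.+1%:R^-1 by rewrite ltr_wpDl ?nrm_ge0//
    invr_gt0 ltr0n.
  (* The summand 1/(k+1) keeps the scaling legitimate when D x = 0. *)
  have := Fc _ (NZ (nrm (D x) + k.+1%:R^-1)^-1 _ Nx).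
  rewrite (rlinZ Dlin) !nrm_R ger0_norm ?invr_ge0 ?(ltW q0)//
    !(ler_pdivrMl _ _ q0).
  rewrite mulr1 lerDl invr_ge0 ler0n => /(_ isT)/le_trans; apply.
  rewrite mulrC ler_wpM2r ?(ltW q0)// (le_trans (ler_norm _))// lerDl ler01//.
exists (2 / c'); first by rewrite divr_gt0.
apply: fin_codim_sub (fin_codim_orth v) => x /= xv.
rewrite souriau_op_plus// nrm_R ger0_norm// -(refl_nrm ll x) -mulrA ler_pM2l//
  ler_pdivrMl//.
(* The [v i] lie in lam and are fixed by the reflection, which therefore preserves N. *)
apply: Nc => i; rewrite -(refl_id ll (vl i)) (refl_hp ll) xv.
by rewrite conjc0.
Qed.


Let T := souriau_op lam nu.

Lemma eigen_piP z : eigen T pi z <-> T z = - z.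
Proof.
have cp : cis pi = -1 :> C by rewrite /cis cospi sinpi; apply/eqP;
  rewrite eq_complex /= oppr0 !eqxx.
by rewrite /eigen /= cp scaleN1r.
Qed.

Lemma cap_eigen z : lam z -> nu z -> eigen T pi z.
Proof. by move=> lz nz; apply/eigen_piP; rewrite /T souriau_opE !refl_id. Qed.

(** T z = -z makes the two projections of m = [refl lam z] agree, so the components of m in lam and
    in i lam both come from the intersection. *)
Lemma eigen_cap z : eigen T pi z -> exists p q,
  [/\ lam p /\ nu p, lam q /\ nu q & z = p + ii *: q].
Proof.
move/eigen_piP => /eqP; rewrite -addr_eq0 /T souriau_op_plus//;
  set m := refl lam z => /eqP E.
have pE : lproj lam m = lproj nu m.
  apply/eqP; rewrite -subr_eq0 -nrm_eq0.
  by have := nrm_R (2 : R) (lproj lam m - lproj nu m); rewrite E nrm0 ger0_norm//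
    => /esym/eqP; rewrite mulf_eq0 pnatr_eq0.
have [lp pm] := lprojP ll m; have [np qm] := lprojP ln m.
have lq : lam (ii *: (m - lproj lam m)) by apply/(orth_lagrangian ll).
have nq : nu (ii *: (m - lproj lam m)) by rewrite pE; apply/(orth_lagrangian ln).
exists (lproj lam m), (ii *: (m - lproj lam m)); split => //; first by split =>
  //; rewrite pE.
rewrite iiK opprB; rewrite -(reflK ll z) -/m /refl rmorphD /= scalerDl scale1r.
by rewrite addrA.
Qed.

(** With L the intersection of lam and nu, the eigenspace at -1 is L + i L. Since -1 is isolated, T
    + Id maps the orthogonal complement N of this eigenspace onto itself, and values of T + Id are
    twice a difference of projections, hence in M. So N lies in M, and adding L gives all vectors
    orthogonal to i L. *)
Lemma fredholm_m1_closed_sum : fredholm_m1 T ->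
  (exists n, forall m (w : 'I_m -> V), (forall i, lam (w i) /\ nu (w i)) ->
     (forall a : 'I_m -> R, \sum_i (a i)%:C *: w i = 0 -> forall i, a i = 0) ->
       (m <= n)%N) /\
  (forall x, M x <-> forall z, lam z -> nu z -> rip x (ii *: z) = 0).
Proof.
move=> eT; have uT : unitop T := souriau_op_unitop ll ln.
have [e [/andP[e0 epi] fd er]] := fredholm_m1_gap uT eT.
have lamO y z : lam y -> lam z -> rip y (ii *: z) = 0.
  by move=> ly lz; rewrite ripC; exact: (ll _).1 lz _ ly.
have nuO y z : nu y -> nu z -> rip y (ii *: z) = 0.
  by move=> ly lz; rewrite ripC; exact: (ln _).1 lz _ ly.
split.
  exists (dim (eigen T pi)) => m w lw wi.
  have [v [vi vE]] := finite_dimE fd.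
  (* A complex relation splits as X + i Y = 0 with X and Y in lam; lam is orthogonal to i lam, so
     both vanish. *)
  have wi' : lin_indep w.
    move=> a a0 i; have lsum (b : 'I_m -> R) : lam (\sum_i (b i)%:C *: w i).
      elim/big_ind: _ => [|x y|j _]; first exact: (lagrangian_rsubspace ll).1.
        exact: (rsubspaceD (lagrangian_rsubspace ll)).
      by apply: (rsubspaceZ _ (lagrangian_rsubspace ll)); exact: (lw j).1.
    have := lsum (fun i => complex.Re (a i)); have := lsum (fun i =>
      complex.Im (a i)).
    set Y := \sum_i _; set X := \sum_i _ => lY lX.
    have XY : X + ii *: Y = 0.
      rewrite -a0 scaler_sumr -big_split; apply: eq_bigr => j _ /=.
      rewrite scalerA -scalerDl; congr (_ *: _).
      by apply/eqP; rewrite eq_complex /=; apply/andP; split; apply/eqP; ring.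
    have X0 : X = 0.
      apply/eqP; rewrite -rip_eq0; move/eqP: XY; rewrite addr_eq0 => /eqP {2}->.
      by rewrite ripNr lamO// oppr0.
    have Y0 : Y = 0.
      by apply/eqP; rewrite -nrm_eq0 -nrm_ii nrm_eq0 -[ii *: Y]add0r -{1}X0 XY.
    have := wi _ X0 i; have := wi _ Y0 i => /=.
    by case: (a i) => u q /= -> ->.
  apply: (lin_indep_size (v := v) wi') => i; rewrite -vE; apply: cap_eigen;
    by have [] := lw i.
have gapT : bounded_below [set x | forall y, eigen T pi y ->
  hp x y = 0] (fun x => T x - cis pi *: x).
  apply: isolated_bounded_below => //; exists e => // s /andP[s0 se]; apply: er.
  by rewrite s0 ltW.
pose N := [set x | forall y, eigen T pi y -> hp x y = 0].
pose S x := T x - cis pi *: x.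
have SE x : S x = T x + x.
  have cp : cis pi = -1 :> C by rewrite /cis cospi sinpi; apply/eqP;
    rewrite eq_complex /= oppr0 !eqxx.
  by rewrite /S cp scaleN1r opprK.
have Slin : linear S.
  by move=> a x y; rewrite !SE (unitop_lin uT) (scalerDr a (T x)) addrACA.
have Srlin := linear_rlinear Slin.
have Sbdd : hbounded S by exists 2 => x; rewrite SE (le_trans (nrmD _ _))//
  (unitop_nrm uT) mulr_natl mulr2n.
have sN : csubspace N.
  split; first by move=> y _; rewrite hp0l.
  by move=> a x y Nx Ny z Ez; rewrite hpPl Nx// Ny// mulr0 addr0.
have cN : hclosed N.
  move=> x cx y Ey; rewrite hp_rip.
  have h z : eigen T pi z -> rip x z = 0.
    move=> Ez; have := @orth_closed (eigen T pi) x; apply => // r /cx[u Nu xu].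
    by exists u => // u' Eu'; apply/hp_eq0/Nu.
  have Eiy : eigen T pi (ii *: y).
    by rewrite -[ii *: y]addr0; apply: (csubspace_eigen pi uT).2 => //;
      exact: (csubspace_eigen pi uT).1.
  by rewrite h// rip_skew h// !oppr0.
have cW : hclosed (S @` N) by apply: range_closed => //;
  exact: csubspace_rsubspace.
have sW : csubspace (S @` N).
  split; first by exists 0; [exact: sN.1|exact: (rlin0 Srlin)].
  by move=> a _ _ [x Nx <-] [y Ny <-]; exists (a *: x + y);
    [exact: sN.2|rewrite Slin].
have SN x y : eigen T pi y -> hp (S x) y = 0.
  move=> /eigen_piP Ey; rewrite SE hpDl -{1}[y]opprK -Ey hpNr (unitop_hp uT).
  by rewrite addNr.
have SW x : (S @` N) (S x).
  have [v [vi vE]] := finite_dimE fd.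
  have [p vp xp] := proj_span v x.
  have Sp : S p = 0.
    by rewrite SE; move: vp; rewrite -vE => /eigen_piP ->; rewrite addNr.
  exists (x - p); last by rewrite (rlinB Srlin) Sp subr0.
  move=> y; rewrite vE => -[a ->]; apply: hp_eq0C; rewrite hp_suml big1// => i _.
  by rewrite hpZl hp_eq0C ?mulr0.
have NW y : N y -> exists x, S x = y.
  (* The remainder y - p is orthogonal to the range of S, which forces it into the eigenspace at -1;
     there it is orthogonal to y and to p. *)
  move=> Ny; have [p Wp yp] := projection y (csubspace_rsubspace sW) cW.
  have [w wE] : exists w, T w = y - p by case: uT => _ _; apply.
  have Tw : T w = - w.
    apply: rip_eqP => x; have := yp _ (SW x);
      rewrite -wE SE ripDr (unitop_rip uT) ripNl.
    by move=> h; lra.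
  have Ey : eigen T pi (y - p) by apply/eigen_piP;
    rewrite -wE {1}Tw (rlinN (unitop_rlin uT)).
  move: Wp => [x _ xp]; exists x; rewrite xp; apply/esym/eqP;
    rewrite -subr_eq0 -rip_eq0.
  rewrite {1}ripBl (hp_eq0 (Ny _ Ey)) -xp sub0r oppr_eq0; apply/eqP/hp_eq0.
  by apply: SN; rewrite xp.
have NM y : N y -> M y.
  move=> /NW[x <-]; rewrite SE /T souriau_op_plus//; set m := refl lam x.
  have [lp _] := lprojP ll m; have [np _] := lprojP ln m.
  by apply: (rsubspaceZ 2 M_rsubspace); apply: (rsubspaceB M_rsubspace);
    [exact: M_l|exact: M_n].
move=> x; split=> [[b nb [a la <-]] z lz nz|xz].
  by rewrite ripDl (nuO b z nb nz) (lamO a z la lz) addr0.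
pose L := lam `&` nu.
have sL : rsubspace L.
  split; first by split; [exact: (lagrangian_rsubspace ll).1|exact:
    (lagrangian_rsubspace ln).1].
  by move=> r u v [lu nu'] [lv nv]; split;
    [exact: (lagrangian_rsubspace ll).2|exact: (lagrangian_rsubspace ln).2].
have cL : hclosed L.
  move=> u cu; split; [apply: (lagrangian_closed ll)|apply: (lagrangian_closed
    ln)] => r /cu[v [lv nv] uv];
    by exists v.
have [p [lp np] xp] := projection x sL cL.
rewrite -(subrK p x); apply: (rsubspaceD M_rsubspace); last exact: M_l.
apply: NM => n En.
have hn k : eigen T pi k -> rip (x - p) k = 0.
  move=> /eigen_cap[q [q' [Lq [lq' nq'] ->]]]; rewrite ripDr (xp _ Lq) add0r.
  by rewrite ripBl (xz _ lq' nq') (lamO _ _ lp lq') subr0.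
rewrite hp_rip hn// rip_skew hn ?oppr0//.
by rewrite -[ii *: n]addr0; apply: (csubspace_eigen pi uT).2 => //;
  exact: (csubspace_eigen pi uT).1.
Qed.

End Fredholm.

End Lagr.

(** * Fredholm pairs in H and the Souriau map near -1 *)

Section LagrangianBridge.
Local Open Scope complex_scope.
Variables (R : realType) (H : symplecticHilbert R).
Local Notation C := (complex R).
Local Notation K := (HJ H).
Local Notation V := (HJ_hilbert H).
Local Notation ii := (Complex 0 1 : C).

Lemma JE (x : K) : ii *: x = J H x :> K.
Proof.
by have := HJ_scaleE ii x; rewrite /= scale0r add0r scale1r.
Qed.

Lemma rscaleE (r : R) (x : K) : r%:C *: x = (r *: (x : carrier H)) :> K.
Proof. by have := HJ_scaleE r%:C x; rewrite /= scale0r addr0. Qed.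

Lemma Lagrangian_lagrangian (lam : set H) : Lagrangian lam -> @lagrangian R V lam.
Proof.
move=> Hl x; have E y : rip (ii *: x : V) y = omega H x y.
  by rewrite rip_HJ omega_compatible -JE.
split=> [lx y ly|h]; first by rewrite E; move: lx; rewrite {1}Hl; exact.
by rewrite Hl => y ly; rewrite -E; exact: h.
Qed.

Lemma projE (lam : set H) (x : H) : proj lam x = @lproj R V lam x.
Proof. by []. Qed.

Lemma souriauE (lam nu : set H) : souriau lam nu = @souriau_op R V lam nu.
Proof.
by apply/funext => x; rewrite /souriau /souriau_op /refl !rscaleE !projE.
Qed.

Lemma closed_hclosed (A : set H) : closed A <-> @hclosed R V A.
Proof.
split=> [cA x cx|cA x cx].
  apply: cA => B /nbhs_ballP[e /= e0 eB]; have [y Ay xy] := cx e e0.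
  exists y; split => //; apply: eB; rewrite -ball_normE /ball_ /=.
  by move: xy; rewrite nrmE_HJ.
apply: cA => e e0; have [y [Ay]] := cx _ (nbhsx_ballx x e e0).
rewrite -ball_normE /ball_ /= => xy; exists y => //.
by rewrite nrmE_HJ.
Qed.

Lemma bounded_family (F : set V) :
  (forall y, exists c, forall x, F x -> `|rip x y| <= c) ->
  exists c, forall x, F x -> nrm x <= c.
Proof.
move=> Fb; pose G := [set f : carrier H -> R^o | exists2 x, F x & f = fun y =>
  rip (x : V) y].
have /(_ 1)[c cG] : uniform_bounded G.
  apply: Banach_Steinhauss.
    move=> _ [x Fx ->]; split.
      move=> r; exists (nrm x * r) => y yr; rewrite (le_trans (rip_normM _ _))//.
      by rewrite ler_wpM2l ?nrm_ge0// nrmE_HJ.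
    move=> r y z; rewrite -[r *: y]rscaleE.
    by have := ripDr (r%:C *: (y : V)) (z : V) x; rewrite ripRr.
  by move=> y; have [c Fc] := Fb y; exists c => _ [x Fx ->]; exact: Fc.
exists `|c| => x Fx; have [->|x0] := eqVneq x 0; first by rewrite nrm0.
have nx0 : 0 < nrm x by rewrite nrm_gt0.
have := cG _ (ex_intro2 _ _ x Fx erefl) ((nrm x)^-1%:C *: x).
rewrite -nrmE_HJ nrm_R ger0_norm ?invr_ge0 ?nrm_ge0// mulVf ?gt_eqF// lexx.
rewrite ripRr -nrm2 expr2 mulKf ?gt_eqF// ger0_norm ?nrm_ge0// =>
  /(_ isT)/le_trans.
by apply; exact: ler_norm.
Qed.

(* If y ranges over a finite e-net of the image of the unit ball under U - Id and
   x is orthogonal to the vectors (U - Id)^* y, then (U - Id) x is orthogonal to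
   the net. *)
Lemma compact_near_id (U : K -> K) : unitary U ->
  compact_op (fun x : H => U x - x) -> @near_id R V U.
Proof.
move=> uU; rewrite /compact_op precompactE compact_cover => cU e e0.
have uU' := unitary_unitop uU; have [U' [uU'' UK UK']] := unitop_inv uU'.
have [||D _ DU] := cU (carrier H) setT (fun y => ball y e).
- by move=> y _; exact: ball_open.
- by move=> y _; exists y => //; exact: ballxx.
pose ys := finmap.enum_fset D.
pose v (i : 'I_(size ys)) : V := U' (nth 0 ys i) - nth 0 ys i.
apply: fin_codim_sub (fin_codim_orth v) => x xv /=.
have ort (y : V) : y \in ys -> rip (U x - x : V) y = 0.
  move=> yys; have iy : (index y ys < size ys)%N by rewrite index_mem.
  have vE : v (Ordinal iy) = U' y - y by rewrite /v /= nth_index.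
  have : hp (x : V) (v (Ordinal iy)) = 0 := xv (Ordinal iy).
  by rewrite vE hpBr -{1}(UK x) (unitop_hp uU'') -hpBl; exact: hp_eq0.
have [->|x0] := eqVneq x 0.
  by rewrite (rlin0 (unitop_rlin uU')) subrr nrm0 mulr0.
have nx0 : 0 < nrm x by rewrite nrm_gt0.
pose x1 : V := (nrm x)^-1%:C *: x.
have Ux1 : U x1 - x1 = (nrm x)^-1%:C *: (U x - x : V) :> V.
  by rewrite (unitopZ uU') scalerBr.
have : closure ((fun x : H => U x - x) @` [set x : H | `|x| <= 1]) (U x1 - x1).
  apply: subset_closure; exists x1 => //=.
  rewrite -nrmE_HJ nrm_R ger0_norm ?invr_ge0 ?nrm_ge0// mulVf//.
  by rewrite gt_eqF.
move=> /DU[y /= yD]; rewrite -ball_normE /ball_ /= => yx.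
have {}yx : nrm (y - (U x1 - x1) : V) < e by rewrite nrmE_HJ.
have o1 : rip (U x1 - x1 : V) (y : V) = 0 by rewrite Ux1 ripRl ort// mulr0.
(* u = U x1 - x1 is orthogonal to the net point y and within e of it, so |u|^2 = <u, u - y> <= e
   |u|. *)
have h : nrm (U x1 - x1 : V) <= e.
  have [->|u0] := eqVneq (U x1 - x1 : V) 0; first by rewrite nrm0 ltW.
  have nu0 : 0 < nrm (U x1 - x1 : V) by rewrite nrm_gt0.
  rewrite -(ler_pM2r nu0) -expr2 nrm2 mulrC.
  have := rip_le (U x1 - x1 : V) ((U x1 - x1) - y : V); rewrite ripBr o1 subr0 =>
    h1.
  by rewrite (le_trans h1)// ler_wpM2l ?nrm_ge0// nrmC ltW.
move: h; rewrite Ux1 nrm_R ger0_norm ?invr_ge0 ?nrm_ge0//.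
by rewrite ler_pdivrMl// mulrC.
Qed.

Lemma sum_rscaleE n (v : 'I_n -> carrier H) (a : 'I_n -> R) :
  \sum_i a i *: v i = \sum_i (a i)%:C *: (v i : V) :> carrier H.
Proof.
have : forall (s : seq 'I_n),
    \sum_(i <- s) a i *: v i = \sum_(i <- s) (a i)%:C *: (v i : V) :> carrier H.
  elim=> [|i s IH]; first by rewrite !big_nil.
  by rewrite !big_cons IH rscaleE.
by move=> ->.
Qed.

Lemma Fredholm_fredholm_m1 (lam nu : set H) : Lagrangian lam -> Lagrangian nu ->
  Fredholm_pair nu lam -> @fredholm_m1 R V (@souriau_op R V lam nu).
Proof.
move=> Ll Ln [[n [v [vi vE]]] /closed_hclosed cM _].
have ll := Lagrangian_lagrangian Ll; have ln := Lagrangian_lagrangian Ln.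
apply: (@closed_sum_fredholm_m1 R V lam nu ll ln n v) => //.
- exact: bounded_family.
- move=> x lx nx; have : (nu `&` lam) x by [].
  by rewrite vE => -[a ->]; exists a; rewrite sum_rscaleE.
move=> i; have : (nu `&` lam) (v i) by rewrite vE; exact: span_mem.
by case.
Qed.

Lemma fredholm_m1_Fredholm (lam nu : set H) : Lagrangian lam -> Lagrangian nu ->
  @fredholm_m1 R V (@souriau_op R V lam nu) -> Fredholm_pair nu lam.
Proof.
move=> Ll Ln eT.
have ll := Lagrangian_lagrangian Ll; have ln := Lagrangian_lagrangian Ln.
have [[n nb] ME] := fredholm_m1_closed_sum ll ln eT.
have fd : finite_dim (nu `&` lam).
  have [||m w wi wl|m _ ?] := @finite_dim_bounded _ (carrier H) (nu `&` lam) n;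
    last by exists m.
  - by split; [exact: (lagrangian_rsubspace ln).1|exact: (lagrangian_rsubspace
    ll).1].
  - move=> a x y [nx lx] [ny ly].
    have := (lagrangian_rsubspace ln).2 a _ _ nx ny;
      have := (lagrangian_rsubspace ll).2 a _ _ lx ly.
    by rewrite /= !rscaleE.
  apply: (nb m w) => [i|a a0]; first by have [] := wl i.
  by apply: wi; rewrite sum_rscaleE.
split => //.
  apply/closed_hclosed => x cx; apply/ME => z lz nz.
  have := @orth_closed R V [set ii *: z] x; apply => // e /cx[y My xy].
  by exists y => // _ ->; exact: (ME y).1.
have JJ (x : K) : ii *: (ii *: (x : V)) = - x by exact: iiK.
(* W is i times the intersection, that is, the orthogonal complement of the sum; its dimension is
   the codimension sought. *)
pose W : set H := [set x | nu (ii *: (x : V)) /\ lam (ii *: (x : V))].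
have sW : @rsubspace R V W.
  split; first by split; rewrite scaler0;
    [exact: (lagrangian_rsubspace ln).1|exact: (lagrangian_rsubspace ll).1].
  by move=> r x y [nx lx] [ny ly]; split; rewrite scalerDr rsubspace_iiZ;
    [exact: (lagrangian_rsubspace ln).2|exact: (lagrangian_rsubspace ll).2].
have cW : @hclosed R V W.
  move=> x cx; split; [apply: (lagrangian_closed ln)|apply: (lagrangian_closed
    ll)] => e /cx[y [ny ly] xy];
    by exists (ii *: y) => //; rewrite -scalerBr nrm_ii.
exists W.
  have [n' [v [vi vE]]] := fd.
  have nl i : nu (v i) /\ lam (v i).
    by have : (nu `&` lam) (v i) by rewrite vE; exact: span_mem.
  have Jsum (a : 'I_n' -> R) : ii *: (\sum_i a i *: J H (v i) : V) = - (\sum_i a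
    i *: v i : V).
    rewrite (sum_rscaleE (fun i => J H (v i))) (sum_rscaleE v) scaler_sumr -sumrN.
    by apply: eq_bigr => i _; rewrite rsubspace_iiZ -(JE (v i)) JJ scalerN.
  exists n', (fun i => J H (v i)); split.
    move=> a a0; apply: vi; apply/eqP; rewrite -oppr_eq0 -[- _]Jsum a0 scaler0.
    exact: eqxx.
  apply/seteqP; split => x.
    move=> [nx lx]; have : (nu `&` lam) (- (ii *: (x : V))).
      split; [have := rsubspaceZ (-1) (lagrangian_rsubspace ln) nx|have :=
        rsubspaceZ (-1) (lagrangian_rsubspace ll) lx];
        by rewrite rmorphN1 scaleN1r.
    rewrite vE => -[a aE]; exists a.
    have ii0 : ii != 0 by rewrite eq_complex /= oner_eq0 andbF.
    by apply: (@scalerI _ V _ ii0); rewrite Jsum -[X in - X]aE opprK.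
  move=> [a ->]; rewrite /W /= Jsum.
  have [na la] : (nu `&` lam) (\sum_i a i *: v i) by rewrite vE; exists a.
  split; [have := rsubspaceZ (-1) (lagrangian_rsubspace ln) na|have := rsubspaceZ
    (-1) (lagrangian_rsubspace ll) la];
    by rewrite rmorphN1 scaleN1r.
apply/seteqP; split => // x _; have [p Wp xp] := @projection R V W x sW cW.
exists (x - p); last by exists p => //; rewrite subrK.
apply/ME => z lz nz; apply: xp; split; rewrite iiK.
  by have := rsubspaceZ (-1) (lagrangian_rsubspace ln) nz;
    rewrite rmorphN1 scaleN1r.
by have := rsubspaceZ (-1) (lagrangian_rsubspace ll) lz;
  rewrite rmorphN1 scaleN1r.
Qed.

End LagrangianBridge.

(** * The product of two Lagrangian reflections *)

Section Reflections.
Local Open Scope complex_scope.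
Variables (R : realType) (V : hilbert R).
Local Notation C := (complex R).
Implicit Types (x y z : V) (T D : V -> V) (lam nu mu : set V).

(** Conjugating the coordinates of f o T restores linearity. *)
Lemma fin_codim_antipreim P T : (forall a x y,
  T (a *: x + y) = conjc a *: T x + T y) ->
  fin_codim P -> fin_codim (T @^-1` P).
Proof.
move=> lT [n [f [lf fP]]]; exists n, (fun x => map_mx (@conjc R) (f (T x))).
split => [a x y|x fx].
  by apply/rowP => i; rewrite lT lf !mxE rmorphD rmorphM /= conjcK.
apply: fP; apply/rowP => i; move/rowP: fx => /(_ i); rewrite !mxE => /eqP.
by rewrite conjc_eq0 => /eqP.
Qed.

Lemma refl2_unitop lam mu : lagrangian lam -> lagrangian mu -> unitop (fun x =>
  refl lam (refl mu x)).
Proof.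
move=> ll lm; split.
- by move=> a x y; rewrite (refl_antilin lm) (refl_antilin ll) conjcK.
- by move=> x y; rewrite (refl_hp ll) (refl_hp lm) conjcK.
- by move=> y; exists (refl mu (refl lam y)); rewrite !reflK.
Qed.

(** The reflection in mu is the conjugate by U of the one in lam. With W = [refl lam] o U^-1, the
    product minus Id is [refl lam] (U - Id) W minus (U - Id) U^-1, and each term is small on a
    subspace of finite codimension. *)
Lemma refl2_near_id lam mu U : lagrangian lam -> lagrangian mu -> unitop U ->
  near_id U ->
  mu = U @` lam -> near_id (fun x => refl lam (refl mu x)).
Proof.
move=> ll lm uU sU muE; have [U' [uU' UK UK']] := unitop_inv uU.
have prE x : lproj mu x = U (lproj lam (U' x)).
  have [lp px] := lprojP ll (U' x).
  apply: lproj_uniq => //; first by rewrite muE; exists (lproj lam (U' x)).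
  move=> y; rewrite muE => -[z lz <-].
  by rewrite -{1}(UK' x) -(unitopB uU) (unitop_rip uU) px.
have rfE x : refl mu x = U (refl lam (U' x)).
  by rewrite /refl prE (unitopB uU) (unitopZ uU) UK'.
move=> e e0; have e20 : 0 < e / 2 by rewrite divr_gt0.
pose W x := refl lam (U' x).
have aW a x y : W (a *: x + y) = conjc a *: W x + W y.
  by rewrite /W (unitop_lin uU') (refl_antilin ll).
apply: fin_codim_sub (fin_codimI (fin_codim_antipreim aW (sU _ e20))
  (fin_codim_preim (unitop_lin uU') (sU _ e20))).
move=> x [/= h1 h2]; rewrite rfE -/(W x).
have -> : refl lam (U (W x)) - x = refl lam (U (W x) - W x) - (U (U' x) - U' x).
  by rewrite (rlinB (refl_rlin ll)) {3}/W reflK// UK' opprB addrA subrK.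
rewrite (le_trans (nrmB _ _))// (refl_nrm ll) [e]splitr mulrDl lerD//.
  by rewrite (le_trans h1)// /W (refl_nrm ll) (unitop_nrm uU').
by rewrite (le_trans h2)// (unitop_nrm uU').
Qed.

Lemma refl2_near_id_sym lam mu : lagrangian lam -> lagrangian mu ->
  near_id (fun x => refl lam (refl mu x)) -> near_id (fun x =>
    refl mu (refl lam x)).
Proof.
move=> ll lm s e e0; apply: fin_codim_sub (s _ e0) => x /=.
rewrite -[X in _ -> X <= _](refl_nrm lm) -[X in _ -> X <= _](refl_nrm ll).
rewrite (rlinB (refl_rlin lm)) (rlinB (refl_rlin ll)) !reflK// nrmC.
by [].
Qed.

Lemma unitary_path_comp (d : R -> V -> V) K : unitary_path d -> unitop K ->
  unitary_path (fun t => d t \o K).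
Proof.
move=> [ud cd] uK; split=> [t /ud ?|t t01 r r0]; first exact: unitop_comp.
have [e e0 he] := cd t t01 r r0; exists e => // s s01 st x.
by rewrite /= -(unitop_nrm uK x); exact: he.
Qed.

End Reflections.

(** * Lagrangian curves as norm-continuous paths of unitaries *)

Section Curves.
Local Open Scope complex_scope.
Variables (R : realType) (H : symplecticHilbert R).
Local Notation V := (HJ_hilbert H).

Lemma FLambdaE (lam nu : set H) : Lagrangian lam ->
  FLambda lam nu <-> Lagrangian nu /\ @fredholm_m1 R V (@souriau_op R V lam nu).
Proof.
move=> Ll; split=> -[Ln F]; split => //.
  exact: Fredholm_fredholm_m1.
exact: fredholm_m1_Fredholm.
Qed.

Lemma lag_dist_le (mu nu : set H) : Lagrangian mu -> Lagrangian nu ->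
  forall x : V, nrm (@lproj R V mu x - @lproj R V nu x) <= lag_dist mu nu * nrm x.
Proof.
move=> Lm Ln x; have lm := Lagrangian_lagrangian Lm;
  have ln := Lagrangian_lagrangian Ln; rewrite /lag_dist /opnorm.
set A := [set _ | _ in _].
have bA : has_ubound A.
  exists 2 => _ [y /= y1 <-]; rewrite -nrmE_HJ in y1; rewrite -nrmE_HJ.
  rewrite (le_trans (nrmB _ _))//.
  have := lproj_nrm lm y; have := lproj_nrm ln y; lra.
have [->|x0] := eqVneq x 0.
  by rewrite (rlin0 (rlin_lproj lm)) (rlin0 (rlin_lproj ln)) subrr nrm0 mulr0.
have nx0 : 0 < nrm x by rewrite nrm_gt0.
rewrite -ler_pdivrMr// mulrC; apply: sup_ubound => //.
exists ((nrm x)^-1%:C *: x) => /=.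
  by rewrite -nrmE_HJ nrm_R ger0_norm ?invr_ge0 ?nrm_ge0// mulVf// gt_eqF.
rewrite -nrmE_HJ; set k := (nrm x)^-1.
have E : @lproj R V mu (k%:C *: x) - @lproj R V nu (k%:C *: x) = k%:C *: (@lproj
  R V mu x - @lproj R V nu x) :> V.
  by rewrite (rlinZ (rlin_lproj lm)) (rlinZ (rlin_lproj ln)) scalerBr.
apply: etrans (congr1 (@nrm R V) E) _.
by rewrite nrm_R ger0_norm// invr_ge0 nrm_ge0.
Qed.

Lemma FLambda_curve_unitary_path (lam : set H) (c : R ->
  set H) : Lagrangian lam ->
  FLambda_curve lam c -> @unitary_path R V (fun t => @souriau_op R V lam (c t)).
Proof.
move=> Ll [cF cc]; have ll := Lagrangian_lagrangian Ll.
have Lc t : 0 <= t <= 1 -> Lagrangian (c t).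
  by move=> t01; have [] := cF t; rewrite ?in_itv.
split=> [t t01|t t01 r r0].
  by apply: souriau_op_unitop => //; exact: Lagrangian_lagrangian (Lc _ t01).
have /cvgrPdist_lt/(_ (r / 2)) := cc t ltac:(by rewrite in_itv).
rewrite divr_gt0// => /(_ isT) /nbhs_ballP[e /= e0 he].
exists e => // s s01 st; have := he s; rewrite -ball_normE /ball_ /= distrC =>
  /(_ st).
rewrite in_itv /= => /(_ s01); rewrite sub0r normrN => hs.
apply: (@near_op_le _ _ (2 * `|lag_dist (c s) (c t)|)); first by lra.
apply: souriau_op_near => // x; apply: le_trans (lag_dist_le (Lc _ s01) (Lc _
  t01) x) _.
by rewrite ler_wpM2r ?nrm_ge0// ler_norm.
Qed.

Lemma MasE (lam : set H) (c : R -> set H) : Lagrangian lam -> 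
  (forall t, 0 <= t <= 1 -> Lagrangian (c t)) ->
  Mas c lam = @maslov_index R V (fun t => @souriau_op R V lam (c t)).
Proof.
move=> Ll Lc; rewrite /Mas (_ : (fun t => souriau lam (c t)) = (fun t =>
  @souriau_op R V lam (c t))).
  apply: unitary_maslovE => t t01; apply: (@souriau_op_unitop R V).
    exact: Lagrangian_lagrangian.
  exact: Lagrangian_lagrangian (Lc _ t01).
by apply/funext => t; rewrite souriauE.
Qed.

End Curves.

Theorem proposition2p11 (R : realType) (H : symplecticHilbert R)
    (lam mu : set H) (U : HJ H -> HJ H) :
  Lagrangian lam -> Lagrangian mu ->
  unitary U -> compact_op (fun x : H => U x - x) -> mu = U @` lam ->
  FLambda lam = FLambda mu /\
  forall c c' : R -> set H,
    FLambda_curve lam c -> FLambda_curve lam c' ->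
    c 0 = c' 0 -> c 1 = c' 1 ->
    Mas c lam - Mas c mu = Mas c' lam - Mas c' mu.
Proof.
move=> Ll Lm uU cU muE.
have ll := Lagrangian_lagrangian Ll; have lm := Lagrangian_lagrangian Lm.
have sU := compact_near_id uU cU.
have sK := refl2_near_id ll lm (unitary_unitop uU) sU muE.
have sK' := refl2_near_id_sym ll lm sK.
have uK := refl2_unitop ll lm; have uK' := refl2_unitop lm ll.
have sourK nu : @souriau_op R (HJ_hilbert H) mu nu = @souriau_op R (HJ_hilbert H)
  lam nu \o (fun x => @refl R (HJ_hilbert H) lam (@refl R (HJ_hilbert H) mu x)).
  by apply/funext => x; rewrite /= -souriau_op_comp.
have sourK' nu : @souriau_op R (HJ_hilbert H) lam nu = @souriau_op R (HJ_hilbert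
  H) mu nu \o (fun x => @refl R (HJ_hilbert H) mu (@refl R (HJ_hilbert H) lam x)).
  by apply/funext => x; rewrite /= -souriau_op_comp.
have Sl nu : Lagrangian nu -> unitop (@souriau_op R (HJ_hilbert H) lam nu).
  by move=> Ln; apply: souriau_op_unitop ll (Lagrangian_lagrangian Ln).
have Sm nu : Lagrangian nu -> unitop (@souriau_op R (HJ_hilbert H) mu nu).
  by move=> Ln; apply: souriau_op_unitop lm (Lagrangian_lagrangian Ln).
have FE : FLambda lam = FLambda mu.
  apply/seteqP; split => nu.
    case/(FLambdaE nu Ll) => Ln en; apply/(FLambdaE nu Lm); split;
      first exact: Ln.
    rewrite sourK; exact: fredholm_m1_comp (Sl _ Ln) uK en sK.
  case/(FLambdaE nu Lm) => Ln en; apply/(FLambdaE nu Ll); split; first exact: Ln.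
  rewrite sourK'; exact: fredholm_m1_comp (Sm _ Ln) uK' en sK'.
split; first exact: FE.
move=> c c' Fc Fc' c0 c1.
have Lc t : 0 <= t <= 1 -> Lagrangian (c t).
  by move=> t01; have [] := Fc.1 t; rewrite ?in_itv.
have Lc' t : 0 <= t <= 1 -> Lagrangian (c' t).
  by move=> t01; have [] := Fc'.1 t; rewrite ?in_itv.
have ec t : 0 <= t <= 1 -> @fredholm_m1 R (HJ_hilbert H) (@souriau_op R
  (HJ_hilbert H) lam (c t)).
  by move=> t01; have /FLambdaE[] // := Fc.1 t ltac:(by rewrite in_itv).
have ec' t : 0 <= t <= 1 -> @fredholm_m1 R (HJ_hilbert H) (@souriau_op R
  (HJ_hilbert H) lam (c' t)).
  by move=> t01; have /FLambdaE[] // := Fc'.1 t ltac:(by rewrite in_itv).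
(* Regrouped so that each side compares c with c' for one fixed Lagrangian: lam is the start of the
   homotopy, mu its end. *)
rewrite (MasE Ll Lc) (MasE Lm Lc) (MasE Ll Lc') (MasE Lm Lc'); apply: subr_swap.
have [Ks [Ksu Ks0 Ks1 Ksc]] := near_id_path uK sK.
have pc := FLambda_curve_unitary_path Ll Fc;
  have pc' := FLambda_curve_unitary_path Ll Fc'.
pose d s t := @souriau_op R (HJ_hilbert H) lam (c t) \o Ks s.
pose d' s t := @souriau_op R (HJ_hilbert H) lam (c' t) \o Ks s.
have -> : (fun t => @souriau_op R (HJ_hilbert H) lam (c t)) = d 0.
  by apply/funext => t; apply/funext => x; rewrite /d /= Ks0.
have -> : (fun t => @souriau_op R (HJ_hilbert H) lam (c' t)) = d' 0.
  by apply/funext => t; apply/funext => x; rewrite /d' /= Ks0.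
have -> : (fun t => @souriau_op R (HJ_hilbert H) mu (c t)) = d 1.
  by apply/funext => t; apply/funext => x; rewrite sourK /d /= Ks1.
have -> : (fun t => @souriau_op R (HJ_hilbert H) mu (c' t)) = d' 1.
  by apply/funext => t; apply/funext => x; rewrite sourK /d' /= Ks1.
apply: mas_homotopy.
- by move=> s /Ksu[? ?]; exact: unitary_path_comp.
- by move=> s /Ksu[? ?]; exact: unitary_path_comp.
- by move=> s t /Ksu[us ss] t01; exact: fredholm_m1_comp (Sl _ (Lc _ t01)) us (ec
  _ t01) ss.
- by move=> s t /Ksu[us ss] t01; exact: fredholm_m1_comp (Sl _ (Lc' _ t01)) us
  (ec' _ t01) ss.
- by move=> s; rewrite /d /d' c0.
- by move=> s; rewrite /d /d' c1.
(* Composing on the left with a unitary preserves distances, so one h works for all t and for both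
   curves. *)
move=> s r s01 r0; have [h h0 hs] := Ksc s r s01 r0; exists h => //
  s' s'01 ss t t01.
have [ut _] := pc; have [ut' _] := pc'.
split=> x; rewrite /d /d' /=.
  by rewrite -(unitopB (ut t t01)) (unitop_nrm (ut t t01)); exact: hs.
by rewrite -(unitopB (ut' t t01)) (unitop_nrm (ut' t t01)); exact: hs.
Qed.
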